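(* Let $(F,f)\colon (L'\rightrightarrows L'_N; H\rightrightarrows N) \to (L\rightrightarrows L_M; G\rightrightarrows M)$ be a VB-Morita map between LBGs, let $\theta\in\Omega^1(M,L_M)$ be such that $\partial\theta=0$, and let $\nabla$ be a connection on $L_M$. Set $\theta' = F^\ast \theta \in \Omega^1 (N, L'_N)$ and let $\nabla' = f^\ast \nabla$ be the pullback connection on $L'_N$. Then the Morita curvatures of $\theta'$ and $\theta$ (with respect to $\nabla'$ and $\nabla$, respectively) at the points $y\in N$ and $f(y)\in M$ are related by quasi-isomorphisms.
   Context: Manifolds and maps are smooth; Lie groupoids are Hausdorff. For a Lie groupoid $G\rightrightarrows M$ write $s,t$ for source and target; $M$ is identified with the units; $A=\ker(ds)|_M$ is the Lie algebroid and $\rho=dt|_A\colon A\to TM$ the anchor. A Lie groupoid morphism $f\colon(H\rightrightarrows N)\to(G\rightrightarrows M)$ (same letter on arrows and objects) is a Morita map if (i) $H$ is, via $f$ and $(s,t)$, the fibre product of $(s,t)\colon G\to M\times M$ and $f\times f\colon N\times N\to M\times M$, and (ii) $\{(g,y)\in G\times N: s(g)=f(y)\}\to M$, $(g,y)\mapsto t(g)$, is a surjective submersion. A VB-groupoid (VBG) $(V\rightrightarrows V_M;G\rightrightarrows M)$ consists of Lie groupoids $V\rightrightarrows V_M$, $G\rightrightarrows M$ and vector bundles $V\to G$, $V_M\to M$ such that all structure maps of $V$ are vector bundle (VB) morphisms covering those of $G$. A VBG morphism $(F,f)$ consists of Lie groupoid morphisms $F\colon(W\rightrightarrows W_N)\to(V\rightrightarrows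 V_M)$, $f\colon(H\rightrightarrows N)\to(G\rightrightarrows M)$ with $F$ a VB morphism over $f$ on arrows and on objects; it is a VB-Morita map if $F$ is a Morita map. A line bundle-groupoid (LBG) is a VBG $(L\rightrightarrows L_M;G\rightrightarrows M)$ with $L\to G$, $L_M\to M$ line bundles; its structure maps are then fibrewise isomorphisms, and $G$ acts on $L_M$ by $g.\lambda=t(s_g^{-1}(\lambda))$, $s_g\colon L_g\to L_{M,s(g)}$. VB-Morita maps between LBGs are fibrewise isomorphisms. For a fibrewise isomorphism $(F,f)\colon(E\to X)\to(E'\to X')$ and $\theta\in\Omega^k(X',E')$ put $(F^*\theta)_x(v_1,\dots)=F_x^{-1}(\theta_{f(x)}(df(v_1),\dots))$. For $\theta\in\Omega^k(M,L_M)$, $\partial\theta=s^*\theta-t^*\theta\in\Omega^k(G,L)$. For a VB $E\to M$ put $E^\dagger=\operatorname{Hom}(E,L_M)$ (and analogously with $L'_N$ over $N$); $T^\dagger M=(TM)^\dagger$. For $a\in A_x$, the velocity at $\varepsilon=0$ of a curve $g(\varepsilon)\in s^{-1}(x)$ with $g(0)=x$, put $\mathcal D_a\lambda=\frac{d}{d\varepsilon}|_{\varepsilon=0}\,g(\varepsilon)^{-1}.\lambda_{t(g(\varepsilon))}$ for $\lambda\in\Gamma(L_M)$. Given a connection $\nabla$ on $L_M$, $F_\nabla(a)\lambda_x=\mathcal D_a\lambda-\nabla_{\rho(a)}\lambda$ defines a VB morphism $F_\nabla\colon A\to M\times\mathbb R$; $d^\nabla$ is the connection differential on $L_M$-valued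 forms. For $\theta\in\Omega^1(M,L_M)$ with $\partial\theta=0$, the Morita kernel at $x\in M$ is the complex $0\to A_x\xrightarrow{\rho}T_xM\xrightarrow{\theta}L_{M,x}\to0$ in degrees $-1,0,1$; its twisted dual is the complex $0\to\mathbb R\xrightarrow{\theta^\dagger}T_x^\dagger M\xrightarrow{\rho^\dagger}A_x^\dagger\to0$ in degrees $-1,0,1$ ($\theta^\dagger(r)=r\theta_x$, $\rho^\dagger(\psi)=\psi\circ\rho$, $\mathbb R=\operatorname{Hom}(L_{M,x},L_{M,x})$); the Morita curvature of $\theta$ at $x$ (with respect to $\nabla$) is the cochain map from the former to the latter given in degrees $-1,0,1$ by $-F_\nabla$, $v\mapsto d^\nabla\theta(v,-)$, $\lambda\mapsto(a\mapsto F_\nabla(a)\lambda)$. The same definitions apply to $\theta'$, $\nabla'$ on $(L'\rightrightarrows L'_N;H\rightrightarrows N)$. *)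

(* Defs.v *)
From HB Require Import structures.
From mathcomp Require Import all_boot all_order all_algebra.
From mathcomp Require Import all_classical all_reals all_analysis.
From mathcomp Require Import ring.
Set Implicit Arguments.
Unset Strict Implicit.
Unset Printing Implicit Defensive.
Import Order.TTheory GRing.Theory Num.Theory.
Import numFieldNormedType.Exports.
Local Open Scope classical_set_scope.
Local Open Scope ring_scope.

(* Throughout, vector spaces are lmodTypes over R and [hom U V] is the vector
   space of linear maps. *)
Section Subspaces.
Context {R : realType}.

Record subspace (V : lmodType R) := Subspace {
  ss_mem :> V -> Prop;
  ss_0 : ss_mem 0;
  ss_lin : forall a u v, ss_mem u -> ss_mem v -> ss_mem (a *: u + v) }.

Definition ss_pred V (S : subspace V) : {pred V} := fun v => `[< S v >].

Lemma ss_pred_closed V (S : subspace V) : submod_closed (ss_pred S).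
Proof.
split=> [|a u v]; rewrite !unfold_in; first exact/asboolP/ss_0.
by move=> /asboolP Su /asboolP Sv; apply/asboolP/ss_lin.
Qed.

HB.instance Definition _ V (S : subspace V) :=
  GRing.isSubmodClosed.Build R V (ss_pred S) (ss_pred_closed S).

Record subsp V (S : subspace V) := SubSp {
  ssval :> V; ssvalP : ssval \in ss_pred S }.

HB.instance Definition _ V (S : subspace V) := [isSub for @ssval V S].
HB.instance Definition _ V (S : subspace V) := [Choice of subsp S by <:].
HB.instance Definition _ V (S : subspace V) :=
  [SubChoice_isSubLmodule of subsp S by <:].

Lemma subspP V (S : subspace V) (v : subsp S) : S v.
Proof. by apply/asboolP; exact: (ssvalP v). Qed.

Definition mksub V (S : subspace V) v (Sv : S v) : subsp S :=
  SubSp (introT (asboolP _) Sv).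

Section Hom.
Variables U V : lmodType R.

Lemma hom_ss0 : linear (0 : U -> V).
Proof. by move=> a u v; rewrite scaler0 addr0. Qed.

Lemma hom_ss_lin a (f g : U -> V) :
  linear f -> linear g -> linear (a *: f + g : U -> V).
Proof.
move=> lf lg b u v; rewrite !fctE lf lg !scalerDr !scalerA [b * a]mulrC.
by rewrite !addrA; congr (_ + _); rewrite -!addrA; congr (_ + _); rewrite addrC.
Qed.

Definition hom_space : subspace (U -> V) :=
  Subspace (ss_mem := (fun f : U -> V => linear f)) hom_ss0 hom_ss_lin.

Definition hom := subsp hom_space.
HB.instance Definition _ := GRing.Lmodule.on hom.
Definition hom_fun (f : hom) : U -> V := ssval f.
Coercion hom_fun : hom >-> Funclass.
Lemma homP (f : hom) : linear f. Proof. exact: (subspP f). Qed.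
Definition mkhom (f : U -> V) (lf : linear f) : hom :=
  mksub (S := hom_space) lf.

End Hom.

End Subspaces.

Section HomOps.
Context {R : realType}.

Lemma hcomp_linear (U V W : lmodType R) (g : hom V W) (f : hom U V) :
  linear (g \o f).
Proof. by move=> a u v; rewrite /= (homP f) (homP g). Qed.
Definition hcomp (U V W : lmodType R) (g : hom V W) (f : hom U V) : hom U W :=
  mkhom (hcomp_linear g f).

Lemma hid_linear (U : lmodType R) : linear (@id U).
Proof. by []. Qed.
Definition hid (U : lmodType R) : hom U U := mkhom (@hid_linear U).

(* The inverse of f if f is an isomorphism, and 0 otherwise. *)
Definition hinv (U V : lmodType R) (f : hom U V) : hom V U :=
  xget 0 [set g : hom V U | cancel f g /\ cancel g f].

Lemma precomp_linear (U V W : lmodType R) (f : hom U V) :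
  linear (fun g : hom V W => hcomp g f).
Proof. by move=> a g h; apply: val_inj. Qed.
Definition precomp (U V : lmodType R) (W : lmodType R) (f : hom U V) :
  hom (hom V W) (hom U W) := mkhom (@precomp_linear U V W f).

Lemma postcomp_linear (U V W : lmodType R) (g : hom V W) :
  linear (fun f : hom U V => hcomp g f).
Proof.
by move=> a f h; apply: val_inj => /=; apply/funext => u /=; rewrite (homP g).
Qed.
Definition postcomp (U V W : lmodType R) (g : hom V W) :
  hom (hom U V) (hom U W) := mkhom (@postcomp_linear U V W g).

Lemma hscalel_linear (V : lmodType R) (v : V) :
  linear (fun r : R^o => r *: v).
Proof. by move=> a r s; rewrite scalerDl scalerA. Qed.
Definition hscalel (V : lmodType R) (v : V) : hom R^o V :=
  mkhom (hscalel_linear v).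

Lemma htensor_linear (U V : lmodType R) (f : hom U R^o) :
  linear (fun v : V => hcomp (hscalel v) f).
Proof.
move=> a v w; apply: val_inj => /=; apply/funext => u /=.
by rewrite !fctE /= scalerDr scalerA mulrC -scalerA.
Qed.
(* v |-> (u |-> f(u) v) *)
Definition htensor (U V : lmodType R) (f : hom U R^o) : hom V (hom U V) :=
  mkhom (@htensor_linear U V f).

Section Kernel.
Variables (U V : lmodType R) (f : hom U V).
Lemma ker0 : f 0 = 0.
Proof. by have := homP f (-1) 0 0; rewrite scaler0 addr0 scaleN1r addNr. Qed.
Lemma ker_lin (a : R) u v : f u = 0 -> f v = 0 -> f (a *: u + v) = 0.
Proof. by move=> fu fv; rewrite (homP f) fu fv scaler0 addr0. Qed.
Definition ker_space : subspace U :=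
  Subspace (ss_mem := fun u => f u = 0) ker0 ker_lin.
Definition ker := subsp ker_space.
HB.instance Definition _ := GRing.Lmodule.on ker.
Lemma ker_incl_linear : linear (fun u : ker => ssval u).
Proof. by []. Qed.
Definition ker_incl : hom ker U := mkhom ker_incl_linear.
End Kernel.

(* Complexes 0 -> C^{-1} -> C^0 -> C^1 -> 0, and degreewise linear maps. *)
Record cpx := Cpx {
  cpx_m1 : lmodType R; cpx_0 : lmodType R; cpx_1 : lmodType R;
  diff_m1 : hom cpx_m1 cpx_0; diff_0 : hom cpx_0 cpx_1 }.

Definition is_complex (C : cpx) := forall x, diff_0 C (diff_m1 C x) = 0.

Record cpx_map (C D : cpx) := CpxMap {
  map_m1 : hom (cpx_m1 C) (cpx_m1 D);
  map_0 : hom (cpx_0 C) (cpx_0 D);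
  map_1 : hom (cpx_1 C) (cpx_1 D) }.

Definition cpx_comp (C D E : cpx) (g : cpx_map D E) (f : cpx_map C D) :
  cpx_map C E :=
  CpxMap (hcomp (map_m1 g) (map_m1 f)) (hcomp (map_0 g) (map_0 f))
    (hcomp (map_1 g) (map_1 f)).

Definition is_cochain_map (C D : cpx) (f : cpx_map C D) :=
  (forall x, map_0 f (diff_m1 C x) = diff_m1 D (map_m1 f x)) /\
  (forall x, map_1 f (diff_0 C x) = diff_0 D (map_0 f x)).

(* The map ker o / im i -> ker o' / im i' induced by f is bijective. *)
Definition coh_bijective (A B C A' B' C' : lmodType R)
    (i : hom A B) (o : hom B C) (i' : hom A' B') (o' : hom B' C')
    (f : hom B B') :=
  (forall b, o b = 0 -> (exists a', f b = i' a') -> exists a, b = i a) /\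
  (forall b', o' b' = 0 -> exists b, o b = 0 /\ exists a', b' - f b = i' a').

Definition quasi_iso (C D : cpx) (f : cpx_map C D) :=
  [/\ is_complex C, is_complex D & is_cochain_map f] /\
  [/\ coh_bijective (0 : hom R^o _) (diff_m1 C) (0 : hom R^o _) (diff_m1 D)
        (map_m1 f),
      coh_bijective (diff_m1 C) (diff_0 C) (diff_m1 D) (diff_0 D) (map_0 f) &
      coh_bijective (diff_0 C) (0 : hom _ R^o) (diff_0 D) (0 : hom _ R^o)
        (map_1 f)].

End HomOps.
Arguments precomp {R U V} W f.
Arguments postcomp {R} U {V W} g.
Arguments htensor {R U} V f.
Arguments cpx : clear implicits.

Section SmoothCalculus.
Context {R : realType}.
Implicit Types V W : normedModType R.

(* Class C^k on an open set U. *)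
Fixpoint Ck (k : nat) V W (U : set V) (g : V -> W) : Prop :=
  if k is k'.+1 then
    (forall x, U x -> differentiable g x) /\ forall v, Ck k' U ('D_v g)
  else forall x, U x -> {for x, continuous g}.

Definition smooth_at V W (g : V -> W) (a : V) :=
  exists U : set V, [/\ open U, U a & forall k, Ck k U g].

Lemma near0_differentiable V W (h : V -> W) x :
  (\forall y \near x, h y = 0) -> differentiable h x.
Proof.
move=> hx; have h0 : h x = 0 by exact: nbhs_singleton hx.
have heq : h \o shift x = cst (h x) + (\0 : V -> W) +o_ 0 id.
  apply: eqaddoE; rewrite h0 -[LHS]add0r; congr (_ + _).
    by apply/funext => y; rewrite !fctE addr0.
  rewrite littleoE// => _/posnumP[e].
  move: hx; rewrite (near_shift 0 x) /= subr0 => hx.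
  near=> y; rewrite /= (_ : h (y + x) = 0) ?normr0 ?mulr_ge0//.
  by near: y; exact: hx.
have hd := @diff_unique _ V W h \0 x (@cst_continuous _ _ 0) heq.
apply/diff_locallyP; split; first by rewrite hd; exact: cst_continuous.
by rewrite hd.
Unshelve. all: by end_near. Qed.

Lemma near_eq_differentiable V W (f g : V -> W) x :
  (\forall y \near x, f y = g y) -> differentiable f x -> differentiable g x.
Proof.
move=> fg df; rewrite (_ : g = f + (g - f)); last by rewrite addrC subrK.
apply: differentiableD => //; apply: near0_differentiable.
by apply: filterS fg => y fgy; rewrite !fctE fgy subrr.
Qed.

Lemma Ck_cont k V W (U : set V) (g : V -> W) :
  Ck k U g -> forall x, U x -> {for x, continuous g}.
Proof.
by case: k => [//|k] [dg _] x Ux; exact/differentiable_continuous/dg.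
Qed.

Lemma CkW k V W (U : set V) (g : V -> W) : Ck k.+1 U g -> Ck k U g.
Proof.
elim: k g => [|k IH] g [dg Dg]; last by split=> // v; exact/IH/Dg.
by move=> x Ux; exact/differentiable_continuous/dg.
Qed.

Lemma Ck_sub k V W (U U' : set V) (g : V -> W) :
  U' `<=` U -> Ck k U g -> Ck k U' g.
Proof.
move=> s; elim: k g => [|k IH] g => [cg x /s/cg//|[dg Dg]].
by split=> [x /s/dg//|v]; exact/IH/Dg.
Qed.

Lemma Ck_eq k V W (U : set V) (f g : V -> W) : open U ->
  (forall x, U x -> f x = g x) -> Ck k U f -> Ck k U g.
Proof.
move=> oU; elim: k f g => [|k IH] f g fg.
  move=> cf x Ux; suff: g y @[y --> x] --> f x by rewrite (fg x Ux).
  apply: cvg_trans (cf x Ux); apply: near_eq_cvg.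
  by apply: filterS (open_nbhs_nbhs (conj oU Ux)) => y /fg.
move=> [df Df].
have nfg x : U x -> \forall y \near x, f y = g y.
  by move=> Ux; apply: filterS (open_nbhs_nbhs (conj oU Ux)) => y /fg.
split=> [x Ux|v]; first exact: near_eq_differentiable (nfg x Ux) (df x Ux).
by apply: IH (Df v) => x Ux; apply: near_eq_derive; exact: nfg.
Qed.

Lemma CkD k V W (U : set V) (f g : V -> W) : open U ->
  Ck k U f -> Ck k U g -> Ck k U (f + g).
Proof.
move=> oU; elim: k f g => [|k IH] f g.
  by move=> cf cg x Ux; apply: continuousD; [exact: cf|exact: cg].
move=> [df Df] [dg Dg]; split=> [x Ux|v].
  by apply: differentiableD; [exact: df|exact: dg].
apply: (Ck_eq oU) (IH _ _ (Df v) (Dg v)) => x Ux.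
by rewrite [RHS]deriveD//; apply: diff_derivable; [exact: df|exact: dg].
Qed.

Lemma Ck_cst k V W (U : set V) (w : W) : Ck k U (cst w : V -> W).
Proof.
elim: k w => [|k IH] w; first by move=> x _; exact: cst_continuous.
split=> // v; rewrite (_ : 'D_v _ = cst 0)//.
by apply/funext => x; rewrite derive_cst.
Qed.

Lemma CkM k V (U : set V) (f g : V -> R^o) : open U ->
  Ck k U f -> Ck k U g -> Ck k U (f \* g).
Proof.
move=> oU; elim: k f g => [|k IH] f g.
  by move=> cf cg x Ux; apply: continuousM; [exact: cf|exact: cg].
move=> fk gk; have [[df Df] [dg Dg]] := (fk, gk); split=> [x Ux|v].
  by apply: differentiableM; [exact: df|exact: dg].
have := CkD oU (IH _ _ (CkW fk) (Dg v)) (IH _ _ (CkW gk) (Df v)).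
apply: (Ck_eq oU) => x Ux; rewrite [RHS]deriveM//.
  by apply: diff_derivable; exact: df.
by apply: diff_derivable; exact: dg.
Qed.

Lemma Ck_sum k V W (U : set V) n (f : 'I_n -> V -> W) : open U ->
  (forall i, Ck k U (f i)) -> Ck k U (\sum_(i < n) f i).
Proof.
move=> oU fk; apply: (big_ind (fun h => Ck k U h)) => //.
  exact: (Ck_cst k U (0 : W)).
by move=> g h; exact: CkD.
Qed.

Lemma Ck_coord k V n (U : set V) (f : V -> 'rV[R]_n) i : open U ->
  Ck k U f -> Ck k U (fun x => f x 0 i : R^o).
Proof.
move=> oU; elim: k f => [|k IH] f.
  move=> cf x Ux; apply: (@continuous_comp _ _ _ f (fun M : 'rV[R]_n => M 0 i)).
    exact: cf.
  exact: coord_continuous.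
move=> [df Df]; split=> [x Ux|v].
  apply: (@differentiable_comp _ _ _ _ f (fun M : 'rV[R]_n => M 0 i : R^o)).
    exact: df.
  exact: differentiable_coord.
apply: (Ck_eq oU) (IH _ (Df v)) => x Ux.
by rewrite derive_mx ?mxE//; exact/diff_derivable/df.
Qed.

Lemma Ck_comp k V n (U : set V) (O : set 'rV[R]_n) (f : V -> 'rV[R]_n)
    (g : 'rV[R]_n -> R^o) : open U -> (forall x, U x -> O (f x)) ->
  Ck k U f -> Ck k O g -> Ck k U (g \o f).
Proof.
move=> oU fO; elim: k g => [|k IH] g.
  move=> cf cg x Ux; apply: continuous_comp; first exact: cf.
  exact: cg (fO x Ux).
move=> fk [dg Dg]; have [df Df] := fk; split=> [x Ux|v].
  by apply: differentiable_comp; [exact: df|exact/dg/fO].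
have H i : Ck k U ((fun x => ('D_v f x) 0 i : R^o) \*
                   ('D_(delta_mx 0 i) g \o f)).
  apply: CkM => //; first exact: Ck_coord (Df v).
  by apply: IH (Dg _); exact: CkW.
apply: (Ck_eq oU) (Ck_sum oU H) => x Ux.
have dgx : differentiable g (f x) by exact/dg/fO.
rewrite fct_sumE deriveE; last by apply: differentiable_comp => //; exact: df.
rewrite (diff_comp (df x Ux) dgx) /=.
rewrite -(deriveE v (df x Ux)) [X in 'd g _ X]row_sum_delta linear_sum.
by apply: eq_bigr => i _; rewrite linearZ /= (deriveE _ dgx).
Qed.

Lemma smooth_at_near V W (f g : V -> W) a :
  (\forall x \near a, f x = g x) -> smooth_at f a -> smooth_at g a.
Proof.
move=> fg [U [oU Ua fU]].
pose U' := [set x | f x = g x]^°.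
have oU' : open U' by exact: open_interior.
exists (U `&` U'); split=> [|//|k]; first exact: openI.
apply: (@Ck_eq _ _ _ _ f); first exact: openI.
  by move=> x [_ /interior_subset].
by apply: Ck_sub (fU k) => x [].
Qed.

Lemma smooth_atD V W (f g : V -> W) a :
  smooth_at f a -> smooth_at g a -> smooth_at (f + g) a.
Proof.
move=> [U [oU Ua fU]] [U2 [oO Oa gO]]; exists (U `&` U2); split=> [|//|k].
  exact: openI.
apply: CkD; first exact: openI.
  by apply: Ck_sub (fU k) => x [].
by apply: Ck_sub (gO k) => x [].
Qed.

Lemma smooth_atM V (f g : V -> R^o) a :
  smooth_at f a -> smooth_at g a -> smooth_at (f \* g) a.
Proof.
move=> [U [oU Ua fU]] [U2 [oO Oa gO]]; exists (U `&` U2); split=> [|//|k].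
  exact: openI.
apply: CkM; first exact: openI.
  by apply: Ck_sub (fU k) => x [].
by apply: Ck_sub (gO k) => x [].
Qed.

Lemma smooth_at_cst V W (w : W) a : smooth_at (cst w : V -> W) a.
Proof. by exists setT; split=> // [|k]; [exact: openT|exact: Ck_cst]. Qed.

Lemma smooth_at_comp V n (f : V -> 'rV[R]_n) (g : 'rV[R]_n -> R^o) a :
  smooth_at f a -> smooth_at g (f a) -> smooth_at (g \o f) a.
Proof.
move=> [U [oU Ua fU]] [U2 [oO Oa gO]].
have oUO : open (U `&` f @^-1` U2).
  rewrite openE => x [Ux Ofx]; apply: filterI.
    exact: open_nbhs_nbhs (conj oU Ux).
  by apply: (Ck_cont (fU 0%N) Ux); exact: open_nbhs_nbhs (conj oO Ofx).
exists (U `&` f @^-1` U2); split=> // k.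
by apply: (Ck_comp oUO _ _ (gO k)) => [x []//|]; apply: Ck_sub (fU k) => x [].
Qed.

End SmoothCalculus.

Section Manifolds.
Context {R : realType}.

Record chart (T : topologicalType) (n : nat) := Chart {
  cdom : set T;
  cmap :> T -> 'rV[R]_n;
  cinv : 'rV[R]_n -> T;
  cdom_open : open cdom;
  cimg_open : open (cmap @` cdom);
  cmapK : forall x, cdom x -> cinv (cmap x) = x;
  cmap_cont : forall x, cdom x -> {for x, continuous cmap};
  cinv_cont : forall x, cdom x -> {for cmap x, continuous cinv} }.

Definition compatible T n m (c : chart T n) (d : chart T m) :=
  forall x, cdom c x -> cdom d x ->
    smooth_at (d \o cinv c) (c x) /\ smooth_at (c \o cinv d) (d x).

Record manifold := Manifold {
  msort :> topologicalType;
  mdim : nat;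
  atlas : set (chart msort mdim);
  atlas_compat : forall c d, atlas c -> atlas d -> compatible c d;
  atlas_cover : forall x, exists2 c, atlas c & cdom c x;
  m_hausdorff : hausdorff_space msort;
  m_second_countable : @second_countable msort }.

(* Membership in the maximal atlas. *)
Definition admissible (M : manifold) n (c : chart M n) :=
  forall d, atlas (m := M) d -> compatible c d.

Definition smooth_fun (M : manifold) (h : M -> R) :=
  forall c, atlas (m := M) c -> forall x, cdom c x ->
    smooth_at (h \o cinv c : _ -> R^o) (c x).

Definition smooth_map (M N : manifold) (f : M -> N) :=
  forall x, {for x, continuous f} /\
    forall c d, atlas (m := M) c -> atlas (m := N) d -> cdom c x ->
      cdom d (f x) -> smooth_at (d \o f \o cinv c) (c x).

Record smap (M N : manifold) := SMap {
  smap_fun :> M -> N;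
  smapP : smooth_map smap_fun }.

Lemma smooth_fun_comp (M N : manifold) (f : smap M N) (h : N -> R) :
  smooth_fun h -> smooth_fun (h \o f).
Proof.
move=> hs c cA x cx; have [d dA dfx] := atlas_cover (f x).
have [cf sf] := smapP f x.
have ci : cinv c (c x) = x by exact: cmapK.
have cfi : {for c x, continuous (f \o cinv c)}.
  apply: (@continuous_comp _ _ _ (cinv c) f); first exact: cinv_cont.
  by rewrite ci.
have fx : (f \o cinv c) (c x) = f x by rewrite /= ci.
apply: (@smooth_at_near _ _ _ ((h \o cinv d) \o (d \o f \o cinv c))).
  have nd : nbhs ((f \o cinv c) (c x)) (cdom d).
    by rewrite fx; exact: open_nbhs_nbhs (conj (@cdom_open _ _ d) dfx).
  have nu : \forall u \near c x, cdom d (f (cinv c u)) by exact: cfi _ nd.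
  by apply: filterS nu => u du /=; rewrite cmapK.
apply: smooth_at_comp; first exact: sf.
by rewrite /= ci; exact: hs.
Qed.

Lemma smooth_fun_cst (M : manifold) (a : R) : smooth_fun (fun _ : M => a).
Proof. by move=> c cA x cx; exact: smooth_at_cst. Qed.

Lemma smooth_funD (M : manifold) (h1 h2 : M -> R) :
  smooth_fun h1 -> smooth_fun h2 -> smooth_fun (fun x => h1 x + h2 x).
Proof.
by move=> s1 s2 c cA x cx; exact: smooth_atD (s1 c cA x cx) (s2 c cA x cx).
Qed.

Lemma smooth_funM (M : manifold) (h1 h2 : M -> R) :
  smooth_fun h1 -> smooth_fun h2 -> smooth_fun (fun x => h1 x * h2 x).
Proof.
by move=> s1 s2 c cA x cx; exact: smooth_atM (s1 c cA x cx) (s2 c cA x cx).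
Qed.

(* A tangent vector is a derivation of the algebra of smooth functions; as a
   functional on all functions it is made to vanish on the non-smooth ones. *)
Section Tangent.
Variables (M : manifold) (x : M).

Definition derivation (v : (M -> R) -> R^o) :=
  [/\ forall h, ~ smooth_fun h -> v h = 0,
      forall (a : R) h1 h2, smooth_fun h1 -> smooth_fun h2 ->
        v (fun z => a * h1 z + h2 z) = a * v h1 + v h2 &
      forall h1 h2, smooth_fun h1 -> smooth_fun h2 ->
        v (fun z => h1 z * h2 z) = v h1 * h2 x + h1 x * v h2].

Lemma derivation0 : derivation 0.
Proof.
have E h : (0 : (M -> R) -> R^o) h = 0 by [].
split=> [//|a h1 h2 _ _|h1 h2 _ _]; rewrite !E; first by rewrite mulr0 addr0.
by rewrite mul0r mulr0 addr0.
Qed.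

Lemma derivation_lin a v w :
  derivation v -> derivation w -> derivation (a *: v + w).
Proof.
move=> [v0 vl vm] [w0 wl wm].
have E h : (a *: v + w) h = a * v h + w h by [].
split=> [h nh|b h1 h2 s1 s2|h1 h2 s1 s2]; rewrite !E.
- by rewrite v0// w0// mulr0 addr0.
- by rewrite vl// wl//; ring.
- by rewrite vm// wm//; ring.
Qed.

Definition tangent_space := Subspace derivation0 derivation_lin.
Definition tangent := subsp tangent_space.
HB.instance Definition _ := GRing.Lmodule.on tangent.
Definition tangent_fun (v : tangent) : (M -> R) -> R := ssval v.
Coercion tangent_fun : tangent >-> Funclass.
Lemma tangentP (v : tangent) : derivation v. Proof. exact: (subspP v). Qed.

End Tangent.

(* The differential of f at x, with values in T_y N for a given proof of
   f x = y; the explicit y avoids transport along identities such as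
   s(1_x) = x. *)
Section Differential.
Variables (M N : manifold) (f : smap M N) (x : M) (y : N) (fxy : f x = y).

Definition push (v : tangent x) : (N -> R) -> R^o :=
  fun h => if `[< smooth_fun h >] then v (h \o f) else 0.

Lemma push_smooth v h : smooth_fun h -> push v h = v (h \o f).
Proof. by move=> hs; rewrite /push; case: asboolP. Qed.

Lemma push_derivation (v : tangent x) : derivation y (push v).
Proof.
have [_ vl vm] := tangentP v.
split=> [h nh|a h1 h2 s1 s2|h1 h2 s1 s2]; first by rewrite /push; case: asboolP.
  rewrite !push_smooth//; last first.
    by apply: smooth_funD => //; apply: smooth_funM => //;
      exact: smooth_fun_cst.
  exact: (vl a _ _ (smooth_fun_comp f s1) (smooth_fun_comp f s2)).
rewrite !push_smooth//; last exact: smooth_funM.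
rewrite -fxy.
exact: (vm _ _ (smooth_fun_comp f s1) (smooth_fun_comp f s2)).
Qed.

Lemma push_linear :
  linear (fun v =>
    mksub (S := tangent_space y) (push_derivation v) : tangent y).
Proof.
move=> a v w; apply: val_inj => /=; apply/funext => h; rewrite !fctE /push.
by case: asboolP => _ //; rewrite scaler0 addr0.
Qed.

Definition tdiff_at : hom (tangent x) (tangent y) := mkhom push_linear.

End Differential.
Arguments tdiff_at {M N} f {x y} fxy.

Definition tdiff (M N : manifold) (f : smap M N) (x : M) :
  hom (tangent x) (tangent (f x)) := tdiff_at f (erefl (f x)).

Definition surj_submersion (M N : manifold) (f : smap M N) :=
  (forall y, exists x, f x = y) /\
  forall x (w : tangent (f x)), exists v : tangent x, tdiff f x v = w.

Definition is_fibre_product (X Y Z P : manifold) (f : smap X Z) (g : smap Y Z)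
    (p : smap P X) (q : smap P Y) :=
  (forall z, f (p z) = g (q z)) /\
  forall (W : manifold) (a : smap W X) (b : smap W Y),
    (forall w, f (a w) = g (b w)) ->
    exists! c : W -> P,
      smooth_map c /\ forall w, p (c w) = a w /\ q (c w) = b w.

Definition vector_field (M : manifold) (X : forall x : M, tangent x) :=
  forall h, smooth_fun h -> smooth_fun (fun x => X x h).

(* Z = [X, Y] *)
Definition is_bracket (M : manifold) (X Y Z : forall x : M, tangent x) :=
  forall h, smooth_fun h -> forall x,
    Z x h = X x (fun z => Y z h) - Y x (fun z => X z h).

Definition smooth_curve_at (M : manifold) (g : R -> M) (e : R) :=
  {for e, continuous g} /\
  forall c, atlas (m := M) c -> cdom c (g e) -> smooth_at (c \o g : R^o -> _) e.

Definition velocity (M : manifold) (g : R -> M) (e : R) (x : M)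
    (v : tangent x) :=
  forall h, smooth_fun h -> v h = derive1 (h \o g : R -> R^o) e.

End Manifolds.
Arguments tdiff_at {R M N} f {x y} fxy.
Arguments manifold : clear implicits.

Section VectorBundles.
Context {R : realType}.

(* A vector bundle of rank k: fibres [fib x], total space [tot], with
   [vin x v] the point v of the fibre over x. Local triviality asks for bundle
   charts, i.e. admissible charts of the total space of the form
   v |-> (c(x), tau_x(v)) with c an admissible chart of the base. *)
Record vbundle (k : nat) (M : manifold R) := VBundle {
  fib : M -> lmodType R;
  tot : manifold R;
  proj : smap tot M;
  vin : forall x, fib x -> tot;
  projE : forall x v, proj (@vin x v) = x;
  vin_inj : forall x, injective (@vin x);
  vin_surj : forall u, exists v, @vin (proj u) v = u;
  vb_trivial : forall x0 : M, exists (c : chart M (mdim M))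
      (C : chart tot (mdim M + k)) (tau : forall x, hom (fib x) 'rV[R]_k),
    [/\ admissible c, admissible C, cdom c x0,
        forall u, cdom C u <-> cdom c (proj u) &
        forall x, cdom c x -> bijective (tau x) /\
          forall v, C (@vin x v) = row_mx (c x) (tau x v)] }.
Arguments vin {k M} _ {x} _.

Definition section k (M : manifold R) (E : vbundle k M) :=
  forall x, fib E x.

Definition smooth_section k (M : manifold R) (E : vbundle k M)
    (l : section E) :=
  smooth_map (fun x => vin E (l x)).

Record vb_mor k l (M N : manifold R) (E : vbundle k M) (E' : vbundle l N)
    (f : smap M N) := VBMor {
  vb_fib : forall x, hom (fib E x) (fib E' (f x));
  vb_tot : smap (tot E) (tot E');
  vb_totE : forall x (v : fib E x), vb_tot (vin E v) = vin E' (vb_fib x v) }.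

Section Forms.
Variables (k : nat) (M : manifold R) (E : vbundle k M).

Definition form1 := forall x, hom (tangent x) (fib E x).

Definition smooth_form (th : form1) :=
  forall X, vector_field X -> smooth_section (fun x => th x (X x)).

(* Only the values nab x l for smooth sections l are constrained. *)
Record connection := Connection {
  nab :> forall x, section E -> hom (tangent x) (fib E x);
  nabD : forall x l1 l2, smooth_section l1 -> smooth_section l2 ->
    forall v, nab x (fun z => l1 z + l2 z) v = nab x l1 v + nab x l2 v;
  nab_leibniz : forall x h l, smooth_fun h -> smooth_section l ->
    forall v : tangent x,
      nab x (fun z => h z *: l z) v = v h *: l x + h x *: nab x l v;
  nab_smooth : forall X l, vector_field X -> smooth_section l ->
    smooth_section (fun x => nab x l (X x)) }.

(* The value at x of d^nabla theta is the bilinear map B with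
   B(X,Y) = nabla_X theta(Y) - nabla_Y theta(X) - theta([X,Y]). *)
Definition cov_diff (nabla : connection) (th : form1) (x : M) :
    hom (tangent x) (hom (tangent x) (fib E x)) :=
  xget (0 : hom (tangent x) (hom (tangent x) (fib E x)))
    [set B : hom (tangent x) (hom (tangent x) (fib E x)) |
    forall X Y Z, vector_field X -> vector_field Y ->
    vector_field Z -> is_bracket X Y Z ->
    (B (X x) : hom _ _) (Y x) = nabla x (fun z => th z (Y z)) (X x)
                    - nabla x (fun z => th z (X z)) (Y x) - th x (Z x)].

End Forms.

(* Pullbacks along a fibrewise isomorphism F; [hinv (vb_fib F y)] is then the
   inverse of F on the fibre over y. *)
Section Pullback.
Variables (k l : nat) (M N : manifold R) (E : vbundle k N) (E' : vbundle l M).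
Variables (f : smap N M) (F : vb_mor E E' f).

Definition pull_section (s : section E') : section E :=
  fun y => hinv (vb_fib F y) (s (f y)).

Definition pull_form (th : form1 E') : form1 E :=
  fun y => hcomp (hinv (vb_fib F y)) (hcomp (th (f y)) (tdiff f y)).

Definition is_pull_connection (nabla : connection E') (nabla' : connection E) :=
  forall s, smooth_section s -> forall y (v : tangent y),
    nabla' y (pull_section s) v
    = hinv (vb_fib F y) (nabla (f y) s (tdiff f y v)).

End Pullback.

End VectorBundles.
Arguments vin {R k M} _ {x} _.

Section Groupoids.
Context {R : realType}.

(* [gmul g h] is relevant only for composable arrows, gsrc g = gtgt h. *)
Record groupoid (G M : manifold R) := Groupoid {
  gsrc : smap G M;
  gtgt : smap G M;
  gunit : smap M G;
  ginv : smap G G;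
  gmul : G -> G -> G;
  gsrc_subm : surj_submersion gsrc;
  gtgt_subm : surj_submersion gtgt;
  gmul_smooth : exists (P : manifold R) (p q : smap P G),
    is_fibre_product gsrc gtgt p q /\ smooth_map (fun z => gmul (p z) (q z));
  gsrc_unit : forall x, gsrc (gunit x) = x;
  gtgt_unit : forall x, gtgt (gunit x) = x;
  gsrc_mul : forall g h, gsrc g = gtgt h -> gsrc (gmul g h) = gsrc h;
  gtgt_mul : forall g h, gsrc g = gtgt h -> gtgt (gmul g h) = gtgt g;
  gmulA : forall g h k, gsrc g = gtgt h -> gsrc h = gtgt k ->
    gmul g (gmul h k) = gmul (gmul g h) k;
  gmul_unitl : forall g, gmul (gunit (gtgt g)) g = g;
  gmul_unitr : forall g, gmul g (gunit (gsrc g)) = g;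
  gsrc_inv : forall g, gsrc (ginv g) = gtgt g;
  gtgt_inv : forall g, gtgt (ginv g) = gsrc g;
  gmulVl : forall g, gmul (ginv g) g = gunit (gsrc g);
  gmulVr : forall g, gmul g (ginv g) = gunit (gtgt g) }.

Record is_gpd_mor (H N G M : manifold R) (HN : groupoid H N)
    (GM : groupoid G M) (fa : smap H G) (fo : smap N M) : Prop := IsGpdMor {
  gm_src : forall h, gsrc GM (fa h) = fo (gsrc HN h);
  gm_tgt : forall h, gtgt GM (fa h) = fo (gtgt HN h);
  gm_unit : forall y, fa (gunit HN y) = gunit GM (fo y);
  gm_mul : forall h h', gsrc HN h = gtgt HN h' ->
    fa (gmul HN h h') = gmul GM (fa h) (fa h') }.

(* In the first clause a pair of maps W -> G, W -> N x N over M x M is spelled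
   out as a triple (a, b1, b2). *)
Definition is_morita (H N G M : manifold R) (HN : groupoid H N)
    (GM : groupoid G M) (fa : smap H G) (fo : smap N M) :=
  (forall (W : manifold R) (a : smap W G) (b1 b2 : smap W N),
    (forall w, gsrc GM (a w) = fo (b1 w)) ->
    (forall w, gtgt GM (a w) = fo (b2 w)) ->
    exists! c : W -> H, smooth_map c /\
      forall w, [/\ fa (c w) = a w, gsrc HN (c w) = b1 w &
                    gtgt HN (c w) = b2 w])
  /\ exists (P : manifold R) (p : smap P G) (q : smap P N) (r : smap P M),
    [/\ is_fibre_product (gsrc GM) fo p q, forall z, r z = gtgt GM (p z) &
        surj_submersion r].

Definition lie_alg (G M : manifold R) (GM : groupoid G M) (x : M) :=
  ker (tdiff (gsrc GM) (gunit GM x)).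

Definition anchor (G M : manifold R) (GM : groupoid G M) (x : M) :
    hom (lie_alg GM x) (tangent x) :=
  hcomp (tdiff_at (gtgt GM) (gtgt_unit GM x)) (ker_incl _).

Section LieAlgMap.
Variables (H N G M : manifold R) (HN : groupoid H N) (GM : groupoid G M).
Variables (fa : smap H G) (fo : smap N M) (f : is_gpd_mor HN GM fa fo).
Variable y : N.

Let df := tdiff_at fa (gm_unit f y).

Lemma lie_alg_map_ker (b : lie_alg HN y) :
  tdiff (gsrc GM) (gunit GM (fo y)) (df (ssval b)) = 0.
Proof.
have b0 : tdiff (gsrc HN) (gunit HN y) (ssval b) = 0 by exact: (subspP b).
apply: val_inj => /=; apply/funext => h; rewrite /push; case: asboolP => // hs.
change (push fa (ssval b) (h \o gsrc GM) = 0).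
rewrite push_smooth; last exact: smooth_fun_comp.
have -> : (h \o gsrc GM) \o fa = (h \o fo) \o gsrc HN.
  by apply/funext => z /=; rewrite (gm_src f).
have hfo : smooth_fun (h \o fo) by exact: smooth_fun_comp.
rewrite -(push_smooth (gsrc HN) (ssval b) hfo).
by have /(congr1 (fun v => (ssval v) (h \o fo))) := b0.
Qed.

Lemma lie_alg_map_linear : linear (fun b : lie_alg HN y =>
  mksub (S := ker_space (tdiff (gsrc GM) (gunit GM (fo y))))
    (lie_alg_map_ker b)).
Proof. by move=> a u v; apply: val_inj; exact: (homP df). Qed.

(* The restriction of the differential of f at 1_y to Lie algebroid fibres. *)
Definition lie_alg_map : hom (lie_alg HN y) (lie_alg GM (fo y)) :=
  mkhom lie_alg_map_linear.

End LieAlgMap.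

(* Rank-k over rank-l VB-groupoids; all structure maps of the total groupoid
   are vector bundle maps over those of the base groupoid. *)
Record vb_groupoid (k l : nat) := VBGroupoid {
  garr : manifold R;
  gobj : manifold R;
  gbase : groupoid garr gobj;
  barr : vbundle k garr;
  bobj : vbundle l gobj;
  gtot : groupoid (tot barr) (tot bobj);
  vsrc : vb_mor barr bobj (gsrc gbase);
  vsrcE : forall u, gsrc gtot u = vb_tot vsrc u;
  vtgt : vb_mor barr bobj (gtgt gbase);
  vtgtE : forall u, gtgt gtot u = vb_tot vtgt u;
  vunit : vb_mor bobj barr (gunit gbase);
  vunitE : forall u, gunit gtot u = vb_tot vunit u;
  vinvm : vb_mor barr barr (ginv gbase);
  vinvmE : forall u, ginv gtot u = vb_tot vinvm u;
  vmul_proj : forall u w, gsrc gtot u = gtgt gtot w ->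
    proj barr (gmul gtot u w) = gmul gbase (proj barr u) (proj barr w);
  vmul_linear : forall g h (a : R) (v v' : fib barr g) (w w' : fib barr h)
      (p p' : fib barr (gmul gbase g h)),
    gsrc gtot (vin barr v) = gtgt gtot (vin barr w) ->
    gsrc gtot (vin barr v') = gtgt gtot (vin barr w') ->
    gmul gtot (vin barr v) (vin barr w) = vin barr p ->
    gmul gtot (vin barr v') (vin barr w') = vin barr p' ->
    gmul gtot (vin barr (a *: v + v')) (vin barr (a *: w + w'))
    = vin barr (a *: p + p') }.

Definition lb_groupoid := vb_groupoid 1 1.

Record vbg_mor k l k' l' (W : vb_groupoid k l) (V : vb_groupoid k' l') :=
  VBGMor {
  farr : smap (garr W) (garr V);
  fobj : smap (gobj W) (gobj V);
  f_mor : is_gpd_mor (gbase W) (gbase V) farr fobj;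
  Farr : vb_mor (barr W) (barr V) farr;
  Fobj : vb_mor (bobj W) (bobj V) fobj;
  F_mor : is_gpd_mor (gtot W) (gtot V) (vb_tot Farr) (vb_tot Fobj) }.

Definition is_vb_morita k l k' l' (W : vb_groupoid k l) (V : vb_groupoid k' l')
    (F : vbg_mor W V) :=
  is_morita (gtot W) (gtot V) (vb_tot (Farr F)) (vb_tot (Fobj F)).

Section MoritaCurvature.
Variable L : lb_groupoid.
Let G := garr L.
Let M := gobj L.
Let LM := bobj L.
Let s := gsrc (gbase L).
Let t := gtgt (gbase L).
Let A (x : M) := lie_alg (gbase L) x.
Let rho (x : M) : hom (A x) (tangent x) := anchor (gbase L) x.

Definition partial (th : form1 LM) : form1 (barr L) :=
  fun g => pull_form (vsrc L) th g - pull_form (vtgt L) th g.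

(* w = g.u *)
Definition acts (g : G) (u w : tot LM) :=
  exists l : fib (barr L) g,
    u = vin LM (vb_fib (vsrc L) g l) /\ w = vin LM (vb_fib (vtgt L) g l).

Definition represents (x : M) (g : R -> G) (a : A x) :=
  [/\ g 0 = gunit (gbase L) x, (\forall e \near (0 : R), s (g e) = x),
      smooth_curve_at g 0 & velocity g 0 (ssval a)].

(* d = D_a lambda, the derivative at 0 of kappa(e) = g(e)^-1.lambda_(t(g(e)))
   in the fibre over x; derivatives in that fibre are taken by composing with
   linear functionals. *)
Definition is_lie_deriv (x : M) (a : A x) (lam : section LM) (d : fib LM x) :=
  exists (g : R -> G) (kappa : R -> fib LM x),
  [/\ represents g a,
      (\forall e \near (0 : R), acts (ginv (gbase L) (g e))
         (vin LM (lam (t (g e)))) (vin LM (kappa e))) &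
      forall phi : hom (fib LM x) R^o,
        is_derive (0 : R^o) (1 : R^o) (fun e : R^o => phi (kappa e)) (phi d)].

Definition lie_deriv (x : M) (a : A x) (lam : section LM) : fib LM x :=
  xget 0 [set d | is_lie_deriv a lam d].

Variables (nabla : connection LM) (th : form1 LM).

(* F_nabla at x: the functional phi on A_x with
   D_a lambda - nabla_(rho a) lambda = phi(a) lambda_x. *)
Definition Fnabla (x : M) : hom (A x) R^o :=
  xget (0 : hom (A x) R^o) [set phi : hom (A x) R^o |
    forall a lam, smooth_section lam ->
      lie_deriv a lam - nabla x lam (rho x a) = phi a *: lam x].

Definition morita_kernel (x : M) : cpx R := Cpx (rho x) (th x).

Definition twisted_dual (x : M) : cpx R :=
  Cpx (hscalel (th x)) (precomp (fib LM x) (rho x)).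

Definition morita_curvature (x : M) :
    cpx_map (morita_kernel x) (twisted_dual x) :=
  @CpxMap _ (morita_kernel x) (twisted_dual x)
    (- Fnabla x) (cov_diff nabla th x) (htensor (fib LM x) (Fnabla x)).

End MoritaCurvature.

(* The maps induced by (F,f): (df on Lie algebroid fibres, df, F) between the
   Morita kernels, and (id, F^-1 o _ o df, F^-1 o _ o df) between the twisted
   duals. *)
Section Induced.
Variables (L' L : lb_groupoid) (F : vbg_mor L' L) (th : form1 (bobj L)).
Variable y : gobj L'.

Let th' := pull_form (Fobj F) th.
Let x := fobj F y.
Let Finv := hinv (vb_fib (Fobj F) y).

Definition kernel_map :
    cpx_map (morita_kernel th' y) (morita_kernel th x) :=
  @CpxMap _ (morita_kernel th' y) (morita_kernel th x)
    (lie_alg_map (f_mor F) y) (tdiff (fobj F) y) (vb_fib (Fobj F) y).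

Definition dual_map :
    cpx_map (twisted_dual th x) (twisted_dual th' y) :=
  @CpxMap _ (twisted_dual th x) (twisted_dual th' y) (hid _)
    (hcomp (precomp _ (tdiff (fobj F) y)) (postcomp _ Finv))
    (hcomp (precomp _ (lie_alg_map (f_mor F) y)) (postcomp _ Finv)).

End Induced.
End Groupoids.
Arguments lb_groupoid : clear implicits.

(* Main.v *)
From HB Require Import structures.
From mathcomp Require Import all_boot all_order all_algebra.
From mathcomp Require Import all_classical all_reals all_analysis.
From mathcomp Require Import ring lra.
Require Import Defs.
Set Implicit Arguments.
Unset Strict Implicit.
Unset Printing Implicit Defensive.
Import Order.TTheory GRing.Theory Num.Theory.
Import numFieldNormedType.Exports.
Local Open Scope classical_set_scope.
Local Open Scope ring_scope.

(** Let rho' : A'_y -> T_yN and rho : A_x -> T_xM be the anchors at y and at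
x = f(y). The theorem rests on the square that they form with df and with f on
the algebroid fibres: (f, rho') embeds A'_y into A_x (+) T_yN as the set of pairs
with equal images in T_xM, with an explicit linear retraction, and df and rho
together span T_xM (morita_alg_inj, morita_alg_lift, morita_alg_retract,
morita_tangent_span). As F is an isomorphism of fibres (morita_fibre_bij) and
theta vanishes on the image of rho, the quasi-isomorphisms are linear algebra
(kernel_quasi_iso, dual_quasi_iso).

The square comes from the definition of a Morita map. Zero sections and
projections transfer both clauses to the bases. The second clause makes
(s, t) : G -> M x M transverse to f x f, and spans T_xM (morita_transv_tgt). The
first clause then says that H is a transverse fibre product, and the tangent
space of such a product is the fibre product of the tangent spaces; tangent
vectors being derivations and the universal property being stated for maps of
manifolds only, this requires the level set of a submersion to be parametrised
smoothly (level_set), a parametrisation that is then lifted to H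
(transverse_pullback).

The equality of the Morita curvatures is naturality. The form d^nabla theta has a
local expression which visibly commutes with pullbacks (cov_diff_pull). For
F_nabla, let e be a local frame of L_M and c the function on G with
t^* e = c s^* e near the unit 1_x; then F_nabla(a) e = a(c) e - nabla_(rho a) e
(FnablaE). The function attached to the frame F^* e is c o f, and so F_nabla is
natural as well (Fnabla_morita).

Two tools replace calculus in charts. Smooth germs extend by bump functions, so
that every point has globally defined coordinates (global_coords), and Hadamard's
lemma turns derivations into directional derivatives (tan_chain). *)

(** * Smooth germs *)

Section SmoothGerms.
Context {R : realType}.
Implicit Types V W : normedModType R.

Lemma derive_lin V W W' (L : W -> W') (f : V -> W) x v :
  linear L -> continuous L -> differentiable f x ->
  differentiable (L \o f) x /\ 'D_v (L \o f) x = L ('D_v f x).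
Proof.
move=> lL cL df.
pose L' : {linear W -> W'} := HB.pack L (GRing.isLinear.Build _ _ _ _ L lL).
have dL : differentiable L (f x) by exact: (@linear_differentiable _ _ _ L').
have dLf : differentiable (L \o f) x by exact: differentiable_comp.
split=> //; rewrite !deriveE//.
by rewrite diff_comp//= (@diff_lin _ _ _ L').
Qed.

Lemma Ck_lin k V W W' (U : set V) (L : W -> W') (f : V -> W) :
  open U -> linear L -> continuous L -> Ck k U f -> Ck k U (L \o f).
Proof.
move=> oU lL cL; elim: k f => [|k IH] f.
  by move=> cf x Ux; apply: continuous_comp; [exact: cf|exact: cL].
move=> [df Df]; split=> [x Ux|v].
  by case: (derive_lin 0 lL cL (df x Ux)).
apply: (Ck_eq oU) (IH _ (Df v)) => x Ux.
by case: (derive_lin v lL cL (df x Ux)).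
Qed.

Lemma Ck_row k V n (U : set V) (f : V -> 'rV[R]_n) : open U ->
  (forall i, Ck k U (fun x => f x 0 i : R^o)) -> Ck k U f.
Proof.
move=> oU fs.
rewrite (_ : f = \sum_(i < n) (fun x => (f x 0 i *: delta_mx 0 i))).
  apply: Ck_sum => // i.
  apply: (@Ck_lin _ _ _ _ _ (fun r : R^o => r *: (delta_mx 0 i : 'rV[R]_n))
    (fun x => f x 0 i : R^o)) => //; last exact: scalel_continuous.
  by move=> a r s; rewrite scalerDl scalerA.
by apply/funext => x; rewrite fct_sumE [LHS]row_sum_delta.
Qed.

Lemma smooth_at_lin V W W' (L : W -> W') (f : V -> W) a :
  linear L -> continuous L -> smooth_at f a -> smooth_at (L \o f) a.
Proof.
by move=> lL cL [U [oU Ua fU]]; exists U; split=> // k; exact: Ck_lin.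
Qed.

Lemma smooth_at_sum V W n (f : 'I_n -> V -> W) a :
  (forall i, smooth_at (f i) a) -> smooth_at (fun x => \sum_(i < n) f i x) a.
Proof.
move=> fs; rewrite (_ : (fun _ => _) = \sum_(i < n) f i); last first.
  by apply/funext => x; rewrite fct_sumE.
apply: (big_ind (fun h => smooth_at h a)) => //.
  exact: (smooth_at_cst (0 : W)).
by move=> g h; exact: smooth_atD.
Qed.

Lemma smooth_at_prod V n (f : 'I_n -> V -> R^o) a :
  (forall i, smooth_at (f i) a) ->
  smooth_at (fun x => \prod_(i < n) f i x : R^o) a.
Proof.
elim: n f => [|n IH] f fs.
  rewrite (_ : (fun _ => _) = cst (1 : R^o)); first exact: smooth_at_cst.
  by apply/funext => x; rewrite big_ord0.
rewrite (_ : (fun _ => _) =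
  (f ord0 : V -> R^o) \* (fun x => \prod_(i < n) f (lift ord0 i) x : R^o)).
  by apply: smooth_atM => //; apply: IH.
by apply/funext => x; rewrite big_ord_recl.
Qed.

Lemma smooth_at_row V n (f : V -> 'rV[R]_n) a :
  (forall i, smooth_at (fun x => f x 0 i : R^o) a) -> smooth_at f a.
Proof.
move=> fs; rewrite (_ : f = fun x => \sum_(i < n) (f x 0 i *: delta_mx 0 i)).
  apply: smooth_at_sum => i.
  apply: (@smooth_at_lin _ _ _ (fun r : R^o => r *: (delta_mx 0 i : 'rV[R]_n))
    (fun x => f x 0 i : R^o)) => //; last exact: scalel_continuous.
  by move=> b r s; rewrite scalerDl scalerA.
by apply/funext => x; rewrite [LHS]row_sum_delta.
Qed.

Lemma smooth_at_coord V n (f : V -> 'rV[R]_n) a i :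
  smooth_at f a -> smooth_at (fun x => f x 0 i : R^o) a.
Proof. by move=> [U [oU Ua fU]]; exists U; split=> // k; exact: Ck_coord. Qed.

Lemma smooth_at_compr V n m (f : V -> 'rV[R]_n) (g : 'rV[R]_n -> 'rV[R]_m) a :
  smooth_at f a -> smooth_at g (f a) -> smooth_at (g \o f) a.
Proof.
move=> sf sg; apply: smooth_at_row => i.
exact: (smooth_at_comp sf (smooth_at_coord i sg)).
Qed.

Lemma smooth_at_open V W (g : V -> W) a :
  smooth_at g a -> \forall x \near a, smooth_at g x.
Proof.
move=> [U [oU Ua gU]]; apply: filterS (open_nbhs_nbhs (conj oU Ua)) => x Ux.
by exists U.
Qed.

Lemma smooth_at_derive V W (g : V -> W) a v :
  smooth_at g a -> smooth_at ('D_v g) a.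
Proof.
by move=> [U [oU Ua gU]]; exists U; split=> // k; case: (gU k.+1) => _; apply.
Qed.

Lemma smooth_at_diff V W (g : V -> W) a : smooth_at g a -> differentiable g a.
Proof. by move=> [U [oU Ua gU]]; case: (gU 1%N) => dg _; exact: dg. Qed.

Lemma smooth_at_cont V W (g : V -> W) a :
  smooth_at g a -> {for a, continuous g}.
Proof. by move/smooth_at_diff/differentiable_continuous. Qed.

Lemma smooth_Ck V W (g : V -> W) k (U : set V) :
  (forall a, U a -> smooth_at g a) -> Ck k U g.
Proof.
elim: k g => [|k IH] g gs; first by move=> x Ux; exact/smooth_at_cont/gs.
split=> [x Ux|v]; first exact/smooth_at_diff/gs.
by apply: IH => a Ua; exact/smooth_at_derive/gs.
Qed.

Lemma smooth_at_id V (a : V) : smooth_at (@id V) a.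
Proof.
exists setT; split=> //; first exact: openT.
case=> [|k]; first by move=> x _; exact: cvg_id.
split=> [x _|v]; first exact: ex_diff.
rewrite (_ : 'D_v _ = cst v); first exact: Ck_cst.
by apply/funext => x; rewrite derive_id.
Qed.

Lemma smooth_atZ V W (c : R) (f : V -> W) a :
  smooth_at f a -> smooth_at (fun x => c *: f x) a.
Proof.
move=> sf; apply: (@smooth_at_lin V W W (fun w => c *: w)) => //.
  by move=> b u w; rewrite scalerDr !scalerA mulrC.
exact: scaler_continuous.
Qed.

Lemma smooth_atB V W (f g : V -> W) a :
  smooth_at f a -> smooth_at g a -> smooth_at (fun x => f x - g x) a.
Proof.
move=> sf sg.
rewrite (_ : (fun _ => _) = f + (fun x => (-1) *: g x)).
  by apply: smooth_atD => //; exact: smooth_atZ.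
by apply/funext => x; rewrite fctE scaleN1r.
Qed.

Lemma smooth_at_mulmx V n m (f : V -> 'rV[R]_n) (A : 'M[R]_(n, m)) a :
  smooth_at f a -> smooth_at (fun x => f x *m A) a.
Proof.
move=> sf; apply: smooth_at_row => j.
rewrite (_ : (fun _ => _) = (fun x => \sum_i A i j *: (f x 0 i : R^o))).
  by apply: smooth_at_sum => i; apply: smooth_atZ; exact: smooth_at_coord.
by apply/funext => x; rewrite mxE; apply: eq_bigr => i _; rewrite mulrC.
Qed.

(** The analogue of Ck_comp for a middle space that is the real line, which is
not a space of row vectors. *)
Lemma Ck_comp1 k V (U : set V) (O : set R^o) (f : V -> R^o)
    (g : R^o -> R^o) :
  open U -> (forall x, U x -> O (f x)) -> Ck k U f -> Ck k O g ->
  Ck k U (g \o f).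
Proof.
move=> oU fO; elim: k g => [|k IH] g.
  move=> cf cg x Ux; apply: continuous_comp; first exact: cf.
  exact: cg (fO x Ux).
move=> fk [dg Dg]; have [df Df] := fk; split=> [x Ux|v].
  by apply: differentiable_comp; [exact: df|exact/dg/fO].
have H : Ck k U (('D_v f : V -> R^o) \* (('D_(1 : R^o) g : R^o -> R^o) \o f)).
  by apply: CkM => //; [exact: Df|exact: (IH _ (CkW fk) (Dg _))].
apply: (Ck_eq oU) H => x Ux.
have dgx : differentiable g (f x) by exact/dg/fO.
rewrite [RHS]deriveE; last by apply: differentiable_comp => //; exact: df.
rewrite (diff_comp (df x Ux) dgx) /= -(deriveE v (df x Ux)) (deriveE _ dgx).
rewrite -[in RHS](mulr1 ('D_v f x)).
by rewrite -[X in _ = 'd g _ X]/('D_v f x *: (1 : R^o)) linearZ.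
Qed.

Lemma smooth_at_comp1 V (f : V -> R^o) (g : R^o -> R^o) a :
  smooth_at f a -> smooth_at g (f a) -> smooth_at (g \o f) a.
Proof.
move=> [U [oU Ua fU]] [U2 [oO Oa gO]].
have oUO : open (U `&` f @^-1` U2).
  rewrite openE => x [Ux Ofx]; apply: filterI.
    exact: open_nbhs_nbhs (conj oU Ux).
  by apply: (Ck_cont (fU 0%N) Ux); exact: open_nbhs_nbhs (conj oO Ofx).
exists (U `&` f @^-1` U2); split=> // k.
by apply: (Ck_comp1 oUO _ _ (gO k)) => [x []//|]; apply: Ck_sub (fU k) => x [].
Qed.

Lemma CkV k V (U : set V) (f : V -> R^o) : open U ->
  (forall x, U x -> f x != 0) -> Ck k U f -> Ck k U (fun x => (f x)^-1 : R^o).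
Proof.
move=> oU f0; elim: k => [|k IH] fk.
  by move=> x Ux; apply: cvgV; [exact: f0|exact: fk].
have [df Df] := fk; split=> [x Ux|v].
  by apply: differentiableV; [exact: df|exact: f0].
have fV := IH (CkW fk).
have H := CkM oU (Ck_cst k U (-1 : R^o)) (CkM oU (CkM oU fV fV) (Df v)).
apply: (Ck_eq oU) H => x Ux.
rewrite [RHS]deriveV; [|exact: f0|exact/diff_derivable/df].
by rewrite /= scaleNr mulN1r expr2 invfM.
Qed.

Lemma smooth_atV V (f : V -> R^o) a : f a != 0 ->
  smooth_at f a -> smooth_at (fun x => (f x)^-1 : R^o) a.
Proof.
move=> fa0 [U [oU Ua fU]].
pose U' := U `&` f @^-1` [set r | r != 0].
have oU' : open U'.
  rewrite openE => x [Ux fx0]; apply: filterI.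
    exact: open_nbhs_nbhs (conj oU Ux).
  apply: (Ck_cont (fU 0%N) Ux); apply: open_nbhs_nbhs.
  by split; [exact: open_neq|exact: fx0].
exists U'; split=> // k; apply: CkV => // [x []//|].
by apply: Ck_sub (fU k) => x [].
Qed.

End SmoothGerms.

(** * Mean value and Taylor estimates *)

Section Estimates.
Context {R : realType}.
Implicit Types V W : normedModType R.

(** The derivative is read off from an estimate; used where no differentiation
rule applies, for inverse maps, integrals and functions defined by cases. *)
Lemma diff_of_est V W (f : V -> W) x (L : V -> W) :
  linear L -> continuous L ->
  (forall e : R, 0 < e ->
    \forall v \near (0 : V), `|f (v + x) - f x - L v| <= e * `|v|) ->
  differentiable f x /\ forall v, 'D_v f x = L v.
Proof.
move=> lL cL est.
pose L' : {linear V -> W} := HB.pack L (GRing.isLinear.Build _ _ _ _ L lL).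
have heq : f \o shift x = cst (f x) + L' +o_ 0 id.
  apply: eqaddoE; rewrite -[LHS](subrK (cst (f x) + L')) [RHS]addrC.
  congr (_ + _); rewrite littleoE// => _/posnumP[e].
  near=> v; rewrite !fctE /= opprD addrA.
  by near: v; exact: est.
have hd := @diff_unique _ V W f L' x cL heq.
have df : differentiable f x by apply/diff_locallyP; rewrite hd; split.
by split=> // v; rewrite deriveE// hd.
Unshelve. all: by end_near. Qed.

Lemma line_derive V W (f : V -> W) (x v : V) (t : R) :
  differentiable f (x + t *: v) ->
  is_derive t (1 : R) (fun s : R => f (x + s *: v)) ('D_v f (x + t *: v)).
Proof.
move=> df.
have dl : is_diff t (fun s : R => x + s *: v) (fun s : R => s *: v).
  have := is_diffD (is_diff_cst x t) (is_diff_scalel t v).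
  by rewrite add0r.
have dg : differentiable (f \o (fun s : R => x + s *: v)) t.
  by apply: differentiable_comp => //; exact: ex_diff.
apply: DeriveDef; first exact: diff_derivable.
by rewrite deriveE// diff_comp//= diff_val scale1r deriveE.
Qed.

Lemma mvt_line V (f : V -> R^o) (x v : V) :
  (forall t : R, 0 <= t <= 1 -> differentiable f (x + t *: v)) ->
  exists2 t : R, 0 <= t <= 1 & f (x + v) - f x = 'D_v f (x + t *: v).
Proof.
move=> df.
have der (t : R) : t \in `[0, 1]%R ->
    is_derive t (1:R) (fun s : R => f (x + s *: v) : R) ('D_v f (x + t *: v)).
  by rewrite in_itv /= => t01; apply: line_derive; exact: df.
have cont : {within `[0, 1], continuous (fun s : R => f (x + s *: v) : R)}.
  apply: derivable_within_continuous => t t01.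
  by have [] := der t t01.
have der' (t : R) : t \in `]0, 1[%R ->
    is_derive t (1:R) (fun s : R => f (x + s *: v) : R) ('D_v f (x + t *: v)).
  move=> t01; apply: der.
  by move: t01; rewrite !in_itv /= => /andP[/ltW -> /ltW ->].
have [t t01] := MVT ltr01 der' cont.
rewrite scale1r scale0r addr0 subr0 mulr1 => E; exists t => //.
by move: t01; rewrite in_itv /= => /andP[/ltW -> /ltW ->].
Qed.

Lemma row_coord_le n (v : 'rV[R]_n) i : `|v 0 i| <= `|v|.
Proof.
rewrite [X in _ <= X]mx_normrE.
by apply: (le_trans _ (@le_bigmax _ _ _ 0 (fun ij => `|v ij.1 ij.2|) (0, i))).
Qed.

Lemma row_norm_le n (v : 'rV[R]_n) (e : R) :
  0 <= e -> (forall i, `|v 0 i| <= e) -> `|v| <= e.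
Proof.
move=> e0 h; rewrite [X in X <= _]mx_normrE.
by apply: bigmax_le => // -[i j] _; rewrite ord1; exact: h.
Qed.

Lemma derive_row n W (f : 'rV[R]_n -> W) x v : differentiable f x ->
  'D_v f x = \sum_i v 0 i *: 'D_(delta_mx 0 i) f x.
Proof.
move=> df; rewrite deriveE// {1}[v]row_sum_delta linear_sum.
by apply: eq_bigr => i _; rewrite linearZ deriveE.
Qed.

Lemma ball_bounded n (f : 'rV[R]_n -> R^o) (r : R) :
  (forall x, {for x, continuous f}) ->
  exists2 B : R, 0 <= B & forall p : 'rV[R]_n, `|p| <= r -> `|f p| <= B.
Proof.
move=> cf; have [r0|r0] := leP 0 r; last first.
  exists 0 => // p pr; have := le_lt_trans pr r0.
  by rewrite ltNge normr_ge0.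
pose A := [set p : 'rV[R]_n | `|p| <= r].
have cA : compact A.
  apply: bounded_closed_compact.
    by exists r; split; [exact: num_real|move=> s rs p /le_trans; apply; exact: ltW].
  apply: (@closed_comp _ _ (fun p : 'rV[R]_n => `|p|) [set x | x <= r]).
    by move=> p _; exact: norm_continuous.
  exact: closed_le.
have [||c cA' cmax] := @EVT_max_rV _ _ (fun p => `|f p| : R) A _ cA.
- by exists 0; rewrite /A /= normr0.
- apply: continuous_subspaceT => p.
  apply: (@continuous_comp _ _ _ f (fun x : R^o => `|x|)); first exact: cf.
  exact: norm_continuous.
exists `|f c| => // p pr; apply: cmax.
by rewrite inE.
Qed.

Lemma ball_convex V (p v : V) (r t : R) : 0 <= t <= 1 ->
  `|p| <= r -> `|p + v| <= r -> `|p + t *: v| <= r.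
Proof.
move=> /andP[t0 t1] pr pvr.
have -> : p + t *: v = (1 - t) *: p + t *: (p + v).
  by rewrite scalerBl scalerDr scale1r addrA subrK.
apply: le_trans (ler_normD _ _) _; rewrite !normrZ.
rewrite (ger0_norm t0) ger0_norm ?subr_ge0//.
apply: (@le_trans _ _ ((1 - t) * r + t * r)); last by rewrite -mulrDl subrK mul1r.
by apply: lerD; apply: ler_wpM2l => //; rewrite subr_ge0.
Qed.

(** Uniformity on a ball, here and in the quadratic remainder below, is what
allows the differentiation of an average over a segment. *)
Lemma ball_lipschitz n (f : 'rV[R]_n -> R^o) (r : R) :
  (forall a, smooth_at f a) ->
  exists2 K : R, 0 <= K & forall p v : 'rV[R]_n,
    `|p| <= r -> `|p + v| <= r -> `|f (p + v) - f p| <= K * `|v|.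
Proof.
move=> fs.
have /choice[B BP] : forall i : 'I_n, exists B : R,
    0 <= B /\ forall p : 'rV[R]_n, `|p| <= r -> `|'D_(delta_mx 0 i) f p| <= B.
  move=> i; have [|B B0 BP] := @ball_bounded n ('D_(delta_mx 0 i) f) r.
    by move=> x; exact/smooth_at_cont/smooth_at_derive.
  by exists B.
exists (\sum_i B i); first by apply: sumr_ge0 => i _; case: (BP i).
move=> p v pr pvr.
have [|t t01 ->] := @mvt_line _ f p v.
  by move=> t _; exact/smooth_at_diff.
rewrite derive_row; last exact/smooth_at_diff.
apply: le_trans (ler_norm_sum _ _ _) _; rewrite mulr_suml.
apply: ler_sum => i _; rewrite normrM mulrC.
apply: ler_pM => //; last exact: row_coord_le.
by have [_] := BP i; apply; exact: ball_convex.
Qed.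

Lemma ball_taylor n (f : 'rV[R]_n -> R^o) (r : R) :
  (forall a, smooth_at f a) ->
  exists2 K : R, 0 <= K & forall p v : 'rV[R]_n,
    `|p| <= r -> `|p + v| <= r ->
    `|f (p + v) - f p - 'D_v f p| <= K * `|v| ^+ 2.
Proof.
move=> fs.
have /choice[B BP] : forall i : 'I_n, exists B : R,
    0 <= B /\ forall p v : 'rV[R]_n, `|p| <= r -> `|p + v| <= r ->
      `|'D_(delta_mx 0 i) f (p + v) - 'D_(delta_mx 0 i) f p| <= B * `|v|.
  move=> i; have [|B B0 BP] := @ball_lipschitz n ('D_(delta_mx 0 i) f) r.
    by move=> x; exact/smooth_at_derive.
  by exists B.
exists (\sum_i B i); first by apply: sumr_ge0 => i _; case: (BP i).
move=> p v pr pvr.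
have [|t t01 ->] := @mvt_line _ f p v.
  by move=> t _; exact/smooth_at_diff.
rewrite !derive_row; try exact/smooth_at_diff.
rewrite -sumrB; apply: le_trans (ler_norm_sum _ _ _) _; rewrite mulr_suml.
apply: ler_sum => i _; rewrite -scalerBr normrM mulrC expr2 mulrA.
apply: ler_pM => //; last exact: row_coord_le.
have [B0 /(_ p (t *: v) pr)] := BP i; move/(_ (ball_convex t01 pr pvr)).
move=> h; apply: (le_trans h); apply: ler_wpM2l => //.
rewrite normrZ ler_piMl//.
by case/andP: t01 => t0 t1; rewrite ger0_norm.
Qed.

Lemma primitive_exists (f : R -> R) : continuous f ->
  exists F : R -> R, forall t : R, 0 <= t <= 1 -> is_derive t (1:R) F (f t).
Proof.
move=> cf.
exists (fun x => (\int[@lebesgue_measure R]_(t in `[(-1)%R, x]) (f t))%R).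
move=> t /andP[t0 t1].
have t2 : t < 2 by rewrite (le_lt_trans t1)// ltr1n.
have := @continuous_FTC1_closed R f (-1) t 2 t2.
case.
- apply: continuous_compact_integrable; first exact: segment_compact.
  exact: continuous_subspaceT.
- by rewrite (lt_le_trans _ t0)// ltrN10.
- exact: cf.
by move=> df E; split; [exact: df|rewrite -derive1E; exact: E].
Qed.

End Estimates.

(** * Hadamard's lemma *)

Section Hadamard.
Context {R : realType}.

Lemma contM (T : topologicalType) (f g : T -> R) :
  continuous f -> continuous g -> continuous (fun t => f t * g t).
Proof. by move=> cf cg t; exact: continuousM (cf t) (cg t). Qed.

Lemma contD (T : topologicalType) (f g : T -> R) :
  continuous f -> continuous g -> continuous (fun t => f t + g t).
Proof. by move=> cf cg t; exact: continuousD (cf t) (cg t). Qed.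

Lemma contZ (T : topologicalType) (c : R) (f : T -> R) :
  continuous f -> continuous (fun t => c * f t).
Proof. by move=> cf; apply: contM => // t; exact: cst_continuous. Qed.

Lemma cont_sum (T : topologicalType) n (f : 'I_n -> T -> R) :
  (forall i, continuous (f i)) -> continuous (fun t => \sum_i f i t).
Proof.
elim: n f => [|n IH] f cf.
  by under eq_fun do rewrite big_ord0; move=> t; exact: cst_continuous.
under eq_fun do rewrite big_ord_recl.
by apply: contD => //; exact: IH.
Qed.

Lemma contX m : continuous (fun t : R => t ^+ m).
Proof.
elim: m => [|m IH]; first by move=> t; exact: cst_continuous.
under eq_fun do rewrite exprS.
by apply: contM => // t; exact: cvg_id.
Qed.

(** The integral over the unit segment, defined by primitives so that linearity
and bounds follow from the mean value theorem alone. *)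
Definition seg_int (f : R -> R) : R :=
  let F := xget (fun _ => 0)
    [set F : R -> R | forall t : R, 0 <= t <= 1 -> is_derive t (1:R) F (f t)] in
  F 1 - F 0.

Lemma primitive_bound (F f : R -> R) (B : R) :
  (forall t : R, 0 <= t <= 1 -> is_derive t (1:R) F (f t)) ->
  (forall t : R, 0 <= t <= 1 -> `|f t| <= B) -> `|F 1 - F 0| <= B.
Proof.
move=> dF fB.
have cont : {within `[0, 1], continuous F}.
  apply: derivable_within_continuous => t; rewrite in_itv /= => t01.
  by have [] := dF t t01.
have sub (t : R) : t \in `]0, 1[%R -> 0 <= t <= 1.
  by rewrite in_itv /= => /andP[/ltW -> /ltW ->].
have [t t01 ->] := MVT ltr01 (fun t t01 => dF t (sub t t01)) cont.
by rewrite subr0 mulr1; exact/fB/sub.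
Qed.

Lemma seg_intE (F f : R -> R) :
  (forall t : R, 0 <= t <= 1 -> is_derive t (1:R) F (f t)) ->
  seg_int f = F 1 - F 0.
Proof.
move=> dF; rewrite /seg_int; case: xgetP => [G _ dG|/(_ F)//].
have dGF (t : R) : 0 <= t <= 1 -> is_derive t (1:R) (G - F) ((fun _ => 0 : R) t).
  by move=> t01; have := is_deriveB (dG t t01) (dF t t01); rewrite subrr.
have h0 : forall t : R, 0 <= t <= 1 -> `|(fun _ => 0 : R) t| <= 0.
  by move=> t _; rewrite normr0.
have := primitive_bound dGF h0; rewrite normr_le0 !fctE => /eqP h.
by rewrite -[G 1](subrK (F 1)) (subr0_eq h); ring.
Qed.

Lemma seg_intD (f g : R -> R) : continuous f -> continuous g ->
  seg_int (fun t => f t + g t) = seg_int f + seg_int g.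
Proof.
move=> /primitive_exists[F dF] /primitive_exists[G dG].
rewrite (seg_intE dF) (seg_intE dG).
have dFG (t : R) (t01 : 0 <= t <= 1) := is_deriveD (dF t t01) (dG t t01).
by rewrite (seg_intE dFG) !fctE; ring.
Qed.

Lemma seg_intZ (c : R) (f : R -> R) : continuous f ->
  seg_int (fun t => c * f t) = c * seg_int f.
Proof.
move=> /primitive_exists[F dF].
rewrite (seg_intE dF).
have dcF (t : R) (t01 : 0 <= t <= 1) := is_deriveZ c (dF t t01).
by rewrite (seg_intE dcF) -mulrBr.
Qed.

Lemma seg_int_bound (f : R -> R) (B : R) : continuous f ->
  (forall t : R, 0 <= t <= 1 -> `|f t| <= B) -> `|seg_int f| <= B.
Proof.
move=> /primitive_exists[F dF] fB; rewrite (seg_intE dF).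
exact: primitive_bound dF fB.
Qed.

Lemma seg_int_sum n (f : 'I_n -> R -> R) : (forall i, continuous (f i)) ->
  seg_int (fun t => \sum_i f i t) = \sum_i seg_int (f i).
Proof.
elim: n f => [|n IH] f cf.
  rewrite big_ord0; under eq_fun do rewrite big_ord0.
  have d0 (t : R) (t01 : 0 <= t <= 1) := is_derive_cst (0 : R) t (1 : R).
  by rewrite (seg_intE d0) subrr.
rewrite big_ord_recl -IH// -seg_intD//; last by apply: cont_sum => i.
by congr seg_int; apply/funext => t; rewrite big_ord_recl.
Qed.

(** The weight t^m makes the family closed under differentiation: the
derivative of an average of weight m is a combination of averages, of weight
m+1, of partial derivatives. *)
Definition avg n (m : nat) (f : 'rV[R]_n -> R^o) (x : 'rV[R]_n) : R^o :=
  seg_int (fun t => t ^+ m * f (t *: x)).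

Lemma avg_cont n m (f : 'rV[R]_n -> R^o) x : continuous f ->
  continuous (fun t : R => t ^+ m * f (t *: x) : R).
Proof.
move=> cf; apply: contM; first exact: contX.
move=> t; apply: (@continuous_comp R _ _ ( *:%R^~ x) f); first exact: scalel_continuous.
exact: cf.
Qed.

(** Differentiation under the integral sign: the quadratic Taylor remainder,
uniform on a ball that contains the segments from 0 to x and to x + v, is
integrated. *)
Lemma avg_diff n m (f : 'rV[R]_n -> R^o) x : (forall a, smooth_at f a) ->
  differentiable (avg m f) x /\ forall v, 'D_v (avg m f) x =
    \sum_i v 0 i * avg m.+1 ('D_(delta_mx 0 i) f) x.
Proof.
move=> fs.
have cf : continuous f by move=> y; exact: smooth_at_cont.
have cdf i : continuous ('D_(delta_mx 0 i) f : _ -> R^o).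
  by move=> y; exact/smooth_at_cont/smooth_at_derive.
apply: diff_of_est.
- move=> a u v; rewrite scaler_sumr -big_split; apply: eq_bigr => i _ /=.
  by rewrite !mxE mulrDl -mulrA.
- apply: cont_sum => i; apply: contM => v; last exact: cst_continuous.
  exact: coord_continuous.
move=> e e0; have [K K0 KP] := ball_taylor (`|x| + 1) fs.
have n1 : \forall v \near (0 : 'rV[R]_n), `|v| <= 1.
  by apply: nbhs0_le.
have n2 : \forall v \near (0 : 'rV[R]_n), `|v| <= e / (K + 1).
  by apply: nbhs0_le; rewrite divr_gt0// ltr_wpDl.
near=> v.
have v1 : `|v| <= 1 by near: v.
have ve : `|v| <= e / (K + 1) by near: v.
have -> : avg m f (v + x) - avg m f x
    - \sum_i v 0 i * avg m.+1 ('D_(delta_mx 0 i) f) x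
  = seg_int (fun t => t ^+ m * f (t *: (v + x)) + (-1) * (t ^+ m * f (t *: x))
     + (-1) * (\sum_i v 0 i * (t ^+ m.+1 * 'D_(delta_mx 0 i) f (t *: x)))).
  have c1 := @avg_cont _ m _ (v + x) cf.
  have c2 := @avg_cont _ m _ x cf.
  have c3 i := @avg_cont _ m.+1 _ x (cdf i).
  have c4 i := @contZ _ (v 0 i) _ (c3 i).
  have c5 := cont_sum c4.
  have c6 := @contZ _ (-1) _ c2; have c7 := @contZ _ (-1) _ c5; have c8 := contD c1 c6.
  rewrite (seg_intD c8 c7) (seg_intD c1 c6).
  rewrite !seg_intZ// seg_int_sum// !mulN1r; congr (_ - _).
  by apply: eq_bigr => i _; rewrite seg_intZ.
apply: le_trans (_ : K * `|v| ^+ 2 <= _); last first.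
  rewrite expr2 mulrA; apply: ler_wpM2r => //.
  apply: (le_trans (ler_wpM2l K0 ve)).
  rewrite mulrCA -[leRHS]mulr1 ler_wpM2l ?(ltW e0)//.
  by rewrite ler_pdivrMr ?mul1r ?lerDl// ltr_wpDl.
apply: seg_int_bound.
  apply: contD; first by apply: contD; [|apply: contZ]; exact: avg_cont.
  apply/contZ/cont_sum => i.
  exact: @contZ _ (v 0 i) _ (@avg_cont _ m.+1 _ x (cdf i)).
move=> t /andP[t0 t1].
have tx : `|t *: x| <= `|x| + 1.
  rewrite normrZ ger0_norm//; apply: (@le_trans _ _ `|x|); last by rewrite lerDl.
  exact: ler_piMl.
have tv : `|t *: v| <= `|v| by rewrite normrZ ger0_norm// ler_piMl.
have txv : `|t *: x + t *: v| <= `|x| + 1.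
  rewrite -scalerDr normrZ ger0_norm//.
  apply: (@le_trans _ _ `|x + v|); first exact: ler_piMl.
  by apply: (le_trans (ler_normD _ _)); rewrite lerD2l.
have -> : t ^+ m * f (t *: (v + x)) + (-1) * (t ^+ m * f (t *: x))
    + (-1) * (\sum_i v 0 i * (t ^+ m.+1 * 'D_(delta_mx 0 i) f (t *: x)))
   = t ^+ m * (f (t *: x + t *: v) - f (t *: x) - 'D_(t *: v) f (t *: x)).
  rewrite derive_row; last exact/smooth_at_diff.
  rewrite !mulrBr !mulN1r -scalerDr [x + v]addrC; congr (_ - _).
  rewrite mulr_sumr; apply: eq_bigr => i _; rewrite mxE.
  rewrite exprS; set d : R := derive _ _ _.
  by rewrite -[X in _ = _ * X]/((t * v 0 i) * d); ring.
rewrite normrM ger0_norm ?exprn_ge0//.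
apply: (@le_trans _ _ (1 * (K * `|t *: v| ^+ 2))).
  by apply: ler_pM => //; [exact: exprn_ge0|exact: exprn_ile1|exact: KP].
by rewrite mul1r; apply: ler_wpM2l => //; apply: lerXn2r; rewrite ?nnegrE.
Unshelve. all: by end_near. Qed.

Lemma avg_smooth n m (f : 'rV[R]_n -> R^o) a :
  (forall a, smooth_at f a) -> smooth_at (avg m f) a.
Proof.
move=> fs; suff h k : Ck k setT (avg m f) by exists setT; split=> //; exact: openT.
elim: k m f fs => [|k IH] m f fs.
  move=> x _; apply: differentiable_continuous.
  by have [] := avg_diff m x fs.
split=> [x _|v]; first by have [] := avg_diff m x fs.
have H i : Ck k setT ((cst (v 0 i) : _ -> R^o)
    \* (avg m.+1 ('D_(delta_mx 0 i) f))).
  apply: CkM; [exact: openT|exact: Ck_cst|].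
  by apply: IH => b; exact: smooth_at_derive.
apply: (Ck_eq openT) (Ck_sum openT H) => x _.
rewrite fct_sumE.
by have [_ ->] := avg_diff m x fs.
Qed.

(** Hadamard's lemma: the g i are the averages of the partial derivatives over
the segment from a to x. It identifies derivations with directional
derivatives, and so gives access to the tangent spaces of manifolds, which are
defined by derivations. *)
Lemma hadamard n (f : 'rV[R]_n -> R^o) (a : 'rV[R]_n) :
  (forall x, smooth_at f x) ->
  exists g : 'I_n -> 'rV[R]_n -> R^o,
    [/\ forall i x, smooth_at (g i) x,
        forall i, g i a = 'D_(delta_mx 0 i) f a &
        forall x, f x = f a + \sum_i (x - a) 0 i * g i x].
Proof.
move=> fs; pose F (x : 'rV[R]_n) := f (x + a).
have shiftS (b : 'rV[R]_n) x : smooth_at (fun y : 'rV[R]_n => y + b) x.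
  by apply: (smooth_atD (smooth_at_id x)); exact: smooth_at_cst.
have Fs x : smooth_at F x by apply: (smooth_at_comp (shiftS a x)); exact: fs.
have gs i x : smooth_at (fun y => avg 0 ('D_(delta_mx 0 i) F) (y - a)) x.
  apply: (@smooth_at_comp _ _ _ (fun y => y - a)); first exact: shiftS.
  by apply: avg_smooth => b; exact: smooth_at_derive.
have E x : f x = f a
    + \sum_i (x - a) 0 i * avg 0 ('D_(delta_mx 0 i) F) (x - a).
  have cF i : continuous ('D_(delta_mx 0 i) F : _ -> R^o).
    by move=> y; exact/smooth_at_cont/smooth_at_derive.
  under eq_bigr => i _ do
    rewrite -(seg_intZ ((x - a) 0 i) (@avg_cont _ 0 _ (x - a) (cF i))).
  rewrite -seg_int_sum; last first.
    by move=> i; apply: contZ (@avg_cont _ 0 _ (x - a) (cF i)).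
  suff dF (t : R) : 0 <= t <= 1 ->
      is_derive t (1 : R) (fun s : R => F (0 + s *: (x - a)))
      (\sum_i (x - a) 0 i * (t ^+ 0 * 'D_(delta_mx 0 i) F (t *: (x - a)))).
    rewrite (seg_intE dF).
    by rewrite scale0r scale1r /F !add0r subrK subrKC.
  move=> _; have -> : \sum_i (x - a) 0 i * (t ^+ 0 * 'D_(delta_mx 0 i) F (t *: (x - a)))
     = 'D_(x - a) F (0 + t *: (x - a)).
    rewrite derive_row; last exact/smooth_at_diff.
    by rewrite add0r; apply: eq_bigr => i _; rewrite mul1r.
  exact/line_derive/smooth_at_diff.
exists (fun i y => avg 0 ('D_(delta_mx 0 i) F) (y - a)); split=> //.
move=> i; rewrite subrr /avg.
have -> : 'D_(delta_mx 0 i) f a = 'D_(delta_mx 0 i) F 0.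
  rewrite /derive.
  suff -> : (fun h : R => h^-1 *: ((f \o shift a) (h *: delta_mx 0 i) - f a))
    = (fun h : R => h^-1 *: ((F \o shift 0) (h *: delta_mx 0 i) - F 0)) by [].
  by apply/funext => h /=; rewrite /F addr0 add0r.
under eq_fun do rewrite expr0 mul1r scaler0.
have dF (t : R) (t01 : 0 <= t <= 1) :=
  is_deriveZ ('D_(delta_mx 0 i) F 0) (is_derive_id t (1 : R)).
have := seg_intE dF; rewrite -[_ *: 1]/(_ * 1) mulr1 => ->.
by rewrite -[(_ \*: id) 1]/(_ * 1) -[(_ \*: id) 0]/(_ * 0) mulr1 mulr0 subr0.
Qed.

End Hadamard.

(** * Bump functions *)

Section Bumps.
Context {R : realType}.

(** Only flat 0, the function exp(-1/x) on the positive half-line, is of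
interest; the powers of 1/x appear in its derivatives, and the family is closed
under differentiation. *)
Definition flat (m : nat) (x : R^o) : R^o :=
  if 0 < x then x^-1 ^+ m * expR (- x^-1) else 0.

(** The exponential of 1/x exceeds the term of degree m+2 of its series, hence
a bound in x^2, which gives the derivative at 0. *)
Lemma flat_quadratic m : exists2 C : R, 0 <= C &
  forall x, `|flat m x| <= C * `|x| ^+ 2.
Proof.
exists ((m.+2)`!%:R) => // x; rewrite /flat; case: ifP => x0; last first.
  by rewrite normr0 mulr_ge0// exprn_ge0.
have y0 : 0 < x^-1 by rewrite invr_gt0.
rewrite ger0_norm ?mulr_ge0 ?exprn_ge0 ?expR_ge0 ?(ltW y0)//.
rewrite (ger0_norm (ltW x0)) expRN ler_pdivrMr ?expR_gt0//.
have := expR_ge1Dxn m.+1 (ltW y0); set E := expR _ => hE.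
have {}hE : x^-1 ^+ m.+2 <= (m.+2)`!%:R * E.
  rewrite mulrC -ler_pdivrMr ?ltr0n ?fact_gt0//.
  by apply: le_trans hE; rewrite lerDr.
rewrite mulrAC; rewrite -ler_pdivrMr ?exprn_gt0//.
by rewrite -exprVn -exprD addn2.
Qed.

Lemma flat_derive m (x : R) : is_derive (x : R^o) (1 : R^o) (flat m)
  (- m%:R * flat m.+1 x + flat m.+2 x).
Proof.
have [x0|x0|<-] := ltgtP 0 x.
- have hI := is_deriveV (lt0r_neq0 x0) (is_derive_id x (1 : R)).
  have hX := is_deriveX m hI.
  have hE := @is_derive1_comp _ expR (fun y : R => - y^-1) x _ _
    (is_derive_expR _) (is_deriveN hI).
  have := is_deriveM hX hE.
  rewrite {2}/flat {2}/flat x0 => h.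
  have : is_derive x (1 : R) (flat m : R -> R)
    (- m%:R * (x^-1 ^+ m.+1 * expR (- x^-1)) + x^-1 ^+ m.+2 * expR (- x^-1)).
    apply: (near_eq_is_derive _ (is_derive_eq h _)).
      near=> y; rewrite /flat ifT; last by near: y; exact: lt_nbhsr.
      by rewrite !fctE.
    rewrite !fctE -!exprVn; set e := expR _; set y := x^-1.
    suff : y ^+ m * (e * - (- y ^+ 2 * 1)) + e * (m%:R * y ^+ m.-1 * (- y ^+ 2 * 1))
      = - m%:R * (y ^+ m.+1 * e) + y ^+ m.+2 * e by [].
    by case: (m) => [|k] /=; rewrite ?exprS; ring.
  by [].
- rewrite /flat ifF; last by apply/negbTE; rewrite -leNgt ltW.
  rewrite ifF; last by apply/negbTE; rewrite -leNgt ltW.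
  rewrite mulr0 addr0.
  apply: (near_eq_is_derive _ (is_derive_cst (0 : R^o) x (1 : R^o))).
  near=> y; rewrite ifF//; apply/negbTE; rewrite -leNgt; near: y.
  exact: lt_le_nbhsl.
- have f0 k : flat k 0 = 0 by rewrite /flat ltxx.
  rewrite !f0 mulr0 addr0.
  have [C C0 CP] := flat_quadratic m.
  have [||e e0|df E] := @diff_of_est R R^o R^o (flat m) 0 (fun _ => 0).
  - by move=> a u v; rewrite scaler0 addr0.
  - by move=> y; exact: cst_continuous.
  - have n2 : \forall v \near (0 : R^o), `|v| <= e / (C + 1).
      by apply: nbhs0_le; rewrite divr_gt0// ltr_wpDl.
    near=> v; rewrite addr0 f0 !subr0; apply: le_trans (CP v) _.
    rewrite expr2 mulrA; apply: ler_wpM2r => //.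
    have ve : `|v| <= e / (C + 1) by near: v.
    apply: (le_trans (ler_wpM2l C0 ve)).
    rewrite mulrCA -[leRHS]mulr1 ler_wpM2l ?(ltW e0)//.
    by rewrite ler_pdivrMr ?mul1r ?lerDl// ltr_wpDl.
  by split; [exact: diff_derivable|exact: E].
Unshelve. all: by end_near. Qed.

Lemma flat_smooth m a : smooth_at (flat m) a.
Proof.
have df k x : differentiable (flat k) x.
  by apply/derivable1_diffP; have [] := flat_derive k x.
suff h k : Ck k setT (flat m) by exists setT; split=> //; exact: openT.
elim: k m => [|k IH] m; first by move=> x _; exact: differentiable_continuous.
split=> // v.
have H := CkM openT (Ck_cst k setT (v : R^o)) (CkD openT
  (CkM openT (Ck_cst k setT (- m%:R : R^o)) (IH m.+1)) (IH m.+2)).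
apply: (Ck_eq openT) H => x _.
rewrite deriveE// -[X in 'd _ _ X]mulr1 -[X in 'd _ _ X]/(v *: 1) linearZ.
rewrite -deriveE//; have [_ ->] := flat_derive m x.
by [].
Qed.

Definition step (x : R^o) : R^o := flat 0 x / (flat 0 x + flat 0 (1 - x)).

Lemma flat_ge0 x : 0 <= flat 0 x.
Proof. by rewrite /flat; case: ifP => // _; rewrite mul1r expR_ge0. Qed.

Lemma flat_gt0 x : 0 < x -> 0 < flat 0 x.
Proof. by rewrite /flat => ->; rewrite mul1r expR_gt0. Qed.

Lemma flat_eq0 m x : x <= 0 -> flat m x = 0.
Proof. by rewrite /flat leNgt; case: ifP. Qed.

Lemma step_den x : 0 < flat 0 x + flat 0 (1 - x).
Proof.
have [x0|x0] := ltP 0 x; first by rewrite ltr_pwDl ?flat_gt0 ?flat_ge0.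
by rewrite ltr_wpDl ?flat_ge0// flat_gt0// subr_gt0 (le_lt_trans x0).
Qed.

Lemma step_eq0 x : x <= 0 -> step x = 0.
Proof. by move=> x0; rewrite /step flat_eq0// mul0r. Qed.

Lemma step_eq1 x : 1 <= x -> step x = 1.
Proof.
move=> x1; rewrite /step [X in _ / (_ + X)]flat_eq0 ?subr_le0// addr0 divff//.
by rewrite gt_eqF// flat_gt0// (lt_le_trans _ x1).
Qed.

Lemma step_itv x : 0 <= step x <= 1.
Proof.
apply/andP; split; first by rewrite divr_ge0 ?flat_ge0// ltW// step_den.
by rewrite ler_pdivrMr ?step_den// mul1r lerDl flat_ge0.
Qed.

Lemma step_smooth a : smooth_at step a.
Proof.
have s1 : smooth_at (fun x : R^o => flat 0 (1 - x)) a.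
  apply: (@smooth_at_comp1 _ _ (fun x : R^o => 1 - x) (flat 0)).
    by apply: smooth_atB; [exact: smooth_at_cst|exact: smooth_at_id].
  exact: flat_smooth.
apply: smooth_atM; first exact: flat_smooth.
apply: smooth_atV; first by rewrite gt_eqF// step_den.
by apply: smooth_atD => //; exact: flat_smooth.
Qed.

(** A product of cut-offs of the coordinates, adapted to the sup norm. The
radii are part of the statement because the support has to be seen to be
compact when the bump is carried to a manifold. *)
Lemma bump_exists n (a : 'rV[R]_n) (U : set 'rV[R]_n) : nbhs a U ->
  exists (b : 'rV[R]_n -> R^o) (r : R), [/\ 0 < r,
    (forall x, smooth_at b x), (forall x, 0 <= b x <= 1),
    (forall x, `|x - a| <= r -> b x = 1) &
    (forall x, `|x - a| > r + r -> b x = 0) /\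
    (forall x, `|x - a| <= r + r -> U x)].
Proof.
move=> /nbhs_ballP[e /= e0 eU]; pose r := e / 4.
have r0 : 0 < r by rewrite divr_gt0.
have re : r + r < e by rewrite /r; lra.
pose y (x : 'rV[R]_n) i : R^o := (x - a) 0 i / r.
pose b (x : 'rV[R]_n) : R^o := \prod_i (step (2 - y x i) * step (2 + y x i)).
have ys i x : smooth_at (y ^~ i) x.
  apply: smooth_atM; last exact: smooth_at_cst.
  apply: (@smooth_at_coord _ _ _ (fun x => x - a)).
  by apply: smooth_atB; [exact: smooth_at_id|exact: smooth_at_cst].
exists b, r; split=> //.
- move=> x; apply: smooth_at_prod => i; apply: smooth_atM.
    apply: (@smooth_at_comp1 _ _ (fun x => 2 - y x i) step).
      by apply: smooth_atB => //; exact: smooth_at_cst.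
    exact: step_smooth.
  apply: (@smooth_at_comp1 _ _ (fun x => 2 + y x i) step).
    by apply: smooth_atD => //; exact: smooth_at_cst.
  exact: step_smooth.
- move=> x; rewrite /b; elim/big_ind: _ => //=.
  + by rewrite ler01 lexx.
  + move=> u v /andP[u0 u1] /andP[v0 v1].
    by rewrite mulr_ge0// mulr_ile1.
  + move=> i _; have /andP[u0 u1] := step_itv (2 - y x i).
    have /andP[v0 v1] := step_itv (2 + y x i).
    by rewrite mulr_ge0// mulr_ile1.
- move=> x xr; apply: big1 => i _.
  have : `|y x i| <= 1.
    rewrite normrM (gtr0_norm (x := r^-1)) ?invr_gt0// ler_pdivrMr// mul1r.
    exact: le_trans (row_coord_le _ _) xr.
  rewrite ler_norml => /andP[h1 h2].
  by rewrite !step_eq1 ?mulr1//; lra.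
- split=> x xr.
    apply/eqP; apply/negPn/negP => bx0; move: xr; apply/negP; rewrite -leNgt.
    apply: row_norm_le => [|i]; first by rewrite addr_ge0// ltW.
    have : `|y x i| <= 2.
      rewrite leNgt; apply/negP => yi; move/negP: bx0; apply.
      rewrite /b (bigD1 i)//=; move: yi; rewrite ltr_normr => /orP[h|h].
        by rewrite step_eq0 ?mul0r//; lra.
      by rewrite [X in _ * X * _]step_eq0 ?mulr0 ?mul0r//; lra.
    rewrite normrM (gtr0_norm (x := r^-1)) ?invr_gt0// ler_pdivrMr//.
    by rewrite mulr2n mulrDl !mul1r.
  apply: eU; rewrite -ball_normE /= distrC.
  exact: le_lt_trans xr re.
Qed.

(** Cutting off by a bump function, whose radii are kept for the same
purpose. *)
Lemma smooth_extend n (g : 'rV[R]_n -> R^o) (a : 'rV[R]_n) U :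
  smooth_at g a -> nbhs a U ->
  exists (h : 'rV[R]_n -> R^o) (r : R), [/\ 0 < r,
    (forall x, smooth_at h x),
    (forall x, `|x - a| <= r -> h x = g x),
    (forall x, `|x - a| > r + r -> h x = 0) &
    (forall x, `|x - a| <= r + r -> U x)].
Proof.
move=> /smooth_at_open gs aU.
have [b [r [r0 bs b01 b1 [b0 bU]]]] := bump_exists (filterI gs aU).
exists (b \* g), r; split=> //.
- move=> x; have [xr|xr] := leP `|x - a| (r + r).
    by apply: smooth_atM => //; case: (bU x xr).
  apply: (@smooth_at_near _ _ _ (cst 0)); last exact: smooth_at_cst.
  have : \forall y \near x, r + r < `|y - a|.
    have d0 : 0 < `|x - a| - (r + r) by rewrite subr_gt0.
    near=> y.
    have xy : `|x - y| < `|x - a| - (r + r) by near: y; exact: cvgr_dist_lt.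
    by have := ler_distD y x a; lra.
  by apply: filterS => y yr /=; rewrite b0// mul0r.
- by move=> x xr /=; rewrite b1// mul1r.
- by move=> x xr /=; rewrite b0// mul0r.
- by move=> x /bU[].
Unshelve. all: by end_near. Qed.

(** Shrinking towards a by a bump function. Composition with k turns a map that
is smooth only near a into one that is smooth everywhere. *)
Lemma smooth_shrink n (a : 'rV[R]_n) U : nbhs a U ->
  exists k : 'rV[R]_n -> 'rV[R]_n, [/\ forall x, smooth_at k x,
    forall x, U (k x) & \forall x \near a, k x = x].
Proof.
move=> aU; have [b [r [r0 bs b01 b1 [b0 bU]]]] := bump_exists aU.
exists (fun x => a + b x *: (x - a)); split.
- move=> x; apply: smooth_at_row => i.
  rewrite (_ : (fun _ => _) =
    cst (a 0 i : R^o) + b \* (fun y : 'rV[R]_n => (y - a) 0 i : R^o)).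
    apply: smooth_atD; first exact: smooth_at_cst.
    apply: smooth_atM => //; apply: (@smooth_at_coord _ _ _ (fun y => y - a)).
    by apply: smooth_atB; [exact: smooth_at_id|exact: smooth_at_cst].
  by apply/funext => y; rewrite !fctE /= !mxE.
- move=> x; have [xr|xr] := leP `|x - a| (r + r).
    apply: bU; rewrite addrAC subrr add0r normrZ.
    apply: le_trans xr; apply: ler_piMl => //.
    by have /andP[h0 h1] := b01 x; rewrite ger0_norm.
  by rewrite b0// scale0r addr0; exact: nbhs_singleton aU.
- have : \forall x \near a, `|x - a| <= r.
    by near=> x; rewrite distrC; near: x; exact: cvgr_dist_le.
  by apply: filterS => x xr; rewrite b1// scale1r subrKC.
Unshelve. all: by end_near. Qed.

End Bumps.

(** * The inverse function theorem *)

Section InverseFunction.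
Context {R : realType}.

Lemma dist_cont (T : topologicalType) (V : normedModType R) (f : T -> V) a :
  continuous f -> continuous (fun y => `|a - f y| : R).
Proof.
move=> cf y; apply: cvg_norm; apply: cvgB; [exact: cvg_cst|exact: cf].
Qed.

Lemma closed_ball_compact n (a : 'rV[R]_n) (r : R) :
  compact [set u : 'rV[R]_n | `|u - a| <= r].
Proof.
apply: bounded_closed_compact.
  exists (`|a| + r); split; first exact: num_real.
  move=> s rs p pr; apply: ltW; apply: le_lt_trans rs.
  by rewrite -{1}(subrK a p) addrC; apply: le_trans (ler_normD _ _) _; rewrite lerD2l.
under eq_set do rewrite distrC.
apply: (@closed_comp _ _ (fun p : 'rV[R]_n => `|a - p|) [set x | x <= r]).
  by move=> p _; apply: (@dist_cont _ _ id) => x; exact: cvg_id.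
exact: closed_le.
Qed.

Lemma derive_coord (V : normedModType R) n (f : V -> 'rV[R]_n) x v i :
  differentiable f x -> 'D_v (fun y => f y 0 i : R^o) x = ('D_v f x) 0 i.
Proof. by move=> df; rewrite derive_mx ?mxE//; exact: diff_derivable. Qed.

Lemma derive_id_sub n (P : 'rV[R]_n -> 'rV[R]_n) x v :
  differentiable P x -> 'D_v (fun u => u - P u) x = v - 'D_v P x.
Proof.
move=> dP; have := @deriveB R _ _ id P x v (@derivable_id _ _ _ _)
  (diff_derivable dP).
by rewrite derive_id.
Qed.

Lemma smooth_sub_id n (P : 'rV[R]_n -> 'rV[R]_n) x :
  smooth_at P x -> smooth_at (fun u => u - P u) x.
Proof. by move=> sP; apply: smooth_atB => //; exact: smooth_at_id. Qed.

Definition jac n m (P : 'rV[R]_n -> 'rV[R]_m) (u : 'rV[R]_n) : 'M[R]_(n, m) :=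
  \matrix_(i, j) ('D_(delta_mx 0 i) P u) 0 j.

Lemma jacE n m (P : 'rV[R]_n -> 'rV[R]_m) u v :
  differentiable P u -> 'D_v P u = v *m jac P u.
Proof.
move=> dP; rewrite derive_row//; apply/rowP => j; rewrite summxE mxE.
by apply: eq_bigr => i _; rewrite !mxE.
Qed.

Lemma smooth_at_det (V : normedModType R) n (M : V -> 'M[R]_n) x :
  (forall i j, smooth_at (fun u => M u i j : R^o) x) ->
  smooth_at (fun u => \det (M u) : R^o) x.
Proof.
elim: n M => [|n IH] M sM.
  by under eq_fun do rewrite det_mx00; exact: smooth_at_cst.
under eq_fun do rewrite (expand_det_row _ ord0).
apply: smooth_at_sum => j; apply: smooth_atM => //.
apply: smooth_atM; first exact: smooth_at_cst.
apply: IH => k l.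
by apply: smooth_at_near (sM (lift ord0 k) (lift j l)); apply: nearW => u; rewrite !mxE.
Qed.

(** By Cramer's rule. *)
Lemma smooth_at_invmx (V : normedModType R) n (M : V -> 'M[R]_n) x i j :
  M x \in unitmx ->
  (forall i j, smooth_at (fun u => M u i j : R^o) x) ->
  smooth_at (fun u => invmx (M u) i j : R^o) x.
Proof.
move=> uM sM; have sD := smooth_at_det sM.
have D0 : \det (M x) != 0 by rewrite -unitfE -unitmxE.
apply: (@smooth_at_near _ _ _ ((fun u => (\det (M u))^-1 : R^o)
   \* (fun u => (-1) ^+ (j + i) *: (\det (row' j (col' i (M u))) : R^o)))).
  have /cvgr_neq0 /(_ D0) := smooth_at_cont sD.
  apply: filterS => u; rewrite -unitfE -unitmxE => uMu.
  by rewrite /invmx uMu !mxE.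
apply: smooth_atM; first exact: smooth_atV.
apply: smooth_atZ; apply: smooth_at_det => k l.
by apply: smooth_at_near (sM _ _); apply: nearW => u; rewrite !mxE.
Qed.

(** Only a map whose derivative at a is the identity is inverted: the
submersions used below are completed to such maps. The inverse is found by
minimising the distance to w over a closed ball; a minimiser u which is not a
solution would be improved by the Newton step u + (w - P u). *)
Lemma inverse_function n (P : 'rV[R]_n -> 'rV[R]_n) (a : 'rV[R]_n) :
  (forall x, smooth_at P x) -> (forall v, 'D_v P a = v) ->
  exists T : 'rV[R]_n -> 'rV[R]_n, [/\ smooth_at T (P a),
    (\forall u \near a, T (P u) = u) & (\forall w \near P a, P (T w) = w)].
Proof.
move=> sP dP.
have [f ff] : exists f : 'rV[R]_n -> 'rV[R]_n, f = fun u => u - P u by eexists.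
have fE u : f u = u - P u by rewrite ff.
have sf x : smooth_at f x by rewrite ff; exact: smooth_sub_id.
have Df u v : 'D_v f u = v - 'D_v P u.
  by rewrite ff derive_id_sub//; exact/smooth_at_diff.
have dif x : differentiable f x by exact/smooth_at_diff.
have diP x : differentiable P x by exact/smooth_at_diff.
(* Bounding the partial derivatives of f = id - P by c makes f a contraction of
   ratio 1/2. *)
pose c : R := (2 * (n%:R + 1))^-1.
have n1 : (0 : R) < n%:R + 1 by rewrite ltr_wpDl.
have c0 : 0 < c by rewrite invr_gt0 mulr_gt0.
have [r r0 rc] : exists2 r : R, 0 < r & forall u, `|u - a| <= r ->
    forall i j, `|('D_(delta_mx 0 i) f u) 0 j| <= c.
  have : \forall u \near a, forall ij : 'I_n * 'I_n,
      `|('D_(delta_mx 0 ij.1) f u) 0 ij.2| <= c.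
    apply: (@filter_forall _ _ (fun ij => [set u |
      `|('D_(delta_mx 0 ij.1) f u) 0 ij.2| <= c]) (nbhs a)) => -[i j] /=.
    have := smooth_at_cont (smooth_at_coord j
      (smooth_at_derive (delta_mx 0 i) (sf a))).
    have D0 : ('D_(delta_mx 0 i) f a) 0 j = 0.
      by rewrite Df dP subrr mxE.
    move=> /cvgr_dist_le /(_ _ c0); apply: filterS => u h.
    by apply: le_trans h; rewrite D0 sub0r normrN.
  move=> /nbhs_ballP[e /= e0 eB]; exists (e / 2); first by rewrite divr_gt0.
  move=> u ue i j; apply: (eB u _ (i, j)).
  by rewrite -ball_normE /= distrC; apply: (le_lt_trans ue); lra.
pose K := [set u : 'rV[R]_n | `|u - a| <= r].
have fD u v : K u -> `|'D_v f u| <= 2^-1 * `|v|.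
  move=> Ku; apply: row_norm_le => [|j].
    by apply: mulr_ge0 => //; rewrite invr_ge0.
  rewrite derive_row// summxE; apply: le_trans (ler_norm_sum _ _ _) _.
  apply: (@le_trans _ _ (\sum_(i < n) `|v| * c)).
    apply: ler_sum => i _; rewrite mxE normrM.
    by apply: ler_pM => //; [exact: row_coord_le|exact: rc].
  rewrite sumr_const card_ord -[leLHS]mulr_natr -mulrA mulrC.
  apply: ler_wpM2r => //.
  by rewrite /c invfM -mulrA ler_piMr ?invr_ge0// ler_pdivrMl// mulr1 lerDl.
have lip p q : K p -> K q -> `|f q - f p| <= 2^-1 * `|q - p|.
  move=> Kp Kq; apply: row_norm_le => [|j].
    by apply: mulr_ge0 => //; rewrite invr_ge0.
  have [|t t01 E] := @mvt_line _ _ (fun u => f u 0 j : R^o) p (q - p).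
    by move=> t _; exact/smooth_at_diff/smooth_at_coord.
  move: E; rewrite subrKC => E.
  have -> : (f q - f p) 0 j = ('D_(q - p) f (p + t *: (q - p))) 0 j.
    by rewrite mxE [X in _ + X]mxE E derive_coord.
  apply: le_trans (row_coord_le _ _) (fD _ _ _).
  rewrite /K /= addrAC; apply: ball_convex => //.
  by rewrite addrAC subrKC.
have inj p q : K p -> K q -> `|q - p| <= 2 * `|P q - P p|.
  move=> Kp Kq; have := lip p q Kp Kq; have := ler_normD (P q - P p) (f q - f p).
  have -> : P q - P p + (f q - f p) = q - p.
    by rewrite !fE; apply/rowP => j; rewrite !mxE; ring.
  lra.
have surj w : `|w - P a| <= r / 2 -> exists u, K u /\ P u = w.
  move=> wr.
  have cP : continuous (fun u : 'rV[R]_n => `|w - P u| : R).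
    by apply: dist_cont => u; exact: (smooth_at_cont (sP u)).
  have [|||u] := @EVT_min_rV _ _ (fun u => `|w - P u| : R) K.
  - by exists a; rewrite /K /= subrr normr0 ltW.
  - exact: closed_ball_compact.
  - exact: continuous_subspaceT.
  rewrite inE => Ku umin; exists u; split=> //.
  have Ka : K a by rewrite /K /= subrr normr0 ltW.
  pose u' := w + f u.
  have Ku' : K u'.
    rewrite /K /= (_ : u' - a = (w - P a) + (f u - f a)); last first.
      by rewrite /u' !fE; apply/rowP => j; rewrite !mxE; ring.
    apply: le_trans (ler_normD _ _) _; have := lip a u Ka Ku.
    have : `|u - a| <= r by []. lra.
  have := umin u'; rewrite inE => /(_ Ku').
  have -> : w - P u' = f u' - f u.
    rewrite [f u']fE {2}/u'; move: (P u') => P'.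
    by apply/rowP => j; rewrite !mxE; ring.
  have := lip u u' Ku Ku'.
  have -> : u' - u = w - P u.
    by rewrite /u' fE; apply/rowP => j; rewrite !mxE; ring.
  move=> h1 h2; have : `|w - P u| = 0 by have := normr_ge0 (w - P u); lra.
  by move/eqP; rewrite normr_eq0 subr_eq0 => /eqP.
pose T w := xget a [set u | K u /\ P u = w].
pose W := [set w : 'rV[R]_n | `|w - P a| < r / 2].
have TP w : W w -> K (T w) /\ P (T w) = w.
  move=> Ww; rewrite /T; case: xgetP => [u _ []//|h].
  by have [u uP] := surj w (ltW Ww); case: (h u).
have r2 : 0 < r / 2 by rewrite divr_gt0.
have oW : open W.
  rewrite (_ : W = ball (P a) (r / 2)); first exact: ball_open.
  by apply/seteqP; split=> w; rewrite /W -ball_normE /= distrC.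
have Wa : W (P a) by rewrite /W /= subrr normr0.
have uJ u : K u -> jac P u \in unitmx.
  move=> Ku; rewrite -row_free_unit -kermx_eq0; apply/eqP/row_matrixP => i.
  rewrite row0; set v := row i _.
  have v0 : v *m jac P u = 0 by apply/sub_kermxP; exact: row_sub.
  have := fD u v Ku; rewrite Df jacE// v0 subr0 => h.
  by apply/eqP; rewrite -normr_eq0; apply/eqP; have := normr_ge0 v; lra.
have dT w : W w -> differentiable T w /\
    forall k, 'D_k T w = k *m invmx (jac P (T w)).
  move=> Ww; have [Ku uw] := TP w Ww; set u := T w in Ku uw *.
  set B := invmx _.
  have [k0 k00 kB] : exists2 k0 : R, 0 < k0 &
      forall v : 'rV[R]_n, `|v *m B| <= k0 * `|v|.
    have lB : linear (fun v : 'rV[R]_n => v *m B).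
      by move=> b x y; rewrite mulmxDl scalemxAl.
    pose L := HB.pack_for {linear 'rV[R]_n -> 'rV[R]_n}
      (fun v : 'rV[R]_n => v *m B) (GRing.isLinear.Build _ _ _ _ _ lB).
    apply: (@linear_lipschitz _ _ _ L) => x.
    by apply: smooth_at_cont; apply: smooth_at_mulmx; exact: smooth_at_id.
  apply: diff_of_est.
  - by move=> b x y; rewrite mulmxDl scalemxAl.
  - move=> x; apply: smooth_at_cont; apply: smooth_at_mulmx.
    exact: smooth_at_id.
  move=> e e0; have e1 : 0 < e / (k0 * 2) by rewrite divr_gt0// mulr_gt0.
  (* T is 2-Lipschitz by inj and k0 bounds the inverse of the Jacobian: an error
     e / (2 k0) for P gives an error e for T. *)
  have dPu : \forall v \near (0 : 'rV[R]_n),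
      `|P (v + u) - P u - v *m jac P u| <= e / (k0 * 2) * `|v|.
    have /diff_locallyP[_ +] := diP u.
    move=> /eqaddoP /(_ _ e1); apply: filterS => v /=.
    by rewrite !fctE /= opprD addrA -deriveE// jacE.
  have [d /= d0 dB] : exists2 d : R, 0 < d & forall v : 'rV[R]_n, `|v| < d ->
      `|P (v + u) - P u - v *m jac P u| <= e / (k0 * 2) * `|v|.
    move: dPu => /nbhs_ballP[d d0 dB]; exists d => // v vd; apply: dB.
    by rewrite -ball_normE /= sub0r normrN.
  have nW : \forall k \near (0 : 'rV[R]_n), W (k + w).
    have : \forall x \near w, W x by exact: open_nbhs_nbhs.
    by rewrite (near_shift 0 w) /= subr0.
  have nd : \forall k \near (0 : 'rV[R]_n), `|k| < d / 2.
    by apply: nbhs0_lt; rewrite divr_gt0.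
  near=> k.
  have Wk : W (k + w) by near: k.
  have [Kk Ek] := TP _ Wk; set v := T (k + w) - u.
  have Ev : T (k + w) = v + u by rewrite /v subrK.
  have vk : `|v| <= 2 * `|k|.
    have := inj u (T (k + w)) Ku Kk.
    by rewrite Ek uw addrK.
  have kd : `|k| < d / 2 by near: k.
  have vd : `|v| < d by apply: (le_lt_trans vk); lra.
  have := dB v vd; rewrite -Ev Ek uw addrK => h.
  rewrite (_ : v - k *m B = - ((k - v *m jac P u) *m B)); last first.
    by rewrite mulmxBl -mulmxA mulmxV ?uJ// mulmx1 opprB.
  rewrite normrN; apply: le_trans (kB _) _.
  apply: (@le_trans _ _ (k0 * (e / (k0 * 2) * (2 * `|k|)))).
    apply: ler_wpM2l; first exact: ltW.
    apply: (le_trans h); apply: ler_wpM2l => //; exact: ltW.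
  rewrite le_eqVlt; apply/orP; left; apply/eqP; field.
  by rewrite gt_eqF.
have CT k : Ck k W T.
  elim: k => [|k IH].
    by move=> w Ww; apply: differentiable_continuous; case: (dT w Ww).
  split=> [w Ww|v]; first by case: (dT w Ww).
  have H : Ck k W (fun w => v *m invmx (jac P (T w))).
    apply: Ck_row => // j.
    apply: (@Ck_comp _ _ _ _ _ [set u | jac P u \in unitmx] T
      (fun u => (v *m invmx (jac P u)) 0 j)) => //.
      by move=> w /TP[/uJ].
    apply: smooth_Ck => u uu; under eq_fun do rewrite mxE.
    apply: smooth_at_sum => i; apply: smooth_atZ; apply: smooth_at_invmx => //.
    move=> i' j'; under eq_fun do rewrite mxE.
    exact/smooth_at_coord/smooth_at_derive.
  by apply: (Ck_eq oW) H => w Ww; case: (dT w Ww) => _ ->.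
exists T; split.
- by exists W.
- have Ka : K a by rewrite /K /= subrr normr0 ltW.
  have nK : \forall u \near a, K u.
    by near=> u; rewrite /K /= distrC; near: u; exact: cvgr_dist_le.
  have nW : \forall u \near a, W (P u).
    have /(_ W) := smooth_at_cont (sP a); apply.
    exact: open_nbhs_nbhs.
  near=> u; have Ku : K u by near: u.
  have Wu : W (P u) by near: u.
  have [K2 E2] := TP _ Wu; have := inj _ _ Ku K2.
  rewrite E2 subrr normr0 mulr0 normr_le0 subr_eq0 => /eqP; exact.
- by apply: filterS (open_nbhs_nbhs (conj oW Wa)) => w /TP[].
Unshelve. all: by end_near. Qed.
End InverseFunction.

(** * Level sets of submersions *)

Section LevelSet.
Context {R : realType}.

Lemma smooth_at_compW (V W : normedModType R) n (f : V -> 'rV[R]_n)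
    (g : 'rV[R]_n -> W) a v :
  smooth_at f a -> smooth_at g (f a) ->
  'D_v (g \o f) a = 'D_('D_v f a) g (f a).
Proof.
move=> /smooth_at_diff df /smooth_at_diff dg.
rewrite !deriveE//; first by rewrite diff_comp.
exact: differentiable_comp.
Qed.

(** The level set is parametrised by a local inverse of u |-> (u - a) E + (F u
- F a) S, where S is a right inverse of the derivative and E projects onto its
kernel. The parametrisation c is defined on the whole ambient space and factors
through E, which avoids a choice of coordinates on the kernel. *)
Lemma level_set p q (F : 'rV[R]_p -> 'rV[R]_q) (a : 'rV[R]_p) :
  (forall x, smooth_at F x) -> (forall k, exists w, 'D_w F a = k) ->
  exists (E : 'M[R]_p) (c : 'rV[R]_p -> 'rV[R]_p),
    [/\ smooth_at c 0, c 0 = a, \forall z \near (0 : 'rV[R]_p), F (c z) = F a,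
      \forall u \near a, F u = F a -> c ((u - a) *m E) = u &
      forall w, 'D_w F a = 0 -> 'D_(w *m E) c 0 = w].
Proof.
move=> sF surj.
have dF x : differentiable F x by exact/smooth_at_diff.
pose D := jac F a.
have DE w : 'D_w F a = w *m D by rewrite jacE.
have [S SD] : exists S : 'M[R]_(q, p), S *m D = 1%:M.
  have /choice[s sP] : forall j : 'I_q, exists w : 'rV[R]_p,
      w *m D = delta_mx 0 j.
    by move=> j; have [w] := surj (delta_mx 0 j); rewrite DE; exists w.
  exists (\matrix_j s j); apply/row_matrixP => j.
  by rewrite row_mul rowK sP rowE mulmx1.
(* The projection onto the kernel of D along the image of S. *)
pose E : 'M[R]_p := 1%:M - D *m S.
have ED : E *m D = 0 by rewrite mulmxBl mul1mx -mulmxA SD mulmx1 subrr.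
have SE : S *m E = 0 by rewrite mulmxBr mulmx1 mulmxA SD mul1mx subrr.
have EE : E *m E = E by rewrite {1}/E mulmxBl mul1mx -mulmxA SE mulmx0 subr0.
have EwD w : w *m D = 0 -> w *m E = w.
  by move=> wD; rewrite mulmxBr mulmx1 mulmxA wD mul0mx subr0.
pose P u := (u - a) *m E + (F u - F a) *m S.
have sub_s (V : normedModType R) (k : V) b : smooth_at (fun u => u - k) b.
  by apply: smooth_atB; [exact: smooth_at_id|exact: smooth_at_cst].
have s1 x : smooth_at (fun u => (u - a) *m E) x by apply: smooth_at_mulmx.
have s2 x : smooth_at (fun u => (F u - F a) *m S) x.
  apply: smooth_at_mulmx; apply: smooth_atB => //; exact: smooth_at_cst.
have sP x : smooth_at P x by exact: smooth_atD (s1 x) (s2 x).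
have Dsub (V : normedModType R) n (f : V -> 'rV[R]_n) k b v :
    differentiable f b -> 'D_v (fun u => f u - k) b = 'D_v f b.
  move=> df; have := @deriveB R _ _ f (cst k) b v (diff_derivable df)
    (@derivable_cst _ _ _ _ _ _).
  by rewrite derive_cst subr0.
have Dmul (V : normedModType R) n m (f : V -> 'rV[R]_n) (A : 'M[R]_(n, m)) b v :
    differentiable f b -> 'D_v (fun u => f u *m A) b = 'D_v f b *m A.
  move=> df.
  have lA : linear (fun x : 'rV[R]_n => x *m A).
    by move=> r x y; rewrite mulmxDl scalemxAl.
  have cA : continuous (fun x : 'rV[R]_n => x *m A).
    by move=> x; apply: smooth_at_cont; apply: smooth_at_mulmx; exact: smooth_at_id.
  by case: (derive_lin v lA cA df).
have idd x : differentiable (@id 'rV[R]_p) x by exact: smooth_at_diff (smooth_at_id x).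
have dP v : 'D_v P a = v.
  rewrite (@deriveD R _ _ (fun u => (u - a) *m E) (fun u => (F u - F a) *m S));
    try exact/diff_derivable/smooth_at_diff.
  rewrite !Dmul; try exact/smooth_at_diff.
    rewrite (@Dsub _ _ id)// Dsub// derive_id DE /E mulmxBr mulmx1 mulmxA.
    by rewrite subrK.
  by apply/smooth_at_diff/smooth_atB => //; exact: smooth_at_cst.
have Pa : P a = 0 by rewrite /P !subrr !mul0mx addr0.
have [T] := inverse_function sP dP; rewrite Pa => -[sT TP PT].
have Ta : T 0 = a by rewrite -Pa; exact: nbhs_singleton TP.
have sE x : smooth_at (fun z : 'rV[R]_p => z *m E) x.
  by apply: smooth_at_mulmx; exact: smooth_at_id.
have nE (Q : set 'rV[R]_p) : nbhs (0 : 'rV[R]_p) Q ->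
    \forall z \near (0 : 'rV[R]_p), Q (z *m E).
  have /(_ Q) := smooth_at_cont (sE 0); rewrite mul0mx; exact.
exists E, (T \o (fun z => z *m E)); split.
- by apply: smooth_at_compr => //; rewrite mul0mx.
- by rewrite /= mul0mx.
- have := nE _ PT; apply: filterS => z /= /(congr1 (fun v => v *m D)).
  rewrite /P mulmxDl -!mulmxA ED SD !mulmx0 mulmx1 add0r => /eqP.
  by rewrite subr_eq0 => /eqP.
- apply: filterS TP => u Tu Fu; rewrite /= -mulmxA EE -[RHS]Tu /P Fu subrr.
  by rewrite mul0mx addr0.
- move=> w; rewrite DE => wD.
  rewrite smooth_at_compW//; last by rewrite mul0mx.
  rewrite (@Dmul _ _ _ id)// derive_id !EwD// ?mul0mx//.
  have := @smooth_at_compW _ _ _ P T a w (sP a); rewrite Pa dP => /(_ sT) <-.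
  by rewrite (near_eq_derive w TP) derive_id.
Qed.

End LevelSet.

(** * Smooth functions and maps on manifolds *)

Section SmoothFunctions.
Context {R : realType}.
Implicit Types M N : manifold R.

Lemma chart_nbhs M n (c : @chart R M n) (x : M) : cdom c x -> nbhs x (cdom c).
Proof. by move=> cx; exact: open_nbhs_nbhs (conj (@cdom_open _ _ _ c) cx). Qed.

Lemma chart_img_nbhs M n (c : @chart R M n) (x : M) (U : set M) : cdom c x -> nbhs x U ->
  \forall u \near c x, [/\ cdom c (cinv c u), c (cinv c u) = u & U (cinv c u)].
Proof.
move=> cx Ux; have := cinv_cont cx.
rewrite /prop_for /continuous_at (cmapK cx) => ci.
have n1 : \forall u \near c x, cdom c (cinv c u) /\ U (cinv c u).
  exact: (ci _ (filterI (chart_nbhs cx) Ux)).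
have n2 : nbhs (c x) (c @` cdom c).
  by apply: open_nbhs_nbhs; split; [exact: cimg_open|exists x].
apply: filterS (filterI n1 n2) => u [[cu Uu]] [z cz zu]; split=> //.
by rewrite -zu cmapK.
Qed.

Lemma adm_chart M (c : @chart R M (mdim M)) : atlas (m := M) c -> admissible c.
Proof. by move=> cA d dA; exact: atlas_compat. Qed.

Lemma smooth_fun_adm M n (c : @chart R M n) (h : M -> R) (x : M) :
  admissible c -> cdom c x ->
  (exists2 d, atlas (m := M) d /\ cdom d x &
     smooth_at (h \o cinv d : _ -> R^o) (d x)) ->
  smooth_at (h \o cinv c : _ -> R^o) (c x).
Proof.
move=> ca cx [d [dA dx] sh].
apply: (@smooth_at_near _ _ _ ((h \o cinv d) \o (d \o cinv c))).
  apply: filterS (chart_img_nbhs cx (chart_nbhs dx)) => u [_ _ du] /=.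
  by rewrite cmapK.
have [sdc _] := ca d dA x cx dx.
apply: smooth_at_comp => //=.
by rewrite cmapK.
Qed.

Definition smooth_fun_at M (h : M -> R) (x : M) :=
  exists2 d, atlas (m := M) d /\ cdom d x &
     smooth_at (h \o cinv d : _ -> R^o) (d x).

Lemma smooth_funE M (h : M -> R) :
  smooth_fun h <-> forall x, smooth_fun_at h x.
Proof.
split=> [sh x|sh c cA x cx].
  by have [c cA cx] := atlas_cover x; exists c => //; exact: sh.
by apply: smooth_fun_adm => //; [exact: adm_chart|exact: sh].
Qed.

Lemma smooth_fun_at_adm M n (c : @chart R M n) (h : M -> R) (x : M) :
  admissible c -> cdom c x ->
  smooth_fun_at h x <-> smooth_at (h \o cinv c : _ -> R^o) (c x).
Proof.
move=> ca cx; split=> [|sh]; first exact: smooth_fun_adm.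
have [d dA dx] := atlas_cover x; exists d => //.
apply: (@smooth_at_near _ _ _ ((h \o cinv c) \o (c \o cinv d))).
  apply: filterS (chart_img_nbhs dx (chart_nbhs cx)) => u [_ _ cu] /=.
  by rewrite cmapK.
have [_ scd] := ca d dA x cx dx.
apply: smooth_at_comp => //=.
by rewrite cmapK.
Qed.

Lemma smooth_fun_at_near M (h k : M -> R) (x : M) :
  (\forall z \near x, h z = k z) -> smooth_fun_at h x -> smooth_fun_at k x.
Proof.
move=> hk [d [dA dx] sh]; exists d => //.
apply: smooth_at_near sh.
by apply: filterS (chart_img_nbhs dx hk) => u [].
Qed.

Lemma smooth_fun_at_cont M (h : M -> R) (x : M) :
  smooth_fun_at h x -> {for x, continuous h}.
Proof.
move=> [d [dA dx] sh].
have c1 : {for x, continuous ((h \o cinv d) \o d)}.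
  apply: continuous_comp; first exact: cmap_cont.
  exact: smooth_at_cont sh.
have E : \forall z \near x, ((h \o cinv d) \o d) z = h z.
  by apply: filterS (chart_nbhs dx) => z dz /=; rewrite cmapK.
rewrite /prop_for /continuous_at -(nbhs_singleton E).
apply: cvg_trans c1; exact: near_eq_cvg.
Qed.

(** The extension by zero of a function cut off in a chart is smooth because
its support, the image of a closed ball of the chart, is compact, hence closed
as the manifold is Hausdorff. *)
Lemma smooth_fun_extend M (h : M -> R) (x : M) (U : set M) :
  smooth_fun_at h x -> nbhs x U ->
  exists k : M -> R, [/\ smooth_fun k, \forall z \near x, k z = h z &
    forall z, ~ U z -> \forall z' \near z, k z' = 0].
Proof.
move=> [d [dA dx] sh] Ux.
have [g [r [r0 gs gr g0 gU]]] := smooth_extend sh (chart_img_nbhs dx Ux).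
pose k z := if `[< cdom d z >] then g (d z) else 0.
have kd z : cdom d z -> k z = g (d z) by move=> dz; rewrite /k asboolT.
have kn z : ~ cdom d z -> k z = 0 by move=> dz; rewrite /k asboolF.
pose K := cinv d @` [set u | `|u - d x| <= r + r].
have cK : closed K.
  apply: compact_closed; first exact: m_hausdorff.
  apply: continuous_compact; last exact: closed_ball_compact.
  apply: continuous_in_subspaceT => u; rewrite inE => ur.
  by have [du <- _] := gU u ur; exact: cinv_cont.
have Kk z : ~ K z -> \forall z' \near z, k z' = 0.
  move=> Kz; have nK : \forall z' \near z, ~ K z'.
    by apply: (open_nbhs_nbhs (A := ~` K)); split; [exact: closed_openC|].
  apply: filterS nK => z' Kz'; have [dz'|dz'] := pselect (cdom d z').
    rewrite kd// g0// ltNge; apply/negP => ur; apply: Kz'.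
    by exists (d z') => //; exact: cmapK.
  by rewrite kn.
exists k; split.
- apply/smooth_funE => z; have [dz|dz] := pselect (cdom d z).
    exists d => //; apply: smooth_at_near (gs (d z)).
    apply: filterS (chart_img_nbhs dz filterT) => u [du E _] /=.
    by rewrite kd// E.
  have Kz : ~ K z by move=> [u ur uz]; have [+ _ _] := gU u ur; rewrite uz.
  have [e eA ez] := atlas_cover z.
  apply: (@smooth_fun_at_near _ (fun=> 0)); last first.
    by exists e => //; exact: smooth_at_cst.
  by apply: filterS (Kk z Kz) => z' ->.
- have n1 : \forall z \near x, `|d x - d z| <= r.
    by have := cmap_cont dx => /cvgr_dist_le /(_ r r0).
  apply: filterS (filterI n1 (chart_nbhs dx)) => z [zr dz].
  have dzr : `|d z - d x| <= r by rewrite distrC.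
  by rewrite kd// (gr _ dzr) /= cmapK.
- by move=> z Uz; apply: Kk => -[u ur uz]; apply: Uz; have [_ _] := gU u ur; rewrite uz.
Qed.

Lemma bump_fun M (x : M) (U : set M) : nbhs x U ->
  exists k : M -> R, [/\ smooth_fun k, \forall z \near x, k z = 1 &
    forall z, ~ U z -> \forall z' \near z, k z' = 0].
Proof.
move=> Ux; have [c cA cx] := atlas_cover x.
by apply: (@smooth_fun_extend _ (fun=> 1)) => //; exists c => //; exact: smooth_at_cst.
Qed.

(** Tested on functions only: continuity is a consequence, by bump
functions. *)
Definition smooth_map_at M N (f : M -> N) (x : M) :=
  forall h, smooth_fun h -> smooth_fun_at (h \o f) x.

Lemma smooth_map_at_cont M N (f : M -> N) (x : M) :
  smooth_map_at f x -> {for x, continuous f}.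
Proof.
move=> fh U Ux; have [k [sk k1 k0]] := bump_fun Ux.
have ck : {for x, continuous (k \o f)} by exact/smooth_fun_at_cont/fh.
have : \forall z \near x, (k \o f) z != 0.
  have /cvgr_neq0 := ck; apply.
  by rewrite /= (nbhs_singleton k1) oner_neq0.
apply: filterS => z kz; apply: contrapT => /k0/nbhs_singleton E.
by move: kz; rewrite /= E eqxx.
Qed.

Lemma smooth_fun_at_comp M N (f : M -> N) (h : N -> R) (x : M) :
  smooth_map_at f x -> smooth_fun_at h (f x) -> smooth_fun_at (h \o f) x.
Proof.
move=> sf sh; have [k [sk kh _]] := smooth_fun_extend sh filterT.
have cf := smooth_map_at_cont sf.
apply: smooth_fun_at_near (sf k sk); exact: (cf _ kh).
Qed.

Lemma smooth_fun_at_coord M n (c : @chart R M n) (x : M) i :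
  admissible c -> cdom c x -> smooth_fun_at (fun z => c z 0 i) x.
Proof.
move=> ca cx; apply/(smooth_fun_at_adm _ ca cx).
apply: (@smooth_at_near _ _ _ (fun u : 'rV[R]_n => u 0 i : R^o)).
  by apply: filterS (chart_img_nbhs cx filterT) => u [_ /= -> _].
exact/smooth_at_coord/smooth_at_id.
Qed.

(** Bump functions give continuity, and cut-off coordinates give smoothness in
charts. *)
Lemma smooth_mapE M N (f : M -> N) :
  smooth_map f <-> forall x, smooth_map_at f x.
Proof.
split=> [sf x h sh|sf x].
  by have /smooth_funE := smooth_fun_comp (SMap sf) sh; exact.
have cf := smooth_map_at_cont (sf x).
split=> // c d cA dA cx dfx; apply: smooth_at_row => i.
have si := smooth_fun_at_coord i (adm_chart dA) dfx.
have := smooth_fun_at_comp (sf x) si.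
by move/(smooth_fun_at_adm _ (adm_chart cA) cx).
Qed.

Lemma smooth_mapP M N (f : M -> N) :
  (forall h, smooth_fun h -> smooth_fun (h \o f)) -> smooth_map f.
Proof.
by move=> fh; apply/smooth_mapE => x h sh; move/smooth_funE: (fh h sh); exact.
Qed.

Lemma smooth_map_fun M N (f : M -> N) (h : N -> R) :
  smooth_map f -> smooth_fun h -> smooth_fun (h \o f).
Proof. by move=> sf; exact: (smooth_fun_comp (SMap sf)). Qed.

Lemma smooth_map_comp M N (P : manifold R) (f : M -> N) (g : N -> P) :
  smooth_map f -> smooth_map g -> smooth_map (g \o f).
Proof.
move=> sf sg; apply: smooth_mapP => h sh.
exact: (smooth_map_fun sf (smooth_map_fun sg sh)).
Qed.

Lemma smooth_map_cst M N (y : N) : smooth_map (fun _ : M => y).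
Proof. by apply: smooth_mapP => h _; exact: smooth_fun_cst. Qed.

Lemma smap_cont M N (f : smap M N) : continuous f.
Proof. by move=> x; case: (smapP f x). Qed.

Definition scomp M N (P : manifold R) (g : smap N P) (f : smap M N) : smap M P :=
  SMap (smooth_map_comp (smapP f) (smapP g)).

Definition sconst M N (y : N) : smap M N := SMap (@smooth_map_cst M N y).

Lemma smooth_fun_sum M n (h : 'I_n -> M -> R) :
  (forall i, smooth_fun (h i)) -> smooth_fun (fun x => \sum_i h i x).
Proof.
elim: n h => [|n IH] h sh.
  by under eq_fun do rewrite big_ord0; exact: smooth_fun_cst.
under eq_fun do rewrite big_ord_recl.
by apply: smooth_funD => //; exact: IH.
Qed.

End SmoothFunctions.

(** * Euclidean spaces and global coordinates *)

Section EuclideanManifold.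
Context {R : realType}.

Lemma rn_chart_img n : open (@id 'rV[R]_n @` setT).
Proof. by rewrite image_id; exact: openT. Qed.

Definition rn_chart n : chart 'rV[R]_n n :=
  @Chart R 'rV[R]_n n setT id id openT (@rn_chart_img n) (fun x _ => erefl)
    (fun x _ => cvg_id) (fun x _ => cvg_id).

Lemma rn_atlas_compat n : forall c d, [set rn_chart n] c -> [set rn_chart n] d ->
  compatible c d.
Proof.
by move=> c d /= -> -> x _ _; split; exact: smooth_at_id.
Qed.

Lemma rn_atlas_cover n (x : 'rV[R]_n) :
  exists2 c, [set rn_chart n] c & cdom c x.
Proof. by exists (rn_chart n). Qed.

Lemma row_norm_lt n (v : 'rV[R]_n) (e : R) :
  0 < e -> (forall i, `|v 0 i| < e) -> `|v| < e.
Proof.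
move=> e0 h; rewrite [X in X < _]mx_normrE.
by apply: bigmax_lt => // -[i j] _; rewrite ord1; exact: h.
Qed.

Lemma rn_second_countable n : @second_countable 'rV[R]_n.
Proof.
pose f (p : 'rV[rat]_n * nat) : set 'rV[R]_n :=
  ball (map_mx ratr p.1 : 'rV[R]_n) (p.2.+1%:R^-1 : R).
exists (f @` setT); first exact: (sub_countable (card_image_le _ _) (countableP _)).
split=> [U [p _ <-]|x U /nbhs_ballP[e /= e0 eU]].
  by apply: ball_open; rewrite invr_gt0 ltr0n.
have e2 : 0 < e / 2 by rewrite divr_gt0.
have [k] := ltr_add_invr e2; rewrite add0r => ke.
set r : R := k.+1%:R^-1 in ke; have r0 : 0 < r by rewrite invr_gt0 ltr0n.
have /choice[q qP] : forall i : 'I_n, exists q : rat, `|ratr q - x 0 i| < r.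
  move=> i; have : x 0 i - r < x 0 i + r by lra.
  move=> /rat_in_itvoo[q]; rewrite in_itv /= => /andP[h1 h2]; exists q.
  by rewrite ltr_norml; lra.
have qx : `|map_mx ratr (\row_i q i) - x| < r.
  by apply: row_norm_lt => // i; rewrite !mxE.
exists (f (\row_i q i, k)); first by split; [exists (\row_i q i, k)|rewrite /f /= -ball_normE].
move=> y; rewrite /f /= -ball_normE /= => yr; apply: eU; rewrite -ball_normE /=.
have := ler_distD (map_mx ratr (\row_i q i)) x y; rewrite [`|x - map_mx _ _|]distrC.
rewrite -/r in yr; lra.
Qed.

Definition rn n : manifold R :=
  @Manifold R 'rV[R]_n n [set rn_chart n] (@rn_atlas_compat n)
    (@rn_atlas_cover n) (@norm_hausdorff _ _) (@rn_second_countable n).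

Lemma smooth_fun_rn n (h : rn n -> R) :
  smooth_fun h <-> forall x : 'rV[R]_n, smooth_at (h : 'rV[R]_n -> R^o) x.
Proof.
by split=> [sh x|sh c -> x _]; [exact: (sh (rn_chart n))|exact: sh].
Qed.

Lemma smooth_map_rn_l (N : manifold R) n (f : rn n -> N) :
  (forall h x, smooth_fun h -> smooth_at (h \o f : 'rV[R]_n -> R^o) x) ->
  smooth_map f.
Proof.
by move=> fh; apply: smooth_mapP => h sh; apply/smooth_fun_rn => x; exact: fh.
Qed.

Lemma smooth_map_rn (M : manifold R) n (f : M -> rn n) :
  (forall i, smooth_fun (fun x => f x 0 i)) -> smooth_map f.
Proof.
move=> fs; apply: smooth_mapP => h /smooth_fun_rn sh.
apply/smooth_funE => x; have [c cA cx] := atlas_cover x.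
exists c => //; apply: (@smooth_at_comp _ _ _ (f \o cinv c) h) => //.
by apply: smooth_at_row => i; exact: fs.
Qed.

Lemma smooth_map_coord (M : manifold R) n (f : M -> rn n) i :
  smooth_map f -> smooth_fun (fun x => f x 0 i).
Proof.
move=> sf.
apply: (@smooth_map_fun _ M (rn n) f (fun u : 'rV[R]_n => u 0 i) sf).
by apply/smooth_fun_rn => x; exact/smooth_at_coord/smooth_at_id.
Qed.

Lemma smooth_map_rn_rn n m (f : rn n -> rn m) :
  (forall x, smooth_at (f : 'rV[R]_n -> 'rV[R]_m) x) <-> smooth_map f.
Proof.
split=> [sf|sf x].
  by apply: smooth_map_rn => i; apply/smooth_fun_rn => x; exact: smooth_at_coord.
by apply: smooth_at_row => i; move/smooth_fun_rn: (smooth_map_coord i sf).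
Qed.

(** Being defined everywhere, X and Y spare all further recourse to partial
charts. *)
Lemma global_chart (M : manifold R) n (c : @chart R M n) (x : M) :
  admissible c -> cdom c x ->
  exists (X : smap M (rn n)) (Y : smap (rn n) M),
    (\forall z \near x, X z = c z) /\ (\forall u \near c x, Y u = cinv c u).
Proof.
move=> ca cx.
have /choice[X XP] : forall i : 'I_n, exists k : M -> R, smooth_fun k /\
    \forall z \near x, k z = c z 0 i.
  move=> i; have si := smooth_fun_at_coord i ca cx.
  by have [k [sk kc _]] := smooth_fun_extend si filterT; exists k.
have sX : smooth_map ((fun z => \row_i X i z) : M -> rn n).
  apply: smooth_map_rn => i; under eq_fun do rewrite mxE.
  by case: (XP i).
have [k [ks kU kc]] := smooth_shrink (chart_img_nbhs cx (filterT : nbhs x setT)).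
have sY : smooth_map ((fun u => cinv c (k u)) : rn n -> M).
  apply: smooth_map_rn_l => h u sh.
  apply: (@smooth_at_comp _ _ _ k (h \o cinv c)) => //.
  have [dk E _] := kU u; rewrite -E; apply/smooth_fun_adm => //.
  by move/smooth_funE: sh; exact.
exists (SMap sX), (SMap sY); split => /=.
  have : \forall z \near x, forall i, X i z = c z 0 i.
    apply: (@filter_forall _ _ (fun i => [set z | X i z = c z 0 i]) (nbhs x)).
    by move=> i; case: (XP i).
  by apply: filterS => z h; apply/rowP => i; rewrite mxE.
by apply: filterS kc => u ->.
Qed.

Lemma global_coords (M : manifold R) (x : M) :
  exists (X : smap M (rn (mdim M))) (Y : smap (rn (mdim M)) M),
    (\forall z \near x, Y (X z) = z) /\ (\forall u \near X x, X (Y u) = u).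
Proof.
have [c cA cx] := atlas_cover x.
have [X [Y [Xc Yc]]] := global_chart (adm_chart cA) cx; exists X, Y.
have cX : {for x, continuous X} by exact: smap_cont.
have Xx : X x = c x by exact: nbhs_singleton Xc.
split.
  have n1 : \forall z \near x, Y (X z) = cinv c (X z).
    by apply: (cX [set u | Y u = cinv c u]); rewrite Xx.
  apply: filterS (filterI (filterI n1 Xc) (chart_nbhs cx)) => z [[-> ->] cz].
  exact: cmapK.
rewrite Xx; have := chart_img_nbhs cx Xc.
by move=> h; apply: filterS (filterI h Yc) => u [[cu E XE] ->]; rewrite XE E.
Qed.

End EuclideanManifold.

(** * Linear maps *)

Section HomTheory.
Context {R : realType}.
Implicit Types U V W : lmodType R.

Lemma homD U V (f : hom U V) u v : f (u + v) = f u + f v.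
Proof. by have := homP f 1 u v; rewrite !scale1r. Qed.

Lemma hom0 U V (f : hom U V) : f 0 = 0.
Proof. exact: ker0. Qed.

Lemma homZ U V (f : hom U V) a u : f (a *: u) = a *: f u.
Proof. by have := homP f a u 0; rewrite hom0 !addr0. Qed.

Lemma homN U V (f : hom U V) u : f (- u) = - f u.
Proof. by rewrite -scaleN1r homZ scaleN1r. Qed.

Lemma homB U V (f : hom U V) u v : f (u - v) = f u - f v.
Proof. by rewrite homD homN. Qed.

Lemma hom_sum U V (f : hom U V) n (u : 'I_n -> U) :
  f (\sum_i u i) = \sum_i f (u i).
Proof. by elim/big_rec2: _ => [|i y z _ <-]; rewrite ?hom0 ?homD. Qed.

Lemma hom_ext U V (f g : hom U V) : (forall u, f u = g u) -> f = g.
Proof. by move=> fg; apply: val_inj; apply/funext. Qed.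

Lemma hinvP U V (f : hom U V) : bijective f -> cancel f (hinv f) /\ cancel (hinv f) f.
Proof.
move=> [g fg gf].
have lg : linear g by move=> a u v; rewrite -{1}(gf u) -{1}(gf v) -(homP f) fg.
rewrite /hinv; case: xgetP => [h _ []//|/(_ (mkhom lg))[]].
by split.
Qed.

End HomTheory.

(** * Tangent vectors and vector fields *)

Section Tangents.
Context {R : realType}.
Implicit Types M N : manifold R.

Lemma tan_ext M (x : M) (v w : tangent x) :
  (forall h, smooth_fun h -> v h = w h) -> v = w.
Proof.
move=> vw; apply: val_inj; apply/funext => h /=.
have [sh|sh] := pselect (smooth_fun h); first exact: vw.
have [v0 _ _] := tangentP v; have [w0 _ _] := tangentP w.
by rewrite -[LHS]/(tangent_fun v h) [LHS]v0// [RHS]w0.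
Qed.

Lemma tdiffE M N (f : smap M N) (x : M) (y : N) (fxy : f x = y) (v : tangent x) h :
  smooth_fun h -> (tdiff_at f fxy v : tangent y) h = v (h \o f).
Proof. by move=> sh; exact: push_smooth. Qed.

Lemma tanD M (x : M) (v : tangent x) h k : smooth_fun h -> smooth_fun k ->
  v (fun z => h z + k z) = v h + v k.
Proof.
move=> sh sk; have [_ vl _] := tangentP v; have := vl 1 h k sh sk.
by rewrite mul1r => <-; congr (v _); apply/funext => z; rewrite mul1r.
Qed.

Lemma tan0 M (x : M) (v : tangent x) : v (fun _ => 0) = 0.
Proof.
have c0 : smooth_fun (fun _ : M => 0 : R) by exact: smooth_fun_cst.
have := tanD v c0 c0; under eq_fun do rewrite addr0.
by move/eqP; rewrite -subr_eq0 opprD addNKr oppr_eq0 => /eqP.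
Qed.

Lemma tanZ M (x : M) (v : tangent x) a h : smooth_fun h ->
  v (fun z => a * h z) = a * v h.
Proof.
move=> sh; have [_ vl _] := tangentP v.
have s0 : smooth_fun (fun _ : M => 0 : R) by exact: smooth_fun_cst.
have := vl a h (fun=> 0) sh s0.
by rewrite tan0 addr0 => <-; congr (v _); apply/funext => z; rewrite addr0.
Qed.

Lemma tanM M (x : M) (v : tangent x) h k : smooth_fun h -> smooth_fun k ->
  v (fun z => h z * k z) = v h * k x + h x * v k.
Proof. by have [_ _ vm] := tangentP v; exact: vm. Qed.

Lemma tan_cst M (x : M) (v : tangent x) a : v (fun _ => a) = 0.
Proof.
have c1 : smooth_fun (fun _ : M => 1 : R) by exact: smooth_fun_cst.
have := tanM v c1 c1; under eq_fun do rewrite mul1r.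
rewrite mulr1 mul1r => /eqP; rewrite -subr_eq0 opprD addNKr oppr_eq0 => /eqP v1.
have := tanZ v a c1; rewrite v1 mulr0 => <-.
by congr (v _); apply/funext => z; rewrite mulr1.
Qed.

Lemma tan_sum M (x : M) (v : tangent x) n (h : 'I_n -> M -> R) :
  (forall i, smooth_fun (h i)) -> v (fun z => \sum_i h i z) = \sum_i v (h i).
Proof.
elim: n h => [|n IH] h sh.
  by rewrite big_ord0; under eq_fun do rewrite big_ord0; exact: tan0.
rewrite big_ord_recl -IH// -tanD//; last exact: smooth_fun_sum.
by congr (v _); apply/funext => z; rewrite big_ord_recl.
Qed.

(** Functions that agree near x become equal after multiplication by a bump
function. *)
Lemma tan_local M (x : M) (v : tangent x) h k : smooth_fun h -> smooth_fun k ->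
  (\forall z \near x, h z = k z) -> v h = v k.
Proof.
move=> sh sk hk; have [b [sb b1 b0]] := bump_fun hk.
have E : (fun z => b z * h z) = (fun z => b z * k z).
  apply/funext => z; have [->//|hkz] := pselect (h z = k z).
  by rewrite (nbhs_singleton (b0 z hkz)) !mul0r.
have := tanM v sb sh; rewrite E tanM// (nbhs_singleton b1) (nbhs_singleton hk).
by rewrite !mul1r => /addrI.
Qed.

(** Hadamard's lemma writes h as a constant plus a sum of products, whose first
factors vanish at a; the Leibniz rule does the rest. *)
Lemma tan_rn n (a : rn n) (v : tangent a) h : smooth_fun h ->
  v h = \sum_i v (fun u : 'rV[R]_n => u 0 i) *
          'D_(delta_mx 0 i) (h : 'rV[R]_n -> R^o) (a : 'rV[R]_n).
Proof.
move=> /smooth_fun_rn sh; have [g [gs ga E]] := hadamard (a : 'rV[R]_n) sh.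
have sg i : @smooth_fun R (rn n) (g i) by exact/smooth_fun_rn.
have sx i : @smooth_fun R (rn n) (fun u : 'rV[R]_n => u 0 i).
  by apply/smooth_fun_rn => x; exact/smooth_at_coord/smooth_at_id.
have sc (c : R) : @smooth_fun R (rn n) (fun _ => c) by exact: smooth_fun_cst.
pose d i (u : rn n) : R := (u : 'rV[R]_n) 0 i + - (a : 'rV[R]_n) 0 i.
have sd i : smooth_fun (d i) by exact: smooth_funD.
transitivity (v (fun u => h a + \sum_i d i u * g i u)).
  congr (v _); apply/funext => u; rewrite [LHS]E; congr (_ + _).
  by apply: eq_bigr => i _; rewrite !mxE.
rewrite (tanD v) ?tan_cst ?add0r//; last first.
  by apply: smooth_fun_sum => i; exact: smooth_funM.
rewrite (tan_sum v); last by move=> i; exact: smooth_funM.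
apply: eq_bigr => i _; rewrite tanM// {2}/d subrr mul0r addr0.
by rewrite (tanD v)// tan_cst addr0 ga.
Qed.

(** The image of v under P in coordinates, the tangent space of the Euclidean
space at P x being identified with that space. *)
Definition tvec M p (P : M -> rn p) (x : M) (v : tangent x) : 'rV[R]_p :=
  \row_i v (fun z => P z 0 i).

(** The chain rule for derivations; with it, tangent vectors are handled as
directional derivatives. *)
Lemma tan_chain M p (P : M -> rn p) (x : M) (v : tangent x) g :
  smooth_map P -> smooth_fun g ->
  v (g \o P) = 'D_(tvec P v) (g : 'rV[R]_p -> R^o) (P x : 'rV[R]_p).
Proof.
move=> sP sg.
have := tan_rn (tdiff (SMap sP) x v) sg; rewrite tdiffE//= => ->.
rewrite derive_row; last by apply/smooth_at_diff; move/smooth_fun_rn: sg; exact.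
apply: eq_bigr => i _; rewrite mxE; congr (_ * _).
have sx : @smooth_fun R (rn p) (fun u : 'rV[R]_p => u 0 i).
  by apply/smooth_fun_rn => u; exact/smooth_at_coord/smooth_at_id.
exact: (tdiffE _ v sx).
Qed.

Lemma tvec_lin M p (P : M -> rn p) (x : M) a (v w : tangent x) :
  tvec P (a *: v + w) = a *: tvec P v + tvec P w.
Proof. by apply/rowP => i; rewrite !mxE. Qed.

Lemma tan_comb M n (x : M) (c : 'I_n -> R) (V : 'I_n -> tangent x) h :
  (\sum_i c i *: V i : tangent x) h = \sum_i c i * V i h.
Proof.
by apply: (big_rec2 (fun (v : tangent x) (r : R) => v h = r)) => // i y z _ <-.
Qed.

Lemma vector_field_comb M n (c : 'I_n -> R) (V : 'I_n -> forall x : M, tangent x) :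
  (forall i, vector_field (V i)) -> vector_field (fun x => \sum_i c i *: V i x).
Proof.
move=> fV h sh.
under eq_fun do rewrite tan_comb; apply: smooth_fun_sum => i.
by apply: smooth_funM; [exact: smooth_fun_cst|exact: fV].
Qed.

Lemma smooth_fun_derive n (h : rn n -> R) k : smooth_fun h ->
  smooth_fun (('D_k (h : 'rV[R]_n -> R^o)) : rn n -> R).
Proof.
by move=> /smooth_fun_rn sh; apply/smooth_fun_rn => x; exact: smooth_at_derive.
Qed.

(** A partial derivative of a coordinate system, cut off by a bump function to
be defined everywhere. The bump function vanishes where Y is not inverse to X,
so that the Leibniz rule holds there too. *)
Lemma coord_field M (x0 : M) (X : smap M (rn (mdim M))) (Y : smap (rn (mdim M)) M) k :
  (\forall z \near x0, Y (X z) = z) ->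
  exists V : forall x : M, tangent x, vector_field V /\
    \forall z \near x0, forall h, smooth_fun h ->
      V z h = 'D_k ((h \o Y) : 'rV[R]_(mdim M) -> R^o) (X z : 'rV[R]_(mdim M)).
Proof.
move=> XY; have [b [sb b1 b0]] := bump_fun XY.
pose V (z : M) (h : M -> R) : R^o := if `[< smooth_fun h >] then
  b z * 'D_k ((h \o Y) : 'rV[R]_(mdim M) -> R^o) (X z : 'rV[R]_(mdim M)) else 0.
have VE z h : smooth_fun h -> V z h =
    b z * 'D_k ((h \o Y) : 'rV[R]_(mdim M) -> R^o) (X z : 'rV[R]_(mdim M)).
  by move=> sh; rewrite /V asboolT.
have df (h : M -> R) u : smooth_fun h ->
    derivable ((h \o Y) : 'rV[R]_(mdim M) -> R^o) u k.
  move=> sh; apply/diff_derivable/smooth_at_diff.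
  by have /smooth_fun_rn := smooth_map_fun (smapP Y) sh.
have dV z : derivation z (V z).
  split=> [h nh|a h1 h2 s1 s2|h1 h2 s1 s2]; first by rewrite /V asboolF.
    rewrite !VE//; last first.
      by apply: smooth_funD => //; apply: smooth_funM => //; exact: smooth_fun_cst.
    have -> : ((fun z => a * h1 z + h2 z) \o Y : 'rV[R]_(mdim M) -> R^o)
       = (a \*: (h1 \o Y : _ -> R^o)) + (h2 \o Y) by [].
    rewrite deriveD; [|exact/derivableZ/df|exact: df].
    by rewrite deriveZ ?mulrDr; [congr (_ + _); rewrite mulrCA|exact: df].
  rewrite !VE//; last exact: smooth_funM.
  have -> : ((fun z => h1 z * h2 z) \o Y : 'rV[R]_(mdim M) -> R^o)
     = ((h1 \o Y : _ -> R^o) * (h2 \o Y : _ -> R^o)) by [].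
  rewrite deriveM; [|exact: df|exact: df].
  have [E|nE] := pselect (Y (X z) = z); last first.
    by rewrite (nbhs_singleton (b0 z nE)) !mul0r mulr0 addr0.
  rewrite /= E -![_ *: _]/(_ * _); ring.
pose W z : tangent z := mksub (S := tangent_space z) (dV z).
exists W; split.
  move=> h sh; have -> : (fun x => W x h) = (fun z => b z *
      ('D_k ((h \o Y) : 'rV[R]_(mdim M) -> R^o) \o X) z).
    by apply/funext => z; rewrite -VE.
  apply: smooth_funM => //; apply: (smooth_map_fun (smapP X)).
  exact/smooth_fun_derive/(smooth_map_fun (smapP Y)).
by apply: filterS b1 => z bz h sh; rewrite -[LHS]/(V z h) VE// bz mul1r.
Qed.

Lemma tan_coord M (z : M) (X : smap M (rn (mdim M))) (Y : smap (rn (mdim M)) M)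
    (v : tangent z) h :
  (\forall z' \near z, Y (X z') = z') -> smooth_fun h ->
  v h = 'D_(tvec X v) ((h \o Y) : 'rV[R]_(mdim M) -> R^o) (X z : 'rV[R]_(mdim M)).
Proof.
move=> XY sh; have sY := smooth_map_fun (smapP Y) sh.
rewrite -tan_chain//; last exact: smapP.
apply: tan_local => //; first exact: smooth_map_fun (smapP X) sY.
by apply: filterS XY => z' /= ->.
Qed.

Lemma near_near (T : topologicalType) (x : T) (P : T -> Prop) :
  (\forall z \near x, P z) -> \forall z \near x, \forall z' \near z, P z'.
Proof. by move/nbhs_interior. Qed.

(** Global functions and fields in place of coordinates and their partial
derivatives: connections, and the smoothness of forms, are only tested on
global objects. *)
Lemma coord_frame M (x : M) : exists (f : 'I_(mdim M) -> M -> R)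
    (V : 'I_(mdim M) -> forall z : M, tangent z),
  [/\ forall i, smooth_fun (f i), forall i, vector_field (V i) &
    \forall z \near x, forall w : tangent z, w = \sum_i w (f i) *: V i z].
Proof.
have [X [Y [YX XY]]] := global_coords x.
have /choice[V VP] : forall i : 'I_(mdim M), exists V : forall x : M, tangent x,
    vector_field V /\ \forall z \near x, forall h, smooth_fun h -> V z h =
   'D_(delta_mx 0 i) ((h \o Y) : 'rV[R]_(mdim M) -> R^o) (X z : 'rV[R]_(mdim M)).
  by move=> i; exact: coord_field.
exists (fun i z => X z 0 i), V; split=> [i|i|].
- exact: smooth_map_coord (smapP X).
- by case: (VP i).
have nV : \forall z \near x, forall i h, smooth_fun h -> V i z h =
   'D_(delta_mx 0 i) ((h \o Y) : 'rV[R]_(mdim M) -> R^o) (X z : 'rV[R]_(mdim M)).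
  apply: (@filter_forall _ _ (fun i => [set z | forall h, smooth_fun h ->
    V i z h = 'D_(delta_mx 0 i) ((h \o Y) : 'rV[R]_(mdim M) -> R^o)
     (X z : 'rV[R]_(mdim M))]) (nbhs x)).
  by move=> i; case: (VP i).
apply: filterS (filterI nV (near_near YX)) => z [Vz YXz] w.
apply: tan_ext => h sh.
rewrite tan_comb (tan_coord _ YXz sh) derive_row.
  by apply: eq_bigr => i _; rewrite mxE Vz.
apply/smooth_at_diff; move: (X z).
exact/smooth_fun_rn/(smooth_map_fun (smapP Y)).
Qed.

Lemma vector_field_extend M (x : M) (v : tangent x) :
  exists2 V : forall z : M, tangent z, vector_field V & V x = v.
Proof.
have [f [V [sf fV E]]] := coord_frame x.
exists (fun z => \sum_i v (f i) *: V i z); first exact: vector_field_comb.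
by rewrite -(nbhs_singleton E).
Qed.

Lemma tan_of_tvec M (x : M) (X : smap M (rn (mdim M))) (Y : smap (rn (mdim M)) M) k :
  (\forall z \near x, Y (X z) = z) -> (\forall u \near X x, X (Y u) = u) ->
  exists v : tangent x, tvec X v = k.
Proof.
move=> YX XY; have [V [_ VE]] := coord_field k YX.
exists (V x); apply/rowP => i; rewrite mxE (nbhs_singleton VE); last first.
  exact: smooth_map_coord (smapP X).
rewrite (@near_eq_derive _ _ _ _ (fun u : 'rV[R]_(mdim M) => u 0 i : R^o)).
  by rewrite (@derive_coord _ _ _ id) ?derive_id.
by apply: filterS XY => u /= ->.
Qed.

(** The mixed terms of the Leibniz rule cancel in the commutator. *)
Lemma bracket_exists M (X Y : forall x : M, tangent x) :
  vector_field X -> vector_field Y ->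
  exists2 Z : forall x : M, tangent x, vector_field Z & is_bracket X Y Z.
Proof.
move=> fX fY.
pose V (x : M) (h : M -> R) : R^o := if `[< smooth_fun h >] then
  X x (fun z => Y z h) - Y x (fun z => X z h) else 0.
have VE z h : smooth_fun h ->
    V z h = X z (fun x => Y x h) - Y z (fun x => X x h).
  by move=> sh; rewrite /V asboolT.
have comb (W : forall x : M, tangent x) a h1 h2 : smooth_fun h1 -> smooth_fun h2 ->
    (fun z => W z (fun z => a * h1 z + h2 z)) = (fun z => a * W z h1 + W z h2).
  by move=> s1 s2; apply/funext => z; have [_ l _] := tangentP (W z); exact: l.
have prod (W : forall x : M, tangent x) h1 h2 : smooth_fun h1 -> smooth_fun h2 ->
    (fun z => W z (fun z => h1 z * h2 z)) = (fun z => W z h1 * h2 z + h1 z * W z h2).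
  by move=> s1 s2; apply/funext => z; exact: tanM.
have sc (c : R) : smooth_fun (fun _ : M => c) by exact: smooth_fun_cst.
have dV z : derivation z (V z).
  split=> [h nh|a h1 h2 s1 s2|h1 h2 s1 s2]; first by rewrite /V asboolF.
    rewrite !VE//; last by apply: smooth_funD => //; exact: smooth_funM.
    rewrite !comb//.
    have [_ lX _] := tangentP (X z); have [_ lY _] := tangentP (Y z).
    rewrite -!/(tangent_fun _ _) in lX lY *.
    have -> := lX a _ _ (fY _ s1) (fY _ s2).
    have -> := lY a _ _ (fX _ s1) (fX _ s2).
    rewrite -!/(tangent_fun _ _); ring.
  rewrite !VE//; last exact: smooth_funM.
  have [a1 a2 b1 b2] := And4 (fY _ s1) (fY _ s2) (fX _ s1) (fX _ s2).
  rewrite !prod// (tanD (X z) (smooth_funM a1 s2) (smooth_funM s1 a2)).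
  rewrite (tanD (Y z) (smooth_funM b1 s2) (smooth_funM s1 b2)).
  rewrite (tanM (X z) a1 s2) (tanM (X z) s1 a2).
  rewrite (tanM (Y z) b1 s2) (tanM (Y z) s1 b2); ring.
pose Z x : tangent x := mksub (S := tangent_space x) (dV x).
have ZE x h : smooth_fun h -> Z x h = X x (fun z => Y z h) - Y x (fun z => X z h).
  exact: VE.
exists Z; last by move=> h sh x; exact: ZE.
move=> h sh; have -> : (fun x => Z x h) =
   (fun x => X x (fun z => Y z h) + (-1) * Y x (fun z => X z h)).
  by apply/funext => x; rewrite ZE// mulN1r.
apply: smooth_funD; first exact: fX (fY _ sh).
by apply: smooth_funM => //; exact: fY (fX _ sh).
Qed.

End Tangents.

Section LocalSmoothness.
Context {R : realType}.
Implicit Types M N : manifold R.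

Lemma smooth_fun_at_of M (h : M -> R) (x : M) : smooth_fun h -> smooth_fun_at h x.
Proof. by move/smooth_funE; exact. Qed.

Lemma smooth_fun_atM M (h k : M -> R) (x : M) :
  smooth_fun_at h x -> smooth_fun_at k x -> smooth_fun_at (fun z => h z * k z) x.
Proof.
have [c cA cx] := atlas_cover x; have ca := adm_chart cA.
move=> /(smooth_fun_at_adm _ ca cx) sh /(smooth_fun_at_adm _ ca cx) sk.
by apply/(smooth_fun_at_adm _ ca cx); exact: smooth_atM sh sk.
Qed.

Lemma smooth_fun_atD M (h k : M -> R) (x : M) :
  smooth_fun_at h x -> smooth_fun_at k x -> smooth_fun_at (fun z => h z + k z) x.
Proof.
have [c cA cx] := atlas_cover x; have ca := adm_chart cA.
move=> /(smooth_fun_at_adm _ ca cx) sh /(smooth_fun_at_adm _ ca cx) sk.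
by apply/(smooth_fun_at_adm _ ca cx); exact: smooth_atD sh sk.
Qed.

Lemma smooth_fun_atV M (h : M -> R) (x : M) : h x != 0 ->
  smooth_fun_at h x -> smooth_fun_at (fun z => (h z)^-1) x.
Proof.
have [c cA cx] := atlas_cover x; have ca := adm_chart cA.
move=> h0 /(smooth_fun_at_adm _ ca cx) sh.
apply/(smooth_fun_at_adm _ ca cx); apply: (@smooth_atV _ _ (h \o cinv c)) => //.
by rewrite /= cmapK.
Qed.

Lemma smooth_fun_at_germ M (h : M -> R) (x : M) : smooth_fun_at h x ->
  exists2 k, smooth_fun k & \forall z \near x, k z = h z.
Proof. by move=> sh; have [k [sk kh _]] := smooth_fun_extend sh filterT; exists k. Qed.

Lemma smooth_map_at_near M N (f g : M -> N) (x : M) :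
  (\forall z \near x, f z = g z) -> smooth_map_at f x -> smooth_map_at g x.
Proof.
move=> fg sf h sh; apply: smooth_fun_at_near (sf h sh).
by apply: filterS fg => z /= ->.
Qed.

End LocalSmoothness.

(** * Smooth families of vectors of a bundle *)

Section BundleCharts.
Context {R : realType}.
Implicit Types M N : manifold R.

(** Bundle charts reduce smoothness to that of components. Families of vectors
over a map f cover at once the sections, the zero section and the pullbacks of
sections. *)
Lemma bundle_triv k M (E : vbundle k M) (x0 : M) :
  exists (U : set M) (tau : forall x, hom (fib E x) 'rV[R]_k),
  [/\ open U, U x0, forall x, U x -> bijective (tau x) &
   forall N (f : N -> M) (v : forall z, fib E (f z)) (z : N),
     smooth_map_at f z -> U (f z) ->
     smooth_map_at (fun z => vin E (v z)) z <->
     forall i, smooth_fun_at (fun z => tau (f z) (v z) 0 i) z].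
Proof.
have [c [C [tau [ca Ca cx0 CU tauP]]]] := vb_trivial E x0.
exists (cdom c), tau; split => //; first exact: cdom_open.
  by move=> x /tauP[].
move=> N f v z sf cz.
have nf : \forall z' \near z, cdom c (f z').
  by have /(_ _ (chart_nbhs cz)) := smooth_map_at_cont sf.
have CE z' : cdom c (f z') ->
    C (vin E (v z')) = row_mx (c (f z')) (tau (f z') (v z')).
  by move=> cz'; have [_] := tauP _ cz'; exact.
have Cd z' : cdom c (f z') -> cdom C (vin E (v z')).
  by move=> cz'; apply/CU; rewrite projE.
split=> [sv i|sv h sh].
  have := smooth_fun_at_comp sv (smooth_fun_at_coord (rshift (mdim M) i) Ca (Cd z cz)).
  apply: smooth_fun_at_near; apply: filterS nf => z' cz' /=.
  by rewrite CE// row_mxEr.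
have [d dA dz] := atlas_cover z.
apply/(smooth_fun_at_adm _ (adm_chart dA) dz).
pose P z' : 'rV[R]_(mdim M + k) := row_mx (c (f z')) (tau (f z') (v z')).
apply: (@smooth_at_near _ _ _ ((h \o cinv C) \o (P \o cinv d))).
  apply: filterS (chart_img_nbhs dz nf) => u [_ _ cu] /=.
  by rewrite /P -CE// cmapK//; exact: Cd.
apply: smooth_at_comp; last first.
  rewrite /= cmapK// /P -CE//; apply/(smooth_fun_at_adm _ Ca) => //.
    exact: Cd.
  exact: smooth_fun_at_of.
apply: smooth_at_row => i.
suff : smooth_fun_at (fun z' => P z' 0 i) z.
  by move/(smooth_fun_at_adm _ (adm_chart dA) dz).
rewrite /P; case: (split_ordP i) => j ->.
  apply: (@smooth_fun_at_near _ _ (fun z' => c (f z') 0 j)).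
    by apply: nearW => z'; rewrite row_mxEl.
  exact: (smooth_fun_at_comp sf (smooth_fun_at_coord j ca cz)).
apply: (@smooth_fun_at_near _ _ (fun z' => tau (f z') (v z') 0 j)).
  by apply: nearW => z'; rewrite row_mxEr.
exact: sv.
Qed.

Lemma smooth_map_at_id M (x : M) : smooth_map_at id x.
Proof. by move=> h sh; exact: smooth_fun_at_of. Qed.

Section OverMap.
Variables (k : nat) (M : manifold R) (E : vbundle k M) (N : manifold R).
Variables (f : N -> M).
Implicit Types v w : forall z, fib E (f z).

Lemma smooth_over_comb (a : N -> R) v w (z : N) :
  smooth_map_at f z -> smooth_fun_at a z ->
  smooth_map_at (fun z => vin E (v z)) z ->
  smooth_map_at (fun z => vin E (w z)) z ->
  smooth_map_at (fun z => vin E (a z *: v z + w z)) z.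
Proof.
move=> sf sa; have [U [tau [_ Ufz tb tP]]] := bundle_triv E (f z).
move=> /(tP _ _ _ _ sf Ufz) sv /(tP _ _ _ _ sf Ufz) sw.
apply/(tP _ _ _ _ sf Ufz) => i.
apply: (@smooth_fun_at_near _ _
  (fun z => a z * tau (f z) (v z) 0 i + tau (f z) (w z) 0 i)).
  by apply: nearW => z'; rewrite homP !mxE.
by apply: smooth_fun_atD => //; exact: smooth_fun_atM.
Qed.

Lemma smooth_over_zero (z : N) : smooth_map_at f z ->
  smooth_map_at (fun z => vin E (0 : fib E (f z))) z.
Proof.
move=> sf; have [U [tau [_ Ufz tb tP]]] := bundle_triv E (f z).
apply/(tP _ _ _ _ sf Ufz) => i.
apply: (@smooth_fun_at_near _ _ (fun=> 0)).
  by apply: nearW => z'; rewrite hom0 mxE.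
by apply: smooth_fun_at_of; exact: smooth_fun_cst.
Qed.

End OverMap.

Lemma smooth_zero k M (E : vbundle k M) :
  smooth_map (fun z => vin E (0 : fib E z)).
Proof.
apply/smooth_mapE => z.
exact: (@smooth_over_zero k M E M id z (@smooth_map_at_id M z)).
Qed.

Section Sections.
Variables (k : nat) (M : manifold R) (E : vbundle k M).
Implicit Types l : section E.

Definition section_at l (x : M) := smooth_map_at (fun z => vin E (l z)) x.

Lemma smooth_sectionE l : smooth_section l <-> forall x, section_at l x.
Proof. exact: smooth_mapE. Qed.

Lemma smooth_sectionD l1 l2 : smooth_section l1 -> smooth_section l2 ->
  smooth_section (fun z => l1 z + l2 z).
Proof.
move=> /smooth_sectionE s1 /smooth_sectionE s2; apply/smooth_sectionE => x.
apply: (@smooth_map_at_near _ _ _ (fun z => vin E ((1 : R) *: l1 z + l2 z))).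
  by apply: nearW => z; rewrite scale1r.
apply: (@smooth_over_comb _ _ _ _ id (fun=> 1)) => //.
- exact: smooth_map_at_id.
- by apply: smooth_fun_at_of; exact: smooth_fun_cst.
- exact: s1.
- exact: s2.
Qed.

Lemma section_atZ (a : M -> R) l x : smooth_fun_at a x -> section_at l x ->
  section_at (fun z => a z *: l z) x.
Proof.
move=> sa sl; apply: (@smooth_map_at_near _ _ _ (fun z => vin E (a z *: l z + 0))).
  by apply: nearW => z; rewrite addr0.
apply: (@smooth_over_comb _ _ _ _ id) => //; first exact: smooth_map_at_id.
exact: (@smooth_over_zero k M E M id x (@smooth_map_at_id M x)).
Qed.

Lemma smooth_sectionZ (a : M -> R) l : smooth_fun a -> smooth_section l ->
  smooth_section (fun z => a z *: l z).
Proof.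
move=> sa /smooth_sectionE sl; apply/smooth_sectionE => x.
by apply: section_atZ => //; exact: smooth_fun_at_of.
Qed.

Lemma smooth_section_sum n (l : 'I_n -> section E) :
  (forall i, smooth_section (l i)) -> smooth_section (fun z => \sum_i l i z).
Proof.
elim: n l => [|n IH] l sl.
  rewrite (_ : (fun _ => _) = (fun z => 0 : fib E z)); first exact: smooth_zero.
  by apply/functional_extensionality_dep => z; rewrite big_ord0.
rewrite (_ : (fun _ => _) = (fun z => l ord0 z + \sum_i l (lift ord0 i) z)).
  by apply: smooth_sectionD => //; exact: IH.
by apply/functional_extensionality_dep => z; rewrite big_ord_recl.
Qed.

End Sections.

End BundleCharts.

(** * Line bundles *)

Section LineBundles.
Context {R : realType}.
Implicit Types M N : manifold R.

Lemma row1_neq0 (u : 'rV[R]_1) : u != 0 -> u 0 0 != 0.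
Proof.
by apply: contra_neq => u0; apply/rowP => i; rewrite ord1 u0 mxE.
Qed.

Lemma line_scal M (E : vbundle 1 M) (x : M) (e v : fib E x) : e != 0 ->
  exists r : R, v = r *: e.
Proof.
have [U [tau [_ Ux tb _]]] := bundle_triv E x; have ti := bij_inj (tb x Ux).
move=> e0; have te0 : tau x e != 0.
  by apply: contra_neq e0 => te; apply: ti; rewrite te hom0.
exists (tau x v 0 0 / tau x e 0 0); apply: ti.
by rewrite homZ; apply/rowP => i; rewrite ord1 mxE divfK// row1_neq0.
Qed.

Lemma line_basis M (E : vbundle 1 M) (x : M) : exists e : fib E x, e != 0.
Proof.
have [U [tau [_ Ux tb _]]] := bundle_triv E x; have [g tg gt] := tb x Ux.
exists (g (const_mx 1)); apply/eqP => /(congr1 (tau x)).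
by rewrite gt hom0 => /rowP/(_ 0); rewrite !mxE => /eqP; rewrite oner_eq0.
Qed.

Lemma line_inj_bij M N (E : vbundle 1 M) (E' : vbundle 1 N) (x : M) (y : N)
    (f : hom (fib E x) (fib E' y)) : (forall v, f v = 0 -> v = 0) -> bijective f.
Proof.
move=> fi; have [e e0] := line_basis E x.
have fe0 : f e != 0 by apply: contra_neq e0 => /fi.
have /choice[g gP] : forall w, exists v, f v = w.
  by move=> w; have [r ->] := line_scal w fe0; exists (r *: e); rewrite homZ.
exists g => // v; apply/eqP; rewrite -subr_eq0; apply/eqP/fi.
by rewrite homB gP subrr.
Qed.

(** A quotient of components in a bundle chart. This is how sections of line
bundles are compared below. *)
Lemma line_ratio M (E : vbundle 1 M) N (f : N -> M) (v w : forall z, fib E (f z))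
    (z0 : N) : smooth_map_at f z0 ->
  smooth_map_at (fun z => vin E (v z)) z0 ->
  smooth_map_at (fun z => vin E (w z)) z0 -> w z0 != 0 ->
  exists2 r : N -> R, smooth_fun r & \forall z \near z0, v z = r z *: w z.
Proof.
move=> sf; have [U [tau [oU Uz tb tP]]] := bundle_triv E (f z0).
move=> /(tP _ _ _ _ sf Uz)/(_ 0) sv /(tP _ _ _ _ sf Uz)/(_ 0) sw w0.
have tw0 : tau _ (w z0) 0 0 != 0.
  apply/row1_neq0; apply: contra_neq w0 => te.
  by apply: (bij_inj (tb _ Uz)); rewrite te hom0.
have [r sr rE] := smooth_fun_at_germ (smooth_fun_atM sv (smooth_fun_atV tw0 sw)).
exists r => //.
have nU : \forall z \near z0, U (f z).
  by have /(_ U) := smooth_map_at_cont sf; apply; exact: open_nbhs_nbhs.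
have nw : \forall z \near z0, tau _ (w z) 0 0 != 0.
  by have /cvgr_neq0 := smooth_fun_at_cont sw; exact.
apply: filterS (filterI (filterI nU nw) rE) => z [[Ufz wz] ->].
apply: (bij_inj (tb _ Ufz)); rewrite homZ; apply/rowP => i.
by rewrite ord1 [RHS]mxE divfK.
Qed.

(** The constant section of a bundle chart, cut off by a bump function. *)
Lemma line_frame M (E : vbundle 1 M) (x : M) :
  exists2 e : section E, smooth_section e & e x != 0.
Proof.
have [U [tau [oU Ux tb tP]]] := bundle_triv E x.
have ex z : exists e : fib E z, U z -> tau z e = const_mx 1.
  have [Uz|nU] := pselect (U z); last by exists 0.
  by have [h _ ht] := tb z Uz; exists (h (const_mx 1)).
pose g z := projT1 (cid (ex z)).
have gP z : U z -> tau z (g z) = const_mx 1 by rewrite /g; case: cid.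
have [b [sb b1 b0]] := bump_fun (open_nbhs_nbhs (conj oU Ux)).
exists (fun z => b z *: g z); last first.
  rewrite (nbhs_singleton b1) scale1r; apply/eqP => /(congr1 (tau x)).
  by rewrite gP// hom0 => /rowP/(_ 0); rewrite !mxE => /eqP; rewrite oner_eq0.
apply/smooth_sectionE => z; have [Uz|nUz] := pselect (U z).
  apply/(tP _ id _ _ (@smooth_map_at_id _ M z) Uz) => i.
  apply: (@smooth_fun_at_near _ _ b); last exact: smooth_fun_at_of.
  apply: filterS (open_nbhs_nbhs (conj oU Uz)) => z' Uz'.
  by rewrite homZ gP// !mxE mulr1.
apply: (@smooth_map_at_near _ _ _ (fun z => vin E (0 : fib E z))).
  by apply: filterS (b0 z nUz) => z' ->; rewrite scale0r.
by move/smooth_mapE: (smooth_zero E); exact.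
Qed.

(** Near a point the pullback is r e, for a frame e and the ratio r of s to F
e. *)
Lemma pull_section_smooth M N (E : vbundle 1 N) (E' : vbundle 1 M) (f : smap N M)
    (F : vb_mor E E' f) (s : section E') :
  (forall y, bijective (vb_fib F y)) -> smooth_section s ->
  smooth_section (pull_section F s).
Proof.
move=> Fb ss; apply/smooth_sectionE => y0; have [e se e0] := line_frame E y0.
have sf : smooth_map_at f y0 by move/smooth_mapE: (smapP f); exact.
have [|||r sr rE] := @line_ratio _ E' _ f (fun z => s (f z))
    (fun z => vb_fib F z (e z)) y0 sf.
- have /smooth_mapE := smooth_map_comp (smapP f) ss; exact.
- have /smooth_mapE/(_ y0) := smooth_map_comp se (smapP (vb_tot F)).
  by apply: smooth_map_at_near; apply: nearW => z /=; rewrite vb_totE.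
- by apply: contra_neq e0 => /=; rewrite -(hom0 (vb_fib F y0)); exact: (bij_inj (Fb y0)).
apply: (@smooth_map_at_near _ _ _ (fun z => vin E (r z *: e z))).
  apply: filterS rE => z E1; rewrite /pull_section E1.
  by have [Fh _] := hinvP (Fb z); rewrite homZ Fh.
apply: section_atZ; first exact: smooth_fun_at_of.
by move/smooth_sectionE: se; exact.
Qed.

Lemma line_functional M (E : vbundle 1 M) (x : M) :
  exists phi : hom (fib E x) R^o, forall v, phi v = 0 -> v = 0.
Proof.
have [U [tau [_ Ux tb _]]] := bundle_triv E x; have ti := bij_inj (tb x Ux).
have l : linear (fun v => tau x v 0 0 : R^o) by move=> a u v; rewrite homP !mxE.
exists (mkhom l) => v /= v0; apply: ti; rewrite hom0; apply/rowP => i.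
by rewrite ord1 mxE.
Qed.

End LineBundles.

(** * The covariant differential of a one-form *)

Section CovariantDifferential.
Context {R : realType}.
Implicit Types M N : manifold R.

Section OneBundle.
Variables (k : nat) (M : manifold R) (E : vbundle k M) (nabla : connection E).

(** As for derivations, by a bump function and the Leibniz rule. *)
Lemma conn_local (x : M) (v : tangent x) (l1 l2 : section E) :
  smooth_section l1 -> smooth_section l2 -> (\forall z \near x, l1 z = l2 z) ->
  nabla x l1 v = nabla x l2 v.
Proof.
move=> s1 s2 l12; have [b [sb b1 b0]] := bump_fun l12.
have E12 : (fun z => b z *: l1 z) = (fun z => b z *: l2 z).
  apply/functional_extensionality_dep => z.
  have [->//|nl] := pselect (l1 z = l2 z).
  by rewrite (nbhs_singleton (b0 z nl)) !scale0r.
have := nab_leibniz nabla sb s1 v; rewrite E12 nab_leibniz//.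
rewrite (nbhs_singleton b1) (nbhs_singleton l12) !scale1r.
by move/addrI.
Qed.

Lemma conn_comb n (h : 'I_n -> M -> R) (l : 'I_n -> section E) (x : M) (v : tangent x) :
  (forall i, smooth_fun (h i)) -> (forall i, smooth_section (l i)) ->
  nabla x (fun z => \sum_i h i z *: l i z) v
  = \sum_i (v (h i) *: l i x + h i x *: nabla x (l i) v).
Proof.
move=> sh sl; elim: n h l sh sl => [|n IH] h l sh sl.
  rewrite big_ord0; set l0 : section E := fun _ => _.
  have s0 : smooth_section l0.
    by apply: (smooth_section_sum (l := fun i z => h i z *: l i z)) => -[].
  have := nabD nabla s0 s0 v.
  rewrite (_ : (fun z => l0 z + l0 z) = l0); last first.
    by apply/functional_extensionality_dep => z; rewrite /l0 big_ord0 addr0.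
  by move/eqP; rewrite -subr_eq0 opprD addNKr oppr_eq0 => /eqP.
have shl i : smooth_section (fun z => h i z *: l i z) by exact: smooth_sectionZ.
rewrite big_ord_recl -IH// -nab_leibniz// -nabD//; last first.
  by apply: (smooth_section_sum (l := fun i z => h (lift ord0 i) z *: l (lift ord0 i) z)).
rewrite (_ : (fun _ => _) = (fun z => h ord0 z *: l ord0 z +
  \sum_i h (lift ord0 i) z *: l (lift ord0 i) z))//.
by apply/functional_extensionality_dep => z; rewrite big_ord_recl.
Qed.

(** Near x the form is a sum of products dh_i (x) e_i. With global h_i and e_i
such expressions are stable under pullback, whereas a coordinate frame is
not. *)
Definition form_repr (th : form1 E) (x : M) n (h : 'I_n -> M -> R)
    (e : 'I_n -> section E) :=
  [/\ forall i, smooth_fun (h i), forall i, smooth_section (e i) &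
   \forall z \near x, forall w : tangent z, th z w = \sum_i w (h i) *: e i z].

Lemma smooth_form_repr (th : form1 E) (x : M) : smooth_form th ->
  exists n (h : 'I_n -> M -> R) (e : 'I_n -> section E), form_repr th x h e.
Proof.
move=> sth; have [h [V [sh fV hV]]] := coord_frame x.
exists (mdim M), h, (fun i z => th z (V i z)); split=> // [i|].
  by apply: sth; exact: fV.
apply: filterS hV => z E1 w; rewrite {1}(E1 w) hom_sum.
by apply: eq_bigr => i _; rewrite homZ.
Qed.

Lemma repr_smooth_form (th : form1 E) :
  (forall x, exists n (h : 'I_n -> M -> R) (e : 'I_n -> section E),
    form_repr th x h e) -> smooth_form th.
Proof.
move=> rth X fX; apply/smooth_sectionE => x.
have [n [h [e [sh se thE]]]] := rth x.
apply: (@smooth_map_at_near _ _ _ (fun z => vin E (\sum_i X z (h i) *: e i z))).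
  by apply: filterS thE => z ->.
have := smooth_section_sum (fun i => smooth_sectionZ (fX _ (sh i)) (se i)).
by move/smooth_sectionE; exact.
Qed.

Definition cov_spec (th : form1 E) (x : M)
    (B : hom (tangent x) (hom (tangent x) (fib E x))) :=
  forall X Y Z, vector_field X -> vector_field Y ->
    vector_field Z -> is_bracket X Y Z ->
    (B (X x) : hom _ _) (Y x) = nabla x (fun z => th z (Y z)) (X x)
                    - nabla x (fun z => th z (X z)) (Y x) - th x (Z x).

(** Tangent vectors extend to vector fields, and these have a bracket. *)
Lemma cov_spec_unique (th : form1 E) (x : M) B B' :
  @cov_spec th x B -> @cov_spec th x B' -> B = B'.
Proof.
move=> hB hB'; apply: hom_ext => v; apply: hom_ext => w.
have [X fX <-] := vector_field_extend v; have [Y fY <-] := vector_field_extend w.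
have [Z fZ XYZ] := bracket_exists fX fY.
by rewrite (hB X Y Z)// (hB' X Y Z).
Qed.

Section OfRepr.
Variables (th : form1 E) (x : M) (n : nat) (h : 'I_n -> M -> R).
Variable e : 'I_n -> section E.

(** The formula d^nabla (dh (x) e) = - dh /\ nabla e, summed. *)
Definition repr_form (v w : tangent x) : fib E x :=
  \sum_i (w (h i) *: nabla x (e i) v - v (h i) *: nabla x (e i) w).

Lemma repr_form_linr v : linear (repr_form v).
Proof.
move=> a w w'; rewrite /repr_form scaler_sumr -big_split; apply: eq_bigr => i _ /=.
pose w1 : tangent x := w; pose w2 : tangent x := w'.
change ((a * w1 (h i) + w2 (h i)) *: nabla x (e i) v
    - v (h i) *: nabla x (e i) (a *: w1 + w2) =
  a *: (w1 (h i) *: nabla x (e i) v - v (h i) *: nabla x (e i) w1) +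
  (w2 (h i) *: nabla x (e i) v - v (h i) *: nabla x (e i) w2)).
rewrite homP scalerDr scalerDl.
rewrite scalerBr !scalerA opprD [a * _]mulrC [a * v _]mulrC addrACA.
by [].
Qed.

Lemma repr_form_linl : linear (fun v => mkhom (repr_form_linr v)).
Proof.
move=> a v v'; apply: hom_ext => w.
suff : repr_form (a *: v + v') w = a *: repr_form v w + repr_form v' w by [].
rewrite /repr_form scaler_sumr -big_split; apply: eq_bigr => i _ /=.
pose w1 : tangent x := v; pose w2 : tangent x := v'; pose w0 : tangent x := w.
change (w0 (h i) *: nabla x (e i) (a *: w1 + w2)
    - (a * w1 (h i) + w2 (h i)) *: nabla x (e i) w0 =
  a *: (w0 (h i) *: nabla x (e i) w1 - w1 (h i) *: nabla x (e i) w0) +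
  (w0 (h i) *: nabla x (e i) w2 - w2 (h i) *: nabla x (e i) w0)).
rewrite homP scalerDr scalerDl.
by rewrite scalerBr !scalerA opprD (mulrC a (w0 (h i))) addrACA.
Qed.

Lemma repr_form_spec : smooth_form th -> form_repr th x h e ->
  cov_spec th (mkhom repr_form_linl).
Proof.
move=> sth [sh se thE] X Y Z fX fY fZ XYZ.
have nabE (V W : forall z : M, tangent z) : vector_field V ->
    nabla x (fun z => th z (V z)) (W x) = \sum_i (W x (fun z => V z (h i)) *: e i x
       + V x (h i) *: nabla x (e i) (W x)).
  move=> fV; have sV i := fV _ (sh i).
  rewrite -(conn_comb (h := fun i z => V z (h i)))//.
  apply: conn_local.
  - exact: sth.
  - exact: (smooth_section_sum (fun i => smooth_sectionZ (sV i) (se i))).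
  - by apply: filterS thE => z ->.
rewrite !nabE// (nbhs_singleton thE) -!sumrB; apply: eq_bigr => i _.
rewrite XYZ// scalerBl; set a := _ *: e i x; set b := _ *: e i x.
by rewrite (addrC a) opprD (addrC (- b)) addrACA addrK.
Qed.

Lemma cov_diffE v w : smooth_form th -> form_repr th x h e ->
  (cov_diff nabla th x v : hom _ _) w = repr_form v w.
Proof.
move=> sth rth; have spec := repr_form_spec sth rth.
have -> : cov_diff nabla th x = mkhom repr_form_linl.
  rewrite /cov_diff; case: xgetP => [B _ hB|/(_ _ spec)//].
  exact: cov_spec_unique hB spec.
by [].
Qed.

End OfRepr.
End OneBundle.

(** Both sides are computed in a local expression of th and in its pullback,
where the connections are only applied to the sections e_i and to their
pullbacks. *)
Lemma cov_diff_pull M N (E : vbundle 1 N) (E' : vbundle 1 M) (f : smap N M)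
    (F : vb_mor E E' f) (th : form1 E') (nabla : connection E')
    (nabla' : connection E) (y : N) (v w : tangent y) :
  (forall y, bijective (vb_fib F y)) -> smooth_form th ->
  is_pull_connection F nabla nabla' ->
  (cov_diff nabla' (pull_form F th) y v : hom _ _) w =
  hinv (vb_fib F y) ((cov_diff nabla th (f y) (tdiff f y v) : hom _ _) (tdiff f y w)).
Proof.
move=> Fb sth pull.
have prepr z n (h : 'I_n -> M -> R) (e : 'I_n -> section E') :
    form_repr th (f z) h e ->
    form_repr (pull_form F th) z (fun i => h i \o f) (fun i => pull_section F (e i)).
  move=> [sh se thE]; split=> [i|i|].
  - exact: smooth_fun_comp.
  - exact: pull_section_smooth.
  have : \forall z' \near z, forall u : tangent (f z'),
      th (f z') u = \sum_i u (h i) *: e i (f z').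
    exact: ((@smap_cont _ _ _ f z) _ thE).
  apply: filterS => z' E1 u; rewrite /pull_form /= E1 hom_sum; apply: eq_bigr => i _.
  by rewrite homZ tdiffE.
have sth' : smooth_form (pull_form F th).
  apply: repr_smooth_form => z.
  have [n [h [e r]]] := smooth_form_repr (f z) sth.
  by exists n, (fun i => h i \o f), (fun i => pull_section F (e i)); exact: prepr.
have [n [h [e r]]] := smooth_form_repr (f y) sth.
have [sh se _] := r.
rewrite (cov_diffE _ _ _ sth' (prepr _ _ _ _ r)) (cov_diffE _ _ _ sth r).
rewrite /repr_form hom_sum; apply: eq_bigr => i _.
by rewrite homB !homZ !tdiffE// !pull.
Qed.

End CovariantDifferential.

(** * Line bundle-groupoids *)

Section Groupoids.
Context {R : realType}.

Section Abstract.
Variables (G M : manifold R) (GM : groupoid G M).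

Lemma gcancel g h : gsrc GM g = gtgt GM h ->
  gmul GM g h = gunit GM (gtgt GM g) -> g = ginv GM h.
Proof.
move=> gh E; have th : gtgt GM g = gtgt GM (ginv GM h).
  by rewrite gtgt_inv -(gsrc_mul gh) E gsrc_unit.
have : gmul GM (gmul GM g h) (ginv GM h) = ginv GM h.
  by rewrite E th gmul_unitl.
by rewrite -gmulA ?gtgt_inv// gmulVr -gh gmul_unitr.
Qed.

Lemma ginvK g : ginv GM (ginv GM g) = g.
Proof.
apply/esym/gcancel; first by rewrite gtgt_inv.
exact: gmulVr.
Qed.

Lemma ginv_unit x : ginv GM (gunit GM x) = gunit GM x.
Proof.
apply/esym/gcancel; first by rewrite gsrc_unit gtgt_unit.
by rewrite -{2}(gsrc_unit GM x) gmul_unitr gtgt_unit.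
Qed.

End Abstract.

Lemma vb_tot_proj k l (M N : manifold R) (E : vbundle k M) (E' : vbundle l N)
    (f : smap M N) (F : vb_mor E E' f) u : proj E' (vb_tot F u) = f (proj E u).
Proof. by have [v <-] := vin_surj u; rewrite vb_totE !projE. Qed.

Definition zero_pt k (M : manifold R) (E : vbundle k M) (x : M) : tot E :=
  vin E (0 : fib E x).

Lemma vb_tot_zero k l (M N : manifold R) (E : vbundle k M) (E' : vbundle l N)
    (f : smap M N) (F : vb_mor E E' f) x : vb_tot F (zero_pt E x) = zero_pt E' (f x).
Proof. by rewrite vb_totE hom0. Qed.

Section LineBundleGroupoid.
Variable L : lb_groupoid R.
Let G := gbase L.

Lemma tot_fib k (M : manifold R) (E : vbundle k M) (u : tot E) x :
  proj E u = x -> exists v : fib E x, u = vin E v.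
Proof. by move=> <-; have [v uE] := vin_surj u; exists v; rewrite uE. Qed.

(** The fibre over a unit is a line, spanned by the unit of any non-zero
vector, whose source is that vector. *)
Lemma unit_fibre (x : gobj L) (u : tot (barr L)) :
  proj (barr L) u = gunit G x ->
  gsrc (gtot L) u = zero_pt (bobj L) x ->
  u = zero_pt (barr L) (gunit G x).
Proof.
move=> /tot_fib[v ->]; rewrite vsrcE vb_totE => E.
have v0 : vb_fib (vsrc L) (gunit G x) v = 0.
  apply: (@vin_inj _ _ _ (bobj L)); rewrite E.
  by rewrite -[RHS]/(zero_pt (bobj L) (gsrc G (gunit G x))) gsrc_unit.
have [e e0] := line_basis (bobj L) x.
pose e1 := vb_fib (vunit L) x e.
have se1 : vb_fib (vsrc L) (gunit G x) e1 != 0.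
  apply/eqP => se; have := gsrc_unit (gtot L) (vin (bobj L) e).
  rewrite vunitE vb_totE vsrcE vb_totE se -/(zero_pt _ _) gsrc_unit.
  by move/vin_inj/esym; exact/eqP.
have e10 : e1 != 0 by apply: contra_neq se1 => ->; rewrite hom0.
have [r vr] := line_scal v e10; move: v0; rewrite vr homZ => /eqP.
by rewrite scaler_eq0 (negbTE se1) orbF => /eqP ->; rewrite scale0r.
Qed.

(** An arrow over g with zero source, multiplied by the zero arrow over the
inverse of g, lands in the fibre over a unit; it is thus the inverse of that
zero arrow. *)
Lemma src_zero (u : tot (barr L)) :
  gsrc (gtot L) u = zero_pt (bobj L) (gsrc G (proj (barr L) u)) ->
  u = zero_pt (barr L) (proj (barr L) u).
Proof.
set g := proj (barr L) u => su.
pose w := zero_pt (barr L) (ginv G g).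
have tw : gtgt (gtot L) w = zero_pt (bobj L) (gsrc G g).
  by rewrite vtgtE vb_tot_zero gtgt_inv.
have uw : gsrc (gtot L) u = gtgt (gtot L) w by rewrite tw.
have Ew : gmul (gtot L) u w = gunit (gtot L) (zero_pt (bobj L) (gtgt G g)).
  rewrite vunitE vb_tot_zero; apply: unit_fibre.
    by rewrite vmul_proj// projE gmulVr.
  by rewrite gsrc_mul// vsrcE vb_tot_zero gsrc_inv.
rewrite (gcancel uw); first by rewrite vinvmE vb_tot_zero ginvK.
by rewrite Ew; rewrite -(gtgt_mul uw) Ew gtgt_unit.
Qed.

Lemma tgt_zero (u : tot (barr L)) :
  gtgt (gtot L) u = zero_pt (bobj L) (gtgt G (proj (barr L) u)) ->
  u = zero_pt (barr L) (proj (barr L) u).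
Proof.
move=> tu; have pi : proj (barr L) (ginv (gtot L) u) = ginv G (proj (barr L) u).
  by rewrite vinvmE vb_tot_proj.
have := @src_zero (ginv (gtot L) u); rewrite gsrc_inv pi gsrc_inv => /(_ tu) E.
by rewrite -{1}(ginvK (gtot L) u) E vinvmE vb_tot_zero ginvK.
Qed.

(** Injectivity suffices, the fibres being lines. *)
Lemma vsrc_bij g : bijective (vb_fib (vsrc L) g).
Proof.
apply: line_inj_bij => v v0; apply: (@vin_inj _ _ _ (barr L)).
have := @src_zero (vin (barr L) v); rewrite projE; apply.
by rewrite vsrcE vb_totE v0.
Qed.

Lemma vtgt_bij g : bijective (vb_fib (vtgt L) g).
Proof.
apply: line_inj_bij => v v0; apply: (@vin_inj _ _ _ (barr L)).
have := @tgt_zero (vin (barr L) v); rewrite projE; apply.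
by rewrite vtgtE vb_totE v0.
Qed.

Lemma vsrc_vin g (v : fib (barr L) g) :
  gsrc (gtot L) (vin (barr L) v) = vin (bobj L) (vb_fib (vsrc L) g v).
Proof. by rewrite vsrcE vb_totE. Qed.

Lemma vtgt_vin g (v : fib (barr L) g) :
  gtgt (gtot L) (vin (barr L) v) = vin (bobj L) (vb_fib (vtgt L) g v).
Proof. by rewrite vtgtE vb_totE. Qed.

(** The action of an inverse exchanges the roles of source and target; the Lie
derivative is defined by such actions. *)
Lemma actsV g (u w : tot (bobj L)) : acts (ginv G g) u w <->
  exists l : fib (barr L) g, u = vin (bobj L) (vb_fib (vtgt L) g l) /\
    w = vin (bobj L) (vb_fib (vsrc L) g l).
Proof.
split=> -[l [-> ->]].
  have /tot_fib[l' E] : proj (barr L) (ginv (gtot L) (vin (barr L) l)) = g.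
    by rewrite vinvmE vb_tot_proj projE ginvK.
  exists l'; rewrite -(vsrc_vin l') -(vtgt_vin l') -E gtgt_inv gsrc_inv.
  by rewrite vsrc_vin vtgt_vin.
have /tot_fib[l' E] : proj (barr L) (ginv (gtot L) (vin (barr L) l)) = ginv G g.
  by rewrite vinvmE vb_tot_proj projE.
exists l'; rewrite -(vsrc_vin l') -(vtgt_vin l') -E gtgt_inv gsrc_inv.
by rewrite vsrc_vin vtgt_vin.
Qed.

End LineBundleGroupoid.

(** Let F kill v. The zero arrow over 1_(f y), with source v and target 0
prescribed upstairs, lifts to an arrow of L'; its target is zero, so that it is
zero, and v is its source. *)
Lemma morita_fibre_bij (L' L : lb_groupoid R) (F : vbg_mor L' L) :
  is_vb_morita F -> forall y, bijective (vb_fib (Fobj F) y).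
Proof.
move=> [FM _] y; apply: line_inj_bij => v Fv0.
have := FM (gobj L') (sconst (gobj L') (zero_pt (barr L) (gunit (gbase L) (fobj F y))))
  (sconst _ (vin (bobj L') v)) (sconst _ (zero_pt (bobj L') y)).
case.
- by move=> _ /=; rewrite vsrcE vb_tot_zero gsrc_unit vb_totE Fv0.
- by move=> _ /=; rewrite vtgtE !vb_tot_zero gtgt_unit.
move=> c [[_ /(_ y) /= [_ sc tc]] _].
have pt : gtgt (gbase L') (proj (barr L') (c y)) = y.
  by rewrite -(vb_tot_proj (vtgt L')) -vtgtE tc projE.
have c0 : c y = zero_pt (barr L') (proj (barr L') (c y)).
  by apply: tgt_zero; rewrite tc pt.
have ps : gsrc (gbase L') (proj (barr L') (c y)) = y.
  by rewrite -(vb_tot_proj (vsrc L')) -vsrcE sc projE.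
apply: (@vin_inj _ _ _ (bobj L')).
by rewrite -sc c0 vsrcE vb_tot_zero ps.
Qed.

End Groupoids.

(** * Tangent spaces of transverse fibre products *)

Section EuclideanProjections.
Context {R : realType}.

Lemma smooth_map_mx n m (A : 'M[R]_(n, m)) :
  smooth_map ((fun u => (u : 'rV[R]_n) *m A) : rn n -> rn m).
Proof.
by apply/smooth_map_rn_rn => x; apply: smooth_at_mulmx; exact: smooth_at_id.
Qed.

Lemma smooth_map_pr1 n m : smooth_map ((fun u => lsubmx (u : 'rV[R]_(n + m))) : rn (n + m) -> rn n).
Proof.
apply/smooth_map_rn_rn => x; apply: smooth_at_row => i.
under eq_fun do rewrite mxE.
exact: (smooth_at_coord (lshift m i) (smooth_at_id x)).
Qed.

Lemma smooth_map_pr2 n m : smooth_map ((fun u => rsubmx (u : 'rV[R]_(n + m))) : rn (n + m) -> rn m).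
Proof.
apply/smooth_map_rn_rn => x; apply: smooth_at_row => i.
under eq_fun do rewrite mxE.
exact: (smooth_at_coord (rshift n i) (smooth_at_id x)).
Qed.

Lemma smooth_map_row_mx (M : manifold R) n m (f : M -> rn n) (g : M -> rn m) :
  smooth_map f -> smooth_map g ->
  smooth_map ((fun z => row_mx (f z : 'rV[R]_n) (g z : 'rV[R]_m)) : M -> rn (n + m)).
Proof.
move=> sf sg; apply: smooth_map_rn => i; case: (split_ordP i) => j ->.
  by under eq_fun do rewrite row_mxEl; exact: smooth_map_coord.
by under eq_fun do rewrite row_mxEr; exact: smooth_map_coord.
Qed.

Lemma smooth_map_sub (M : manifold R) n (f g : M -> rn n) :
  smooth_map f -> smooth_map g ->
  smooth_map ((fun z => (f z : 'rV[R]_n) - (g z : 'rV[R]_n)) : M -> rn n).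
Proof.
move=> sf sg; apply: smooth_map_rn => i.
have -> : (fun x => ((f x : 'rV[R]_n) - (g x : 'rV[R]_n)) 0 i)
   = (fun x => f x 0 i + (-1) * g x 0 i).
  by apply/funext => x; rewrite !mxE mulN1r.
apply: smooth_funD; first exact: smooth_map_coord.
by apply: smooth_funM; [exact: smooth_fun_cst|exact: smooth_map_coord].
Qed.

Lemma tvec_row_mx (M : manifold R) n m (f : M -> rn n) (g : M -> rn m) (x : M)
    (v : tangent x) :
  tvec ((fun z => row_mx (f z : 'rV[R]_n) (g z : 'rV[R]_m)) : M -> rn (n + m)) v
  = row_mx (tvec f v) (tvec g v).
Proof.
apply/rowP => i; rewrite mxE; case: (split_ordP i) => j ->.
  by under eq_fun do rewrite row_mxEl; rewrite row_mxEl mxE.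
by under eq_fun do rewrite row_mxEr; rewrite row_mxEr mxE.
Qed.

Lemma tvec_cst (M : manifold R) n (u : 'rV[R]_n) (x : M) (v : tangent x) :
  tvec ((fun=> u) : M -> rn n) v = 0.
Proof. by apply/rowP => i; rewrite !mxE tan_cst. Qed.

Lemma tvec_comp (M N : manifold R) (f : smap M N) n (P : N -> rn n) (x : M) (y : N)
    (fxy : f x = y) (v : tangent x) : smooth_map P ->
  tvec P (tdiff_at f fxy v) = tvec (fun z => P (f z)) v.
Proof.
by move=> sP; apply/rowP => i; rewrite !mxE tdiffE//; exact: smooth_map_coord.
Qed.

Lemma tvec_near (M : manifold R) n (f g : M -> rn n) (x : M) (v : tangent x) :
  smooth_map f -> smooth_map g -> (\forall z \near x, f z = g z) ->
  tvec f v = tvec g v.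
Proof.
move=> sf sg fg; apply/rowP => i; rewrite !mxE; apply: tan_local.
- exact: smooth_map_coord.
- exact: smooth_map_coord.
- by apply: filterS fg => z ->.
Qed.

Lemma tvec_sub (M : manifold R) n (f g : M -> rn n) (x : M) (v : tangent x) :
  smooth_map f -> smooth_map g ->
  tvec ((fun z => (f z : 'rV[R]_n) - (g z : 'rV[R]_n)) : M -> rn n) v =
  tvec f v - tvec g v.
Proof.
move=> sf sg; apply/rowP => i; rewrite !mxE.
have s1 := smooth_map_coord i sf; have s2 := smooth_map_coord i sg.
rewrite -mulN1r -tanZ// -tanD//; last first.
  by apply: smooth_funM => //; exact: smooth_fun_cst.
by congr (v _); apply/funext => z; rewrite !mxE mulN1r.
Qed.

Lemma tan_chain_map (M : manifold R) p q (P : M -> rn p) (F : rn p -> rn q) (x : M)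
    (v : tangent x) : smooth_map P -> smooth_map F ->
  tvec (fun z => F (P z)) v =
    'D_(tvec P v) (F : 'rV[R]_p -> 'rV[R]_q) (P x : 'rV[R]_p).
Proof.
move=> sP sF; apply/rowP => i; rewrite mxE.
rewrite -derive_coord; last by apply/smooth_at_diff; move/smooth_map_rn_rn: sF; exact.
exact: (tan_chain v sP (smooth_map_coord i sF)).
Qed.

End EuclideanProjections.

Section TransversePullback.
Context {R : realType}.
Variables (H G N M : manifold R) (s t : smap G M) (f : smap N M).
Variables (phi : smap H G) (s' t' : smap H N) (g0 : G) (h0 : H) (y : N) (x : M).
Hypotheses (phi0 : phi h0 = g0) (s'0 : s' h0 = y) (t'0 : t' h0 = y).
Hypotheses (s0 : s g0 = x) (t0 : t g0 = x) (f0 : f y = x).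
Hypothesis sphi : forall h, s (phi h) = f (s' h).
Hypothesis tphi : forall h, t (phi h) = f (t' h).
Hypothesis pull_exists : forall (W : manifold R) (a : smap W G) (b1 b2 : smap W N),
  (forall w, s (a w) = f (b1 w)) -> (forall w, t (a w) = f (b2 w)) ->
  exists c : smap W H, forall w, [/\ phi (c w) = a w, s' (c w) = b1 w & t' (c w) = b2 w].
Hypothesis pull_unique : forall h h',
  phi h = phi h' -> s' h = s' h' -> t' h = t' h' -> h = h'.
Hypothesis transv_s : forall w : tangent x, exists (xi : tangent g0) (v : tangent y),
  tdiff_at t t0 xi = tdiff_at f f0 v /\ tdiff_at s s0 xi = w.
Hypothesis transv_t : forall w : tangent x, exists (xi : tangent g0) (v : tangent y),
  tdiff_at s s0 xi = tdiff_at f f0 v /\ tdiff_at t t0 xi = w.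

(** H is the fibre product of (s, t) and f x f, which are transverse at the
given points. In coordinates, G x N x N near (g0, y, y) is an open subset of a
Euclidean space, where the fibre product is the level set of a submersion Phi.
Its parametrisation lifts to H by the universal property, which gives a smooth
map J from the Euclidean space to H that is left inverse to the coordinates P
of H. The linear maps are the derivatives of J in the three groups of
variables: they reconstruct a tangent vector of H since J P = id, and map
compatible vectors to a solution since these are the vectors tangent to the
level set. *)
Lemma transverse_pullback :
  exists (lG : hom (tangent g0) (tangent h0)) (l1 l2 : hom (tangent y) (tangent h0)),
  (forall xi : tangent h0, lG (tdiff_at phi phi0 xi) + l1 (tdiff_at s' s'0 xi)
     + l2 (tdiff_at t' t'0 xi) = xi) /\
  (forall (eta : tangent g0) (v1 v2 : tangent y),
     tdiff_at s s0 eta = tdiff_at f f0 v1 -> tdiff_at t t0 eta = tdiff_at f f0 v2 ->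
     let xi := lG eta + l1 v1 + l2 v2 in
     [/\ tdiff_at phi phi0 xi = eta, tdiff_at s' s'0 xi = v1 & tdiff_at t' t'0 xi = v2]).
Proof.
have [XG [YG [YXG XYG]]] := global_coords g0.
have [XN [YN [YXN XYN]]] := global_coords y.
have [XM [YM [YXM XYM]]] := global_coords x.
pose mG := mdim G; pose mN := mdim N; pose mM := mdim M; pose p := (mG + (mN + mN))%N.
pose pr1 (u : rn p) : rn mG := lsubmx (u : 'rV[R]_(mG + (mN + mN))).
pose pr2 (u : rn p) : rn mN :=
  lsubmx (rsubmx (u : 'rV[R]_(mG + (mN + mN))) : 'rV[R]_(mN + mN)).
pose pr3 (u : rn p) : rn mN :=
  rsubmx (rsubmx (u : 'rV[R]_(mG + (mN + mN))) : 'rV[R]_(mN + mN)).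
have s1 : smooth_map pr1 by exact: smooth_map_pr1.
have s2 : smooth_map pr2.
  exact: (smooth_map_comp (@smooth_map_pr2 _ mG (mN + mN)) (@smooth_map_pr1 _ mN mN)).
have s3 : smooth_map pr3.
  exact: (smooth_map_comp (@smooth_map_pr2 _ mG (mN + mN)) (@smooth_map_pr2 _ mN mN)).
pose row3 (a : 'rV[R]_mG) (b c : 'rV[R]_mN) : rn p := row_mx a (row_mx b c).
have pr1E a b c : pr1 (row3 a b c) = a by rewrite /pr1 /row3 row_mxKl.
have pr2E a b c : pr2 (row3 a b c) = b by rewrite /pr2 /row3 row_mxKr row_mxKl.
have pr3E a b c : pr3 (row3 a b c) = c by rewrite /pr3 /row3 !row_mxKr.
pose P0 := row3 (XG g0) (XN y) (XN y).
have s_row3 (W : manifold R) (a : W -> rn mG) (b c : W -> rn mN) : smooth_map a ->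
    smooth_map b -> smooth_map c -> smooth_map (fun w => row3 (a w) (b w) (c w)).
  move=> sa sb sc; apply: (@smooth_map_row_mx _ _ mG (mN + mN)) => //.
  exact: smooth_map_row_mx.
have tvec3 (W : manifold R) (a : W -> rn mG) (b c : W -> rn mN) w (v : tangent w) :
    tvec (fun w => row3 (a w) (b w) (c w)) v =
    row3 (tvec a v) (tvec b v) (tvec c v).
  rewrite (@tvec_row_mx _ _ mG (mN + mN) a (fun w => row_mx (b w) (c w))).
  by rewrite tvec_row_mx.
pose i1 : smap G (rn p) := SMap (s_row3 G _ _ _ (smapP XG)
  (smooth_map_cst (XN y)) (smooth_map_cst (XN y))).
pose i2 : smap N (rn p) := SMap (s_row3 N _ _ _ (smooth_map_cst (XG g0))
  (smapP XN) (smooth_map_cst (XN y))).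
pose i3 : smap N (rn p) := SMap (s_row3 N _ _ _ (smooth_map_cst (XG g0))
  (smooth_map_cst (XN y)) (smapP XN)).
(* Coordinates of a triple of tangent vectors; i1, i2 and i3 are the inclusions
   of the three factors through the base point. *)
pose dir (eta : tangent g0) (v1 v2 : tangent y) : 'rV[R]_p :=
  row3 (tvec XG eta) (tvec XN v1) (tvec XN v2).
have dirE (eta : tangent g0) (v1 v2 : tangent y) (g : rn p -> R) : smooth_fun g ->
    'D_(dir eta v1 v2) (g : 'rV[R]_p -> R^o) (P0 : 'rV[R]_p) =
    eta (g \o i1) + v1 (g \o i2) + v2 (g \o i3).
  move=> sg; rewrite (tan_chain eta (smapP i1) sg) (tan_chain v1 (smapP i2) sg).
  rewrite (tan_chain v2 (smapP i3) sg) /= !tvec3 !tvec_cst.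
  have dg : differentiable (g : 'rV[R]_p -> R^o) (P0 : 'rV[R]_p).
    by apply: smooth_at_diff; move/smooth_fun_rn: sg; exact.
  rewrite -/P0 !deriveE// -!linearD; congr ('d _ _ _).
  by rewrite /dir /row3 !add_row_mx !addr0 !add0r.
have dirV (eta : tangent g0) (v1 v2 : tangent y) q (g : rn p -> rn q) : smooth_map g ->
    'D_(dir eta v1 v2) (g : 'rV[R]_p -> 'rV[R]_q) (P0 : 'rV[R]_p) =
    tvec (g \o i1) eta + tvec (g \o i2) v1 + tvec (g \o i3) v2.
  move=> sg; apply/rowP => j; rewrite !mxE -derive_coord; last first.
    by apply: smooth_at_diff; move/smooth_map_rn_rn: sg; exact.
  exact: (dirE _ _ _ _ (smooth_map_coord j sg)).
pose FS u : rn mM := XM (s (YG (pr1 u))).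
pose FT u : rn mM := XM (t (YG (pr1 u))).
pose FB u : rn mM := XM (f (YN (pr2 u))).
pose FC u : rn mM := XM (f (YN (pr3 u))).
have sFS : smooth_map FS by exact: (smooth_map_comp s1 (smapP (scomp XM (scomp s YG)))).
have sFT : smooth_map FT by exact: (smooth_map_comp s1 (smapP (scomp XM (scomp t YG)))).
have sFB : smooth_map FB by exact: (smooth_map_comp s2 (smapP (scomp XM (scomp f YN)))).
have sFC : smooth_map FC by exact: (smooth_map_comp s3 (smapP (scomp XM (scomp f YN)))).
pose Phi (u : rn p) : rn (mM + mM) :=
  row_mx ((FS u : 'rV[R]_mM) - FB u) ((FT u : 'rV[R]_mM) - FC u).
have sPhi : smooth_map Phi.
  by apply: smooth_map_row_mx; apply: smooth_map_sub.
have YG0 : YG (XG g0) = g0 by exact: (nbhs_singleton YXG).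
have YN0 : YN (XN y) = y by exact: (nbhs_singleton YXN).
have Phi0 : Phi P0 = 0.
  rewrite /Phi /FS /FT /FB /FC pr1E pr2E pr3E YG0 YN0 s0 t0 f0 subrr.
  by rewrite row_mx0.
have dPhi (eta : tangent g0) (v1 v2 : tangent y) :
    'D_(dir eta v1 v2) (Phi : 'rV[R]_p -> 'rV[R]_(mM + mM)) (P0 : 'rV[R]_p) =
    row_mx (tvec XM (tdiff_at s s0 eta) - tvec XM (tdiff_at f f0 v1))
           (tvec XM (tdiff_at t t0 eta) - tvec XM (tdiff_at f f0 v2)).
  have split_tvec (Z : manifold R) (k : smap Z (rn p)) (z : Z) (v : tangent z) :
      tvec (Phi \o k) v = row_mx (tvec (FS \o k) v - tvec (FB \o k) v)
                                 (tvec (FT \o k) v - tvec (FC \o k) v).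
    have c g : smooth_map g -> smooth_map (g \o k) by exact: smooth_map_comp (smapP k).
    rewrite (@tvec_row_mx _ _ mM mM (fun z => (FS (k z) : 'rV[R]_mM) - FB (k z))
      (fun z => (FT (k z) : 'rV[R]_mM) - FC (k z))).
    by rewrite !tvec_sub//; exact: c.
  rewrite dirV// !split_tvec.
  have nG (h : smap G M) : tvec (fun z => XM (h (YG (pr1 (i1 z))))) eta =
      tvec (fun z => XM (h z)) eta.
    apply: tvec_near => [||]; last by apply: filterS YXG => z hz; rewrite pr1E hz.
      exact: (smooth_map_comp (smapP i1) (smooth_map_comp s1 (smapP (scomp XM (scomp h YG))))).
    exact: smapP (scomp XM h).
  have n2 (v : tangent y) : tvec (fun z => XM (f (YN (pr2 (i2 z))))) v =
      tvec (fun z => XM (f z)) v.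
    apply: tvec_near => [||]; last by apply: filterS YXN => z hz; rewrite pr2E hz.
      exact: (smooth_map_comp (smapP i2) (smooth_map_comp s2 (smapP (scomp XM (scomp f YN))))).
    exact: smapP (scomp XM f).
  have n3 (v : tangent y) : tvec (fun z => XM (f (YN (pr3 (i3 z))))) v =
      tvec (fun z => XM (f z)) v.
    apply: tvec_near => [||]; last by apply: filterS YXN => z hz; rewrite pr3E hz.
      exact: (smooth_map_comp (smapP i3) (smooth_map_comp s3 (smapP (scomp XM (scomp f YN))))).
    exact: smapP (scomp XM f).
  have z1 (a : smap G M) (Z : manifold R) (k : smap Z (rn p)) (z : Z) (v : tangent z) :
      (forall u, pr1 (k u) = XG g0) -> tvec (fun u => XM (a (YG (pr1 (k u))))) v = 0.
    by move=> ck; under eq_fun do rewrite ck; exact: tvec_cst.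
  have z2 (Z : manifold R) (k : smap Z (rn p)) (z : Z) (v : tangent z) :
      (forall u, pr2 (k u) = XN y) -> tvec (fun u => XM (f (YN (pr2 (k u))))) v = 0.
    by move=> ck; under eq_fun do rewrite ck; exact: tvec_cst.
  have z3 (Z : manifold R) (k : smap Z (rn p)) (z : Z) (v : tangent z) :
      (forall u, pr3 (k u) = XN y) -> tvec (fun u => XM (f (YN (pr3 (k u))))) v = 0.
    by move=> ck; under eq_fun do rewrite ck; exact: tvec_cst.
  rewrite nG (nG t) n2 n3 !z1 ?z2 ?z3; try by move=> u; rewrite ?pr1E ?pr2E ?pr3E.
  rewrite !add_row_mx !tvec_comp; try exact: smapP.
  by rewrite !(subrr, sub0r, subr0, addr0, add0r).
have surj k : exists w, 'D_w (Phi : 'rV[R]_p -> 'rV[R]_(mM + mM)) (P0 : 'rV[R]_p) = k.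
  have [w1 k1] := @tan_of_tvec _ M x XM YM (lsubmx k) YXM XYM.
  have [w2 k2] := @tan_of_tvec _ M x XM YM (rsubmx k) YXM XYM.
  have [xi1 [u1 [txi1 sxi1]]] := transv_s w1.
  have [xi2 [u2 [sxi2 txi2]]] := transv_t w2.
  (* The correction terms u1 and u2 each cancel the unwanted component. *)
  exists (dir (xi1 + xi2) u2 u1); rewrite dPhi !homD txi1 sxi1 sxi2 txi2.
  have addK (a b : tangent x) : tvec XM (a + b) = tvec XM a + tvec XM b.
    by have := tvec_lin XM 1 a b; rewrite !scale1r.
  by rewrite !addK addrK addrC addKr k1 k2 hsubmxK.
have [E [c [sc c0 Phic cPhi dc]]] := @level_set R _ _ (Phi : 'rV[R]_p -> 'rV[R]_(mM + mM))
  (P0 : 'rV[R]_p) ((smooth_map_rn_rn _).2 sPhi) surj.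
rewrite Phi0 in Phic cPhi.
(* On Q the four points of M lie where XM is injective, so that Phi u = 0 is the
   equation of the fibre product. *)
pose Q := [set u : rn p | [/\ YM (XM (s (YG (pr1 u)))) = s (YG (pr1 u)),
  YM (XM (f (YN (pr2 u)))) = f (YN (pr2 u)),
  YM (XM (t (YG (pr1 u)))) = t (YG (pr1 u)) &
  YM (XM (f (YN (pr3 u)))) = f (YN (pr3 u))]].
have QP0 : \forall u \near (P0 : 'rV[R]_p), Q u.
  have tox (W : manifold R) (k : smap (rn p) W) (h : smap W M) :
      h (k P0) = x -> \forall u \near (P0 : 'rV[R]_p), YM (XM (h (k u))) = h (k u).
    move=> hk; have hn : nbhs (scomp h k P0) [set m | YM (XM m) = m].
      by rewrite /= hk; exact: YXM.
    have hc := @smap_cont _ _ _ (scomp h k) P0.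
    exact: (hc _ hn).
  have kG := tox _ (scomp YG (SMap s1)).
  have k2 := tox _ (scomp YN (SMap s2)).
  have k3 := tox _ (scomp YN (SMap s3)).
  have q1 := kG s; have q2 := k2 f; have q3 := kG t; have q4 := k3 f.
  rewrite /= /P0 !(pr1E, pr2E, pr3E, YG0, YN0) in q1 q2 q3 q4.
  apply: filterS (filterI (filterI (q1 s0) (q2 f0)) (filterI (q3 t0) (q4 f0))) => u.
  by move=> [[? ?] [? ?]].
have ccont : {for 0, continuous c} by exact: smooth_at_cont sc.
have csm : \forall z \near 0, smooth_at c z by exact: smooth_at_open.
have cQ : nbhs (0 : 'rV[R]_p) [set z : 'rV[R]_p | Q (c z)] by apply: ccont; rewrite c0.
have [kap [skap kapU kap0]] := smooth_shrink (filterI csm (filterI Phic cQ)).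
have kap00 : kap 0 = 0 by exact: (nbhs_singleton kap0).
pose ck : rn p -> rn p := c \o kap.
have sck : smooth_map ck.
  apply/smooth_map_rn_rn => z; apply: smooth_at_compr; first exact: skap.
  by have [] := kapU z.
pose a := scomp YG (scomp (SMap s1) (SMap sck)).
pose b1 := scomp YN (scomp (SMap s2) (SMap sck)).
pose b2 := scomp YN (scomp (SMap s3) (SMap sck)).
have sab w : s (a w) = f (b1 w).
  have [_ [Phiw [q1 q2 _ _]]] := kapU w; rewrite /= -q1 -q2; congr (YM _).
  have /(congr1 (fun M => lsubmx (M : 'rV_(mM + mM)))) := Phiw.
  by rewrite /Phi row_mxKl linear0 => /subr0_eq.
have tab w : t (a w) = f (b2 w).
  have [_ [Phiw [_ _ q1 q2]]] := kapU w; rewrite /= -q1 -q2; congr (YM _).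
  have /(congr1 (fun M => rsubmx (M : 'rV_(mM + mM)))) := Phiw.
  by rewrite /Phi row_mxKr linear0 => /subr0_eq.
have [C HC] := pull_exists sab tab.
pose aff : rn p -> rn p := fun u => ((u : 'rV[R]_p) - P0) *m E.
have saff : smooth_map aff.
  have sid : smooth_map (fun u : @rn R p => u).
    exact: ((smooth_map_rn_rn _).1 (fun z => smooth_at_id z)).
  exact: (smooth_map_comp (smooth_map_sub sid (smooth_map_cst (P0 : rn p))) (smooth_map_mx E)).
have aff0 : aff P0 = 0 by rewrite /aff subrr mul0mx.
pose J := scomp C (SMap saff).
have phiJ u : phi (J u) = YG (pr1 (ck (aff u))) by have [] := HC (aff u).
have sJ u : s' (J u) = YN (pr2 (ck (aff u))) by have [] := HC (aff u).
have tJ u : t' (J u) = YN (pr3 (ck (aff u))) by have [] := HC (aff u).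
have ckaff0 : ck (aff P0) = P0 by rewrite aff0 /ck /= kap00 c0.
have J0 : J P0 = h0.
  apply: pull_unique; rewrite ?phiJ ?sJ ?tJ ckaff0 /P0 ?pr1E ?pr2E ?pr3E ?YG0 ?YN0 //.
have homE (eta : tangent g0) (v1 v2 : tangent y) (k : H -> R) : smooth_fun k ->
    ((tdiff_at (scomp J i1) J0 eta + tdiff_at (scomp J i2) J0 v1
      + tdiff_at (scomp J i3) J0 v2 : tangent h0) k) =
    'D_(dir eta v1 v2) ((k \o J) : 'rV[R]_p -> R^o) (P0 : 'rV[R]_p).
  move=> sk; rewrite dirE; last exact: (smooth_map_fun (smapP J) sk).
  change ((tdiff_at (scomp J i1) J0 eta : tangent h0) k
    + (tdiff_at (scomp J i2) J0 v1 : tangent h0) k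
    + (tdiff_at (scomp J i3) J0 v2 : tangent h0) k
    = eta ((k \o J) \o i1) + v1 ((k \o J) \o i2) + v2 ((k \o J) \o i3)).
  by rewrite !tdiffE.
exists (tdiff_at (scomp J i1) J0), (tdiff_at (scomp J i2) J0), (tdiff_at (scomp J i3) J0).
split=> [xi|eta v1 v2 e1 e2 xi].
  apply: tan_ext => k sk; rewrite homE//.
  pose P : H -> rn p := fun h => row3 (XG (phi h)) (XN (s' h)) (XN (t' h)).
  have sP : smooth_map P.
    exact: (s_row3 _ _ _ _ (smapP (scomp XG phi)) (smapP (scomp XN s')) (smapP (scomp XN t'))).
  have Ph0 : P h0 = P0 by rewrite /P phi0 s'0 t'0.
  have skJ : smooth_fun (k \o J) by exact: (smooth_map_fun (smapP J) sk).
  have -> : dir (tdiff_at phi phi0 xi) (tdiff_at s' s'0 xi) (tdiff_at t' t'0 xi) = tvec P xi.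
    by rewrite tvec3 /dir !tvec_comp//; exact: smapP.
  rewrite -Ph0 -(tan_chain xi sP skJ); apply: tan_local => //.
    exact: (smooth_map_fun sP skJ).
  have cont_at (W : manifold R) (h : smap H W) (w : W) (B : set W) :
      h h0 = w -> nbhs w B -> nbhs h0 (h @^-1` B).
    by move=> <-; exact: (@smap_cont _ _ _ h h0).
  have n1 := cont_at _ phi _ _ phi0 YXG; have n2 := cont_at _ s' _ _ s'0 YXN.
  have n3 := cont_at _ t' _ _ t'0 YXN.
  have n4 := cont_at _ (SMap sP) _ _ Ph0 cPhi.
  have n5 := cont_at _ (SMap (smooth_map_comp sP saff)) 0 _ _ kap0.
  rewrite /= Ph0 aff0 in n5.
  apply: filterS (filterI (filterI (filterI n1 n2) (filterI n3 n4)) (n5 erefl)) => h.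
  move=> [[[m1 m2] [m3 m4]] m5].
  rewrite /= in m1 m2 m3 m4 m5.
  have PhiP : Phi (P h) = 0.
    rewrite /Phi /FS /FT /FB /FC !(pr1E, pr2E, pr3E) m1 m2 m3 sphi tphi !subrr.
    by rewrite row_mx0.
  have ckP : ck (aff (P h)) = P h by rewrite /ck /= m5 m4.
  congr (k _); apply: pull_unique; rewrite ?phiJ ?sJ ?tJ ckP ?pr1E ?pr2E ?pr3E //.
have dPhi0 : 'D_(dir eta v1 v2) (Phi : 'rV[R]_p -> 'rV[R]_(mM + mM)) (P0 : 'rV[R]_p) = 0.
  by rewrite dPhi e1 e2 !subrr row_mx0.
(* Compatible vectors are tangent to the level set, where the derivative of c
   inverts E. *)
have dck : 'D_(dir eta v1 v2) ((ck \o aff) : 'rV[R]_p -> 'rV[R]_p) (P0 : 'rV[R]_p) = dir eta v1 v2.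
  have sa : smooth_at (aff : 'rV[R]_p -> 'rV[R]_p) P0 by exact: ((smooth_map_rn_rn _).2 saff).
  transitivity ('D_(dir eta v1 v2) ((c \o aff) : 'rV[R]_p -> 'rV[R]_p) (P0 : 'rV[R]_p)).
    apply: near_eq_derive.
    have ca : {for (P0 : 'rV[R]_p), continuous (aff : 'rV[R]_p -> 'rV[R]_p)}.
      exact: smooth_at_cont.
    have nz : nbhs (P0 : 'rV[R]_p) ((aff : 'rV[R]_p -> 'rV[R]_p) @^-1` [set z | kap z = z]).
      by apply: ca; rewrite aff0.
    by apply: filterS nz => z hz; rewrite /ck /= hz.
  rewrite smooth_at_compW ?aff0//.
  have -> : 'D_(dir eta v1 v2) (aff : 'rV[R]_p -> 'rV[R]_p) (P0 : 'rV[R]_p) = dir eta v1 v2 *m E.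
    have lE : linear (fun w : 'rV[R]_p => w *m E) by move=> b u w; rewrite mulmxDl scalemxAl.
    have cE : continuous (fun w : 'rV[R]_p => w *m E).
      by move=> u; apply/smooth_at_cont/smooth_at_mulmx/smooth_at_id.
    have dsub : is_derive (P0 : 'rV[R]_p) (dir eta v1 v2)
        (fun u : 'rV[R]_p => u - P0) (dir eta v1 v2).
      have := is_deriveB (is_derive_id (P0 : 'rV[R]_p) (dir eta v1 v2))
        (is_derive_cst (P0 : 'rV[R]_p) (P0 : 'rV[R]_p) (dir eta v1 v2)).
      by rewrite subr0.
    have dfsub : differentiable (fun u : 'rV[R]_p => u - P0) (P0 : 'rV[R]_p).
      exact: differentiableB.
    have [_ ->] := derive_lin (dir eta v1 v2) lE cE dfsub.
    by rewrite derive_val.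
  exact: dc.
have pushed (Z : manifold R) (h : smap H Z) (pr : rn p -> Z) (z : Z)
     (hz : h h0 = z) (v : tangent z) :
   smooth_map pr -> (forall u, h (J u) = pr (ck (aff u))) ->
   (forall k, smooth_fun k ->
     'D_(dir eta v1 v2) ((k \o pr) : 'rV[R]_p -> R^o) (P0 : 'rV[R]_p) = v k) ->
   tdiff_at h hz xi = v.
  move=> spr hJ vk; apply: tan_ext => k sk; rewrite tdiffE// homE; last first.
    exact: smooth_fun_comp.
  have -> : ((k \o h) \o J) = (k \o pr) \o (ck \o aff).
    by apply/funext => u /=; rewrite hJ.
  have sck' : smooth_at ((ck \o aff) : 'rV[R]_p -> 'rV[R]_p) P0.
    exact: ((smooth_map_rn_rn _).2 (smooth_map_comp saff sck)).
  have skp : smooth_fun (k \o pr) by exact: (smooth_map_fun spr sk).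
  rewrite (smooth_at_compW _ sck') /= ?ckaff0; last exact: ((smooth_fun_rn _).1 skp).
  by rewrite dck vk.
split.
- have spr : smooth_map (YG \o pr1) by exact: (smooth_map_comp s1 (smapP YG)).
  apply: (pushed _ phi (YG \o pr1)) => // k sk.
  have skpr : smooth_fun (k \o (YG \o pr1)) by exact: (smooth_map_fun spr sk).
  rewrite dirE//.
  have -> : (k \o (YG \o pr1)) \o i2 = fun=> k (YG (XG g0)).
    by apply/funext => z /=; rewrite pr1E.
  have -> : (k \o (YG \o pr1)) \o i3 = fun=> k (YG (XG g0)).
    by apply/funext => z /=; rewrite pr1E.
  rewrite !tan_cst !(addr0, add0r); apply: tan_local => //.
    exact: (smooth_map_fun (smapP i1) skpr).
  by apply: filterS YXG => z hz; rewrite /= pr1E hz.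
- have spr : smooth_map (YN \o pr2) by exact: (smooth_map_comp s2 (smapP YN)).
  apply: (pushed _ s' (YN \o pr2)) => // k sk.
  have skpr : smooth_fun (k \o (YN \o pr2)) by exact: (smooth_map_fun spr sk).
  rewrite dirE//.
  have -> : (k \o (YN \o pr2)) \o i1 = fun=> k (YN (XN y)).
    by apply/funext => z /=; rewrite pr2E.
  have -> : (k \o (YN \o pr2)) \o i3 = fun=> k (YN (XN y)).
    by apply/funext => z /=; rewrite pr2E.
  rewrite !tan_cst !(addr0, add0r); apply: tan_local => //.
    exact: (smooth_map_fun (smapP i2) skpr).
  by apply: filterS YXN => z hz; rewrite /= pr2E hz.
- have spr : smooth_map (YN \o pr3) by exact: (smooth_map_comp s3 (smapP YN)).
  apply: (pushed _ t' (YN \o pr3)) => // k sk.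
  have skpr : smooth_fun (k \o (YN \o pr3)) by exact: (smooth_map_fun spr sk).
  rewrite dirE//.
  have -> : (k \o (YN \o pr3)) \o i1 = fun=> k (YN (XN y)).
    by apply/funext => z /=; rewrite pr3E.
  have -> : (k \o (YN \o pr3)) \o i2 = fun=> k (YN (XN y)).
    by apply/funext => z /=; rewrite pr3E.
  rewrite !tan_cst !(addr0, add0r); apply: tan_local => //.
    exact: (smooth_map_fun (smapP i3) skpr).
  by apply: filterS YXN => z hz; rewrite /= pr3E hz.
Qed.

End TransversePullback.

Section TangentCalculus.
Context {R : realType}.

Lemma tdiff_at_comp (M N P : manifold R) (f : smap M N) (g : smap N P) (x : M)
    (y : N) (z : P) (fxy : f x = y) (gyz : g y = z) (gfxz : scomp g f x = z)
    (v : tangent x) :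
  tdiff_at g gyz (tdiff_at f fxy v) = tdiff_at (scomp g f) gfxz v.
Proof.
apply: tan_ext => h sh; rewrite !tdiffE//.
exact: (smooth_map_fun (smapP g) sh).
Qed.

Lemma tdiff_at_eq (M N : manifold R) (f g : smap M N) (x : M) (y : N)
    (fxy : f x = y) (gxy : g x = y) (v : tangent x) : (forall z, f z = g z) ->
  tdiff_at f fxy v = tdiff_at g gxy v.
Proof.
move=> fg; apply: tan_ext => h sh; rewrite !tdiffE//; congr (v _).
by apply/funext => z /=; rewrite fg.
Qed.

Lemma tdiff_at_id (M : manifold R) (f : smap M M) (x : M) (fx : f x = x)
    (v : tangent x) : (forall z, f z = z) -> tdiff_at f fx v = v.
Proof.
move=> fz; apply: tan_ext => h sh; rewrite tdiffE//; congr (v _).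
by apply/funext => z /=; rewrite fz.
Qed.

Lemma tdiff_at_eq0 (M N : manifold R) (f : smap M N) (x : M) (y : N)
    (fxy : f x = y) (v : tangent x) : tdiff_at f fxy v = 0 <-> tdiff f x v = 0.
Proof. by case: _ / fxy. Qed.

Lemma surj_submersion_at (M N : manifold R) (f : smap M N) (x : M) (y : N)
    (fxy : f x = y) (w : tangent y) : surj_submersion f ->
  exists v, tdiff_at f fxy v = w.
Proof. by move=> [_ fs]; case: _ / fxy w => w; exact: fs. Qed.

End TangentCalculus.

(** * Tangent spaces under a Morita map *)

Section MoritaBase.
Context {R : realType}.
Variables (L' L : lb_groupoid R) (F : vbg_mor L' L).
Hypothesis FM : is_vb_morita F.
Let G := gbase L.
Let H := gbase L'.
Let zs k (M : manifold R) (E : vbundle k M) : smap M (tot E) := SMap (smooth_zero E).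

(** Zero sections embed the base groupoids into the total ones, and the
projections lead back: the base map inherits the fibre product property. *)
Lemma base_pull_exists (W : manifold R) (a : smap W (garr L)) (b1 b2 : smap W (gobj L')) :
  (forall w, gsrc G (a w) = fobj F (b1 w)) ->
  (forall w, gtgt G (a w) = fobj F (b2 w)) ->
  exists c : smap W (garr L'),
    forall w, [/\ farr F (c w) = a w, gsrc H (c w) = b1 w & gtgt H (c w) = b2 w].
Proof.
move=> sab tab; have [FM1 _] := FM.
have [||c [[sc cP] _]] := FM1 W (scomp (zs (barr L)) a) (scomp (zs (bobj L')) b1)
  (scomp (zs (bobj L')) b2).
- by move=> w; rewrite /= -!/(zero_pt _ _) vsrcE !vb_tot_zero sab.
- by move=> w; rewrite /= -!/(zero_pt _ _) vtgtE !vb_tot_zero tab.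
exists (scomp (proj (barr L')) (SMap sc)) => w /=; have [c1 c2 c3] := cP w.
split.
- by rewrite -(vb_tot_proj (Farr F)) c1 projE.
- by rewrite -(vb_tot_proj (vsrc L')) -vsrcE c2 projE.
- by rewrite -(vb_tot_proj (vtgt L')) -vtgtE c3 projE.
Qed.

Lemma base_pull_unique (h h' : garr L') : farr F h = farr F h' ->
  gsrc H h = gsrc H h' -> gtgt H h = gtgt H h' -> h = h'.
Proof.
move=> fh sh th; have [FM1 _] := FM.
have [||c [_ cu]] := FM1 (garr L') (sconst _ (zero_pt (barr L) (farr F h)))
  (sconst _ (zero_pt (bobj L') (gsrc H h))) (sconst _ (zero_pt (bobj L') (gtgt H h))).
- by move=> w; rewrite /= vsrcE !vb_tot_zero (gm_src (f_mor F)).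
- by move=> w; rewrite /= vtgtE !vb_tot_zero (gm_tgt (f_mor F)).
have ch k : farr F k = farr F h -> gsrc H k = gsrc H h -> gtgt H k = gtgt H h ->
    c = fun=> zero_pt (barr L') k.
  move=> e1 e2 e3; apply: cu; split; first exact: smooth_map_cst.
  by move=> w; rewrite vsrcE vtgtE !vb_tot_zero e1 e2 e3.
have := ch h erefl erefl erefl.
rewrite (ch h' (esym fh) (esym sh) (esym th)) => /(congr1 (fun k => proj (barr L') (k h))).
by rewrite !projE.
Qed.

Variable y : gobj L'.
Let x := fobj F y.

(** The tangent vector w is moved to the zero section of L, lifted through the
submersion r, and projected down to G and N. *)
Lemma morita_transv_tgt (w : tangent x) :
  exists (xi : tangent (gunit G x)) (v : tangent y),
    tdiff_at (gsrc G) (gsrc_unit G x) xi = tdiff (fobj F) y v /\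
    tdiff_at (gtgt G) (gtgt_unit G x) xi = w.
Proof.
have [_ [P [p [q [r [[pq pull] rE rsub]]]]]] := FM.
have [|c [[sc cP] _]] := pull (gobj L') (sconst _ (zero_pt (barr L) (gunit G x)))
  (sconst _ (zero_pt (bobj L') y)).
  by move=> w0; rewrite /= vsrcE !vb_tot_zero gsrc_unit.
have [pz qz] := cP y; set z := c y in pz qz; rewrite /= in pz qz.
have rz : r z = zero_pt (bobj L) x by rewrite rE pz vtgtE vb_tot_zero gtgt_unit.
have zx : zs (bobj L) x = zero_pt (bobj L) x by [].
have [v vw] := surj_submersion_at rz (tdiff_at (zs (bobj L)) zx w) rsub.
have pz' : scomp (proj (barr L)) p z = gunit G x by rewrite /= pz projE.
have qz' : scomp (proj (bobj L')) q z = y by rewrite /= qz projE.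
exists (tdiff_at _ pz' v), (tdiff_at _ qz' v); split.
  have e1 : scomp (gsrc G) (scomp (proj (barr L)) p) z = x by rewrite /= pz projE gsrc_unit.
  have e2 : scomp (fobj F) (scomp (proj (bobj L')) q) z = x by rewrite /= qz projE.
  rewrite (tdiff_at_comp _ _ e1) /tdiff (tdiff_at_comp _ _ e2).
  by apply: tdiff_at_eq => u; rewrite /= -(vb_tot_proj (vsrc L)) -(vb_tot_proj (Fobj F)) -vsrcE pq.
have e1 : scomp (gtgt G) (scomp (proj (barr L)) p) z = x by rewrite /= pz projE gtgt_unit.
have e2 : scomp (proj (bobj L)) r z = x by rewrite /= rz projE.
have e3 : proj (bobj L) (zero_pt (bobj L) x) = x by rewrite projE.
rewrite (tdiff_at_comp _ _ e1).
transitivity (tdiff_at _ e2 v).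
  by apply: tdiff_at_eq => u; rewrite /= rE vtgtE vb_tot_proj.
rewrite -(tdiff_at_comp rz e3) vw.
have e4 : scomp (proj (bobj L)) (zs (bobj L)) x = x by rewrite /= projE.
by rewrite (tdiff_at_comp _ _ e4); apply: tdiff_at_id => u; rewrite /= projE.
Qed.

(** From the target by inversion of arrows. *)
Lemma morita_transv_src (w : tangent x) :
  exists (xi : tangent (gunit G x)) (v : tangent y),
    tdiff_at (gtgt G) (gtgt_unit G x) xi = tdiff (fobj F) y v /\
    tdiff_at (gsrc G) (gsrc_unit G x) xi = w.
Proof.
have [xi [v [sxi txi]]] := morita_transv_tgt w.
exists (tdiff_at (ginv G) (ginv_unit G x) xi), v; split.
  have e : scomp (gtgt G) (ginv G) (gunit G x) = x by rewrite /= ginv_unit gtgt_unit.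
  rewrite (tdiff_at_comp _ _ e) -sxi; apply: tdiff_at_eq => g; exact: gtgt_inv.
have e : scomp (gsrc G) (ginv G) (gunit G x) = x by rewrite /= ginv_unit gsrc_unit.
rewrite (tdiff_at_comp _ _ e) -txi; apply: tdiff_at_eq => g; exact: gsrc_inv.
Qed.

End MoritaBase.

Section LieAlgebroid.
Context {R : realType}.
Variables (G M : manifold R) (GM : groupoid G M) (x : M).

Lemma lie_alg_src (a : lie_alg GM x) :
  tdiff_at (gsrc GM) (gsrc_unit GM x) (ssval a) = 0.
Proof. by apply/tdiff_at_eq0; exact: (subspP a). Qed.

Lemma lie_alg_lift (xi : tangent (gunit GM x)) :
  tdiff_at (gsrc GM) (gsrc_unit GM x) xi = 0 ->
  exists a : lie_alg GM x, ssval a = xi.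
Proof.
move=> xi0; have k := (tdiff_at_eq0 (gsrc_unit GM x) xi).1 xi0.
by exists (mksub (S := ker_space (tdiff (gsrc GM) (gunit GM x))) k).
Qed.

Lemma unit_src (v : tangent x) :
  tdiff_at (gsrc GM) (gsrc_unit GM x) (tdiff (gunit GM) x v) = v.
Proof.
have e : scomp (gsrc GM) (gunit GM) x = x by rewrite /= gsrc_unit.
by rewrite (tdiff_at_comp _ _ e); apply: tdiff_at_id => z; exact: gsrc_unit.
Qed.

Lemma unit_tgt (v : tangent x) :
  tdiff_at (gtgt GM) (gtgt_unit GM x) (tdiff (gunit GM) x v) = v.
Proof.
have e : scomp (gtgt GM) (gunit GM) x = x by rewrite /= gtgt_unit.
by rewrite (tdiff_at_comp _ _ e); apply: tdiff_at_id => z; exact: gtgt_unit.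
Qed.

(** The units split the source map along x, so that the tangent space of G at
the unit projects onto the algebroid fibre. *)
Lemma lie_alg_proj : exists p : hom (tangent (gunit GM x)) (lie_alg GM x),
  forall xi, ssval (p xi) =
    xi - tdiff (gunit GM) x (tdiff_at (gsrc GM) (gsrc_unit GM x) xi).
Proof.
have k xi : tdiff (gsrc GM) (gunit GM x)
    (xi - tdiff (gunit GM) x (tdiff_at (gsrc GM) (gsrc_unit GM x) xi)) = 0.
  by apply: (tdiff_at_eq0 (gsrc_unit GM x) _).1; rewrite homB unit_src subrr.
have l : linear (fun xi => mksub (S := ker_space (tdiff (gsrc GM) (gunit GM x))) (k xi)
    : lie_alg GM x).
  move=> a u v; apply: val_inj.
  pose q := hcomp (tdiff (gunit GM) x) (tdiff_at (gsrc GM) (gsrc_unit GM x)).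
  change (a *: u + v - q (a *: u + v) = a *: (u - q u) + (v - q v)).
  by rewrite !homP scalerBr opprD addrACA.
by exists (mkhom l).
Qed.

End LieAlgebroid.

Section MoritaTangent.
Context {R : realType}.
Variables (L' L : lb_groupoid R) (F : vbg_mor L' L).
Hypothesis FM : is_vb_morita F.
Variable y : gobj L'.
Let G := gbase L.
Let H := gbase L'.
Let x := fobj F y.
Let d := tdiff (fobj F) y.
Let phi := lie_alg_map (f_mor F) y.
Let dphi := tdiff_at (farr F) (gm_unit (f_mor F) y).

Lemma morita_splitting :
  exists (lG : hom (tangent (gunit G x)) (tangent (gunit H y)))
    (l1 l2 : hom (tangent y) (tangent (gunit H y))),
  (forall xi : tangent (gunit H y), lG (dphi xi)
     + l1 (tdiff_at (gsrc H) (gsrc_unit H y) xi)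
     + l2 (tdiff_at (gtgt H) (gtgt_unit H y) xi) = xi) /\
  (forall (eta : tangent (gunit G x)) (v1 v2 : tangent y),
     tdiff_at (gsrc G) (gsrc_unit G x) eta = d v1 ->
     tdiff_at (gtgt G) (gtgt_unit G x) eta = d v2 ->
     let xi := lG eta + l1 v1 + l2 v2 in
     [/\ dphi xi = eta, tdiff_at (gsrc H) (gsrc_unit H y) xi = v1 &
       tdiff_at (gtgt H) (gtgt_unit H y) xi = v2]).
Proof.
apply: transverse_pullback.
- exact: gm_src (f_mor F).
- exact: gm_tgt (f_mor F).
- exact: base_pull_exists.
- exact: base_pull_unique.
- exact: morita_transv_src.
- exact: morita_transv_tgt.
Qed.

Lemma anchor_morita (b : lie_alg H y) : d (anchor H y b) = anchor G x (phi b).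
Proof.
have e1 : scomp (fobj F) (gtgt H) (gunit H y) = x by rewrite /= gtgt_unit.
have e2 : scomp (gtgt G) (farr F) (gunit H y) = x.
  by rewrite /= (gm_unit (f_mor F)) gtgt_unit.
change (tdiff_at (fobj F) erefl (tdiff_at (gtgt H) (gtgt_unit H y) (ssval b))
  = tdiff_at (gtgt G) (gtgt_unit G x) (dphi (ssval b))).
rewrite (tdiff_at_comp _ _ e1) (tdiff_at_comp _ _ e2).
by apply: tdiff_at_eq => h; rewrite /= (gm_tgt (f_mor F)).
Qed.

(** This lemma, the next and morita_tangent_span say together that the tangent
space of M at f y is the pushout, and the algebroid fibre of H at y the
pullback, in the square formed by the two anchors, df and f on the algebroid
fibres. *)
Lemma morita_alg_inj (b : lie_alg H y) : phi b = 0 -> anchor H y b = 0 -> b = 0.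
Proof.
have [lG [l1 [l2 [lK _]]]] := morita_splitting.
move=> pb rb; apply: val_inj => /=; rewrite -(lK (ssval b)) lie_alg_src.
have -> : dphi (ssval b) = 0 by exact: (congr1 (fun c => ssval c) pb).
have -> : tdiff_at (gtgt H) (gtgt_unit H y) (ssval b) = 0 by exact: rb.
by rewrite !hom0 !addr0.
Qed.

Lemma morita_alg_lift (a : lie_alg G x) (v : tangent y) : anchor G x a = d v ->
  exists2 b, phi b = a & anchor H y b = v.
Proof.
have [lG [l1 [l2 [_ lP]]]] := morita_splitting.
move=> av; have [||e1 e2 e3] := lP (ssval a) 0 v.
- by rewrite lie_alg_src hom0.
- exact: av.
have [b bE] := lie_alg_lift e2; exists b.
  by apply: val_inj; change (dphi (ssval b) = ssval a); rewrite bE.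
change (tdiff_at (gtgt H) (gtgt_unit H y) (ssval b) = v); by rewrite bE.
Qed.

Lemma morita_tangent_span (w : tangent x) :
  exists (v : tangent y) (a : lie_alg G x), w = d v + anchor G x a.
Proof.
have [xi [v [sxi <-]]] := morita_transv_tgt FM w.
have [|a aE] := @lie_alg_lift _ _ _ G x (xi - tdiff (gunit G) x (d v)).
  by rewrite homB sxi unit_src subrr.
exists v, a.
change (anchor G x a) with (tdiff_at (gtgt G) (gtgt_unit G x) (ssval a)).
by rewrite aE homB unit_tgt addrC subrK.
Qed.

(** The splitting gives a left inverse of (f, rho'), by which functionals on
the algebroid fibre of H are extended; no dimension count or choice of a
complement is involved. *)
Lemma morita_alg_retract :
  exists (p1 : hom (lie_alg G x) (lie_alg H y)) (p2 : hom (tangent y) (lie_alg H y)),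
  forall b, p1 (phi b) + p2 (anchor H y b) = b.
Proof.
have [lG [l1 [l2 [lK _]]]] := morita_splitting; have [p pE] := lie_alg_proj H y.
exists (hcomp p (hcomp lG (ker_incl _))), (hcomp p l2) => b.
change (p (lG (dphi (ssval b))) + p (l2 (tdiff_at (gtgt H) (gtgt_unit H y) (ssval b))) = b).
have := lK (ssval b); rewrite lie_alg_src hom0 addr0 -homD => ->.
by apply: val_inj; rewrite /= pE lie_alg_src hom0 subr0.
Qed.

End MoritaTangent.

(** * Quasi-isomorphisms from the tangent square *)

Section MoritaLinearAlgebra.
Context {R : realType}.
Variables (A' T' l' A T l : lmodType R).
Variables (rho' : hom A' T') (rho : hom A T) (theta : hom T l).
Variables (phi : hom A' A) (d : hom T' T) (e : hom l' l).
Let theta' := hcomp (hinv e) (hcomp theta d).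

Hypothesis d_rho : forall b, d (rho' b) = rho (phi b).
Hypothesis theta_rho : forall a, theta (rho a) = 0.
Hypothesis e_bij : bijective e.
Hypothesis phi_inj : forall b, phi b = 0 -> rho' b = 0 -> b = 0.
Hypothesis phi_lift : forall a v, rho a = d v -> exists2 b, phi b = a & rho' b = v.
Hypothesis span : forall w, exists v a, w = d v + rho a.

Let eK : cancel e (hinv e). Proof. by have [] := hinvP e_bij. Qed.
Let eV : cancel (hinv e) e. Proof. by have [] := hinvP e_bij. Qed.

Lemma theta'E v : e (theta' v) = theta (d v). Proof. exact: eV. Qed.

Lemma theta'_rho' b : theta' (rho' b) = 0.
Proof. by apply: (can_inj eK); rewrite theta'E d_rho theta_rho hom0. Qed.

Lemma kernel_quasi_iso :
  quasi_iso (@CpxMap _ (Cpx rho' theta') (Cpx rho theta) phi d e).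
Proof.
split; split=> /=.
- exact: theta'_rho'.
- exact: theta_rho.
- by split=> [b|v]; [exact: d_rho|exact: theta'E].
- split=> [b rb [r pb]|a ra].
    by exists 0; rewrite hom0; apply: phi_inj => //; rewrite pb.
  have [|b pb rb] := @phi_lift a 0; first by rewrite ra hom0.
  by exists b; split=> //; exists 0; rewrite pb subrr hom0.
- split=> [v _ [a va]|w tw].
    by have [b _ rb] := phi_lift (esym va); exists b.
  have [v [a wE]] := span w; exists v; split; last by exists a; rewrite wE addrC addKr.
  by apply: (can_inj eK); rewrite hom0 theta'E; move: tw; rewrite wE homD theta_rho addr0.
- split=> [u _ [w ew]|u _].
    have [v [a wE]] := span w; exists v; apply: (can_inj eK); rewrite theta'E.
    by rewrite ew wE homD theta_rho addr0.
  by exists (hinv e u); split=> //; exists 0; rewrite eV subrr hom0.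
Qed.

(** T is the pushout of T' and A over A'. *)
Lemma pushout_hom (U : lmodType R) (beta : hom T' U) (gamma : hom A U) :
  (forall b, beta (rho' b) = gamma (phi b)) ->
  exists psi : hom T U, (forall v, psi (d v) = beta v) /\ forall a, psi (rho a) = gamma a.
Proof.
move=> bg.
have wd v a : d v + rho a = 0 -> beta v + gamma a = 0.
  move=> va; have [|b pb <-] := @phi_lift (- a) v.
    by rewrite homN; apply/eqP; rewrite eq_sym -addr_eq0 va.
  by rewrite bg pb homN addNr.
have /choice[g gP] w : exists u, forall v a, w = d v + rho a -> u = beta v + gamma a.
  have [v0 [a0 w0]] := span w; exists (beta v0 + gamma a0) => v a wE.
  apply/eqP; rewrite -subr_eq0 opprD addrACA -!homB wd//.
  by rewrite !homB addrACA -opprD -w0 -wE subrr.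
have gl : linear g.
  move=> c w w'; have [v [a wE]] := span w; have [v' [a' wE']] := span w'.
  rewrite (gP w v a)// (gP w' v' a')// (gP _ (c *: v + v') (c *: a + a')) ?homP.
    by rewrite scalerDr addrACA.
  by rewrite wE wE' scalerDr addrACA.
exists (mkhom gl); split=> [v|a] /=.
  by rewrite (gP _ v 0) ?hom0 ?addr0.
by rewrite (gP _ 0 a) ?hom0 ?add0r.
Qed.

Variables (p1 : hom A A') (p2 : hom T' A').
Hypothesis retract : forall b, p1 (phi b) + p2 (rho' b) = b.

(** For surjectivity in degree 0 and injectivity in degree 1, the required
functional on T is glued by pushout_hom; surjectivity in degree 1 holds because
the retraction (p1, p2) writes every functional on A' as the sum of one that
comes from A and of one that extends to T'. *)
Lemma dual_quasi_iso :
  quasi_iso (@CpxMap _ (Cpx (hscalel theta) (precomp l rho))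
    (Cpx (hscalel theta') (precomp l' rho')) (hid _)
    (hcomp (precomp _ d) (postcomp _ (hinv e)))
    (hcomp (precomp _ phi) (postcomp _ (hinv e)))).
Proof.
have homE (U V : lmodType R) (f g : hom U V) u : f = g -> f u = g u by move=> ->.
split; split=> /=.
- move=> r; apply: hom_ext => a; change (r *: theta (rho a) = 0).
  by rewrite theta_rho scaler0.
- move=> r; apply: hom_ext => b; change (r *: theta' (rho' b) = 0).
  by rewrite theta'_rho' scaler0.
- split=> [r|psi]; apply: hom_ext => v.
    change (hinv e (r *: theta (d v)) = r *: theta' v).
    by rewrite homZ.
  change (hinv e ((psi : hom T l) (rho (phi v))) = hinv e ((psi : hom T l) (d (rho' v)))).
  by rewrite d_rho.
- split=> [r _ [s rs]|r rt]; first by exists 0; rewrite hom0; exact: rs.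
  exists r; split; last by exists 0; rewrite hom0 subrr.
  apply: hom_ext => w; have [v [a ->]] := span w.
  change (r *: theta (d v + rho a) = 0).
  rewrite homD theta_rho addr0 -theta'E -homZ.
  have -> : r *: theta' v = 0 by exact: (homE _ _ _ _ v rt).
  exact: hom0.
- split=> [psi0 pr [r pE]|psi0' pr'].
    pose psi : hom T l := psi0.
    exists r; apply: hom_ext => w; have [v [a ->]] := span w.
    change (psi (d v + rho a) = r *: theta (d v + rho a)).
    have pa : psi (rho a) = 0 by exact: (homE _ _ _ _ a pr).
    rewrite !homD theta_rho pa !addr0 -theta'E -homZ.
    have <- : hinv e (psi (d v)) = r *: theta' v by exact: (homE _ _ _ _ v pE).
    by rewrite eV.
  pose psi' : hom T' l' := psi0'.
  have [|psi [pd pa]] := @pushout_hom l (hcomp e psi') 0.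
    move=> b; change (e (psi' (rho' b)) = 0).
    by have -> : psi' (rho' b) = 0 by [exact: (homE _ _ _ _ b pr')]; rewrite hom0.
  exists psi; split; first by apply: hom_ext => a; exact: pa.
  exists 0; rewrite hom0; apply: hom_ext => v.
  change (psi' v - hinv e (psi (d v)) = 0).
  by rewrite pd /= eK subrr.
- split=> [alpha0 _ [psi0' aE]|alpha0' _].
    pose alpha : hom A l := alpha0; pose psi' : hom T' l' := psi0'.
    have [|psi [pd pa]] := @pushout_hom l (hcomp e psi') alpha.
      move=> b; change (e (psi' (rho' b)) = alpha (phi b)).
      have <- : hinv e (alpha (phi b)) = psi' (rho' b) by exact: (homE _ _ _ _ b aE).
      by rewrite eV.
    by exists psi; apply: hom_ext => a; rewrite -pa.
  pose alpha' : hom A' l' := alpha0'.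
  exists (hcomp e (hcomp alpha' p1)); split=> //; exists (hcomp alpha' p2).
  apply: hom_ext => b.
  change (alpha' b - hinv e (e (alpha' (p1 (phi b)))) = alpha' (p2 (rho' b))).
  by rewrite eK -{1}(retract b) homD addrC addKr.
Qed.

End MoritaLinearAlgebra.

(** * Lie derivatives and the functional of a connection *)

Section Curves.
Context {R : realType}.

Lemma curve_smooth (M : manifold R) (g : R -> M) (e : R) (h : M -> R) :
  smooth_curve_at g e -> smooth_fun h -> smooth_at (h \o g : R^o -> R^o) e.
Proof.
move=> [gc gs] sh; have [d dA dg] := atlas_cover (g e).
have E : smooth_at ((h \o cinv d) \o (d \o g) : R^o -> R^o) e.
  by apply: smooth_at_comp; [exact: gs|exact: sh].
apply: smooth_at_near E; have ng : nbhs e (g @^-1` cdom d) by exact: (gc _ (chart_nbhs dg)).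
by apply: filterS ng => u gu /=; rewrite cmapK.
Qed.

Lemma smooth_curve_comp (M : manifold R) p (Y : smap (rn p) M) (k : R^o -> 'rV[R]_p) (e : R) :
  smooth_at k e -> smooth_curve_at ((fun u => Y (k u)) : R -> M) e.
Proof.
move=> sk; split.
  apply: (@continuous_comp _ _ _ (k : R -> 'rV[R]_p) (Y : 'rV[R]_p -> M)).
    exact: smooth_at_cont sk.
  exact: (@smap_cont _ _ _ Y (k e)).
move=> c cA cg; apply: smooth_at_row => i.
have sc := smooth_fun_at_coord i (adm_chart cA) cg.
have sY : smooth_map_at Y (k e) by move/smooth_mapE: (smapP Y); exact.
have [h /smooth_fun_rn sh hE] := smooth_fun_at_germ (smooth_fun_at_comp sY sc).
have E : smooth_at ((fun u => c (Y u) 0 i) : 'rV[R]_p -> R^o) (k e).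
  by apply: smooth_at_near (sh (k e)).
exact: (smooth_at_comp sk E).
Qed.

(** The source map is a submersion: in coordinates, and for w those of the
vector, the curve is u |-> c (u w E), with c and E from level_set. *)
Lemma represents_exists (L : lb_groupoid R) (x : gobj L) (a : lie_alg (gbase L) x) :
  exists g, represents g a.
Proof.
set G := gbase L in a *; pose g0 := gunit G x.
have [X [Y [YX XY]]] := global_coords g0.
have [XM [YM [YXM XYM]]] := global_coords x.
pose p := mdim (garr L).
pose Psi (u : rn p) : rn (mdim (gobj L)) := XM (gsrc G (Y u)).
have sPsi : smooth_map Psi by exact: (smapP (scomp XM (scomp (gsrc G) Y))).
have Y0 : Y (X g0) = g0 by exact: nbhs_singleton YX.
have dPsi (v : tangent g0) : 'D_(tvec X v) (Psi : 'rV[R]_p -> 'rV[R]_(mdim (gobj L))) (X g0 : 'rV[R]_p)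
    = tvec XM (tdiff_at (gsrc G) (gsrc_unit G x) v).
  rewrite -tan_chain_map//; last exact: smapP.
  rewrite tvec_comp; last exact: smapP.
  apply: tvec_near.
  - exact: (smooth_map_comp (smapP X) sPsi).
  - exact: smapP (scomp XM (gsrc G)).
  - by apply: filterS YX => z zE; rewrite /Psi zE.
have surj k : exists w, 'D_w (Psi : 'rV[R]_p -> 'rV[R]_(mdim (gobj L))) (X g0 : 'rV[R]_p) = k.
  have [w <-] := @tan_of_tvec _ _ x XM YM k YXM XYM.
  have [v <-] := surj_submersion_at (gsrc_unit G x) w (gsrc_subm G).
  by exists (tvec X v).
have [E [c [sc c0 Psic _ dc]]] := @level_set R _ _ (Psi : 'rV[R]_p -> 'rV[R]_(mdim (gobj L)))
  (X g0 : 'rV[R]_p) ((smooth_map_rn_rn _).2 sPsi) surj.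
pose w := tvec X (ssval a).
pose lin (u : R^o) : 'rV[R]_p := u *: (w *m E).
have linl : linear lin by move=> b u v; rewrite /lin scalerDl scalerA.
have linc : continuous lin by move=> u; apply: cvgZr_tmp; exact: cvg_id.
have slin : smooth_at lin 0 by exact: (smooth_at_lin linl linc (smooth_at_id (0 : R^o))).
have lin0 : lin 0 = 0 by rewrite /lin scale0r.
pose k := c \o lin.
have sk : smooth_at k 0 by apply: smooth_at_compr => //; rewrite lin0.
have k0 : k 0 = X g0 by rewrite /k /= lin0 c0.
have dk : 'D_1 k (0 : R^o) = w.
  rewrite /k smooth_at_compW ?lin0//.
  have [_ dlin] := derive_lin (1 : R^o) linl linc (smooth_at_diff (smooth_at_id (0 : R^o))).
  have -> : 'D_1 lin (0 : R^o) = w *m E by rewrite [LHS]dlin derive_id /lin scale1r.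
  by apply: dc; rewrite dPsi lie_alg_src; apply/rowP => i; rewrite !mxE.
have dh h : smooth_fun h -> 'D_1 ((h \o Y) \o k : R^o -> R^o) (0 : R^o) = (ssval a : tangent g0) h.
  move=> sh; have shY : smooth_fun (h \o Y) by exact: (smooth_map_fun (smapP Y) sh).
  rewrite (smooth_at_compW _ sk) ?k0; last exact: ((smooth_fun_rn _).1 shY).
  rewrite dk -(tan_chain _ (smapP X) shY); apply: tan_local => //.
    exact: (smooth_map_fun (smapP X) shY).
  by apply: filterS YX => z /= ->.
exists (fun u => Y (k u)); split.
- by rewrite k0 Y0.
- have kc : {for (0 : R^o), continuous (k : R^o -> 'rV[R]_p)} by exact: smooth_at_cont.
  have n1 : nbhs (0 : R^o) (lin @^-1` [set z | Psi (c z) = Psi (X g0)]).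
    by apply: linc; rewrite lin0.
  have n2 : nbhs (0 : R^o) (k @^-1` [set u | YM (XM (gsrc G (Y u))) = gsrc G (Y u)]).
    apply: kc; rewrite k0.
    have nx : nbhs (scomp (gsrc G) Y (X g0)) [set z | YM (XM z) = z].
      by rewrite /= Y0 gsrc_unit; exact: YXM.
    have hc := @smap_cont _ _ _ (scomp (gsrc G) Y) (X g0).
    exact: (hc _ nx).
  apply: filterS (filterI n1 n2) => u /= [e1 e2]; rewrite -e2.
  change (YM (Psi (k u)) = x).
  rewrite /k /= e1 /Psi Y0 gsrc_unit; exact: (nbhs_singleton YXM).
- exact: smooth_curve_comp.
- move=> h sh; rewrite derive1E -dh//.
Qed.

End Curves.

Lemma tan_eval_linear (R : realType) (M : manifold R) (x : M) (h : M -> R) :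
  linear (fun v : tangent x => v h : R^o).
Proof. by []. Qed.

Section LieDerivative.
Context {R : realType}.
Variable L : lb_groupoid R.
Let G := gbase L.

Lemma pull_vsrc (e : section (bobj L)) g :
  vb_fib (vsrc L) g (pull_section (vsrc L) e g) = e (gsrc G g).
Proof. by have [_] := hinvP (vsrc_bij g); apply. Qed.

Lemma pull_vtgt (e : section (bobj L)) g :
  vb_fib (vtgt L) g (pull_section (vtgt L) e g) = e (gtgt G g).
Proof. by have [_] := hinvP (vtgt_bij g); apply. Qed.

Lemma section_eq0 (e : section (bobj L)) (x x' : gobj L) :
  x' = x -> e x != 0 -> e x' != 0.
Proof. by move=> ->. Qed.

(** Both are the unit of the vector e x. *)
Lemma pull_unit (e : section (bobj L)) (x : gobj L) :
  pull_section (vtgt L) e (gunit G x) = pull_section (vsrc L) e (gunit G x).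
Proof.
pose u := vb_fib (vunit L) x (e x).
have uE : gunit (gtot L) (vin (bobj L) (e x)) = vin (barr L) u by rewrite vunitE vb_totE.
have tu : vb_fib (vtgt L) (gunit G x) u = e (gtgt G (gunit G x)).
  by apply: vin_inj; rewrite -vtgt_vin -uE !gtgt_unit.
have su : vb_fib (vsrc L) (gunit G x) u = e (gsrc G (gunit G x)).
  by apply: vin_inj; rewrite -vsrc_vin -uE !gsrc_unit.
transitivity u; first by apply: (bij_inj (vtgt_bij (gunit G x))); rewrite pull_vtgt.
by apply: (bij_inj (vsrc_bij (gunit G x))); rewrite pull_vsrc.
Qed.

Variables (x : gobj L) (e : section (bobj L)) (c : garr L -> R).
Hypotheses (se : smooth_section e) (e0 : e x != 0) (sc : smooth_fun c).
Hypothesis cE : \forall g \near gunit G x,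
  pull_section (vtgt L) e g = c g *: pull_section (vsrc L) e g.

Lemma ratio_unit : c (gunit G x) = 1.
Proof.
have := nbhs_singleton cE; rewrite pull_unit => E.
apply/eqP; rewrite -subr_eq0; apply/negPn/negP => c1.
have w0 : pull_section (vsrc L) e (gunit G x) = 0.
  apply: (scalerI c1); rewrite scaler0 scalerBl scale1r.
  by apply/eqP; rewrite subr_eq0 -E.
have := section_eq0 (gsrc_unit G x) e0.
by rewrite -pull_vsrc w0 hom0 eqxx.
Qed.

Section Frame.
Variables (l : gobj L -> R) (lam : section (bobj L)).
Hypotheses (sl : smooth_fun l) (lE : \forall z \near x, lam z = l z *: e z).
Variable a : lie_alg G x.

Let k g := l (gtgt G g) * c g.

Let sk : smooth_fun k.
Proof. by apply: smooth_funM => //; exact: (smooth_map_fun (smapP (gtgt G)) sl). Qed.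

Let act_near (g : R -> garr L) : represents g a ->
  \forall u \near (0 : R), forall w : fib (bobj L) x,
    acts (ginv G (g u)) (vin (bobj L) (lam (gtgt G (g u)))) (vin (bobj L) w)
    <-> w = k (g u) *: e x.
Proof.
move=> [g0 gs [gc' _] _].
have gc B : nbhs (gunit G x) B -> nbhs (0 : R) (g @^-1` B) by rewrite -g0; exact: gc'.
have n1 : nbhs (0 : R) (g @^-1` [set h | pull_section (vtgt L) e h
    = c h *: pull_section (vsrc L) e h]) by exact: gc cE.
have n2 : nbhs (0 : R) (g @^-1` [set h | lam (gtgt G h) = l (gtgt G h) *: e (gtgt G h)]).
  apply: gc; have hc := @smap_cont _ _ _ (gtgt G) (gunit G x).
  have nt : nbhs (gtgt G (gunit G x)) [set z | lam z = l z *: e z] by rewrite gtgt_unit.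
  exact: (hc _ nt).
apply: filterS (filterI gs (filterI n1 n2)) => u [us [u1 u2]] w; rewrite /= in u1 u2.
set h := g u in us u1 u2 *.
pose l0 := k h *: pull_section (vsrc L) e h.
have tl0 : vb_fib (vtgt L) h l0 = lam (gtgt G h).
  by rewrite /l0 /k -scalerA -u1 homZ pull_vtgt u2.
have sl0 : vin (bobj L) (vb_fib (vsrc L) h l0) = vin (bobj L) (k h *: e x).
  by rewrite homZ pull_vsrc us.
rewrite actsV; split=> [[l1 [t1 s1]]|->].
  apply: vin_inj; rewrite s1 -sl0; congr (vin _ (vb_fib _ _ _)).
  by apply: (bij_inj (vtgt_bij h)); rewrite tl0; apply: vin_inj; rewrite t1.
by exists l0; rewrite tl0 sl0.
Qed.

Let phi_derive (g : R -> garr L) (phi : hom (fib (bobj L) x) R^o) : represents g a ->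
  is_derive (0 : R^o) (1 : R^o) (fun u : R^o => phi (k (g u) *: e x))
    (phi ((ssval a : tangent (gunit G x)) k *: e x)).
Proof.
move=> [g0 _ gsm gv].
have -> : (fun u : R^o => phi (k (g u) *: e x)) = phi (e x) \*: (k \o g : R^o -> R^o).
  by apply/funext => u; rewrite homZ fctE; exact: mulrC.
rewrite homZ (_ : _ *: _ = phi (e x) *: ((ssval a : tangent (gunit G x)) k : R^o)); last exact: mulrC.
apply: is_deriveZ; apply: DeriveDef.
  exact/diff_derivable/smooth_at_diff/curve_smooth.
by rewrite gv// derive1E.
Qed.

(** With lam = l e, and c the ratio of t^* e to s^* e, the curve g^-1.lam of
the definition is (l o t) c e along g, whatever the curve g chosen. *)
Lemma lie_deriv_frame : lie_deriv a lam = (ssval a : tangent (gunit G x)) k *: e x.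
Proof.
have ex : is_lie_deriv a lam ((ssval a : tangent (gunit G x)) k *: e x).
  have [g ga] := represents_exists a.
  exists g, (fun u => k (g u) *: e x); split=> // [|phi]; last exact: phi_derive.
  by apply: filterS (act_near ga) => u ->.
have [g [kap [ga gact gd]]] : is_lie_deriv a lam (lie_deriv a lam).
  by apply: xgetPex; exists ((ssval a : tangent (gunit G x)) k *: e x).
have [phi phi0] := line_functional (bobj L) x.
apply/eqP; rewrite -subr_eq0; apply/eqP/phi0; rewrite homB.
apply/eqP; rewrite subr_eq0; apply/eqP.
have d1 := gd phi; have d2 := phi_derive phi ga.
rewrite -(@derive_val _ _ _ _ _ _ _ d1) -(@derive_val _ _ _ _ _ _ _ d2).
apply: near_eq_derive; apply: filterS (filterI gact (act_near ga)) => u [ua uE].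
by congr (phi _); apply/uE.
Qed.

End Frame.

Variable nabla : connection (bobj L).

(** By lie_deriv_frame and the Leibniz rules, both D_a lam and nabla_(rho a)
lam contain (rho a)(l) e for lam = l e; what remains is proportional to lam. *)
Lemma Fnabla_exists : exists phi : hom (lie_alg G x) R^o,
  forall a lam, smooth_section lam ->
    lie_deriv a lam - nabla x lam (anchor G x a) = phi a *: lam x.
Proof.
have [pi0 pi0P] := line_functional (bobj L) x.
have pe : pi0 (e x) != 0 by apply: contra_neq e0 => /pi0P.
have piE v : v = (pi0 v / pi0 (e x)) *: e x.
  by have [r ->] := line_scal v e0; rewrite homZ [X in X / _](_ : _ = r * pi0 (e x))// mulfK.
pose f1 : hom (lie_alg G x) R^o := hcomp (mkhom (@tan_eval_linear _ _ (gunit G x) c)) (ker_incl _).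
pose f2 : hom (lie_alg G x) R^o := hcomp pi0 (hcomp (nabla x e) (anchor G x)).
exists (f1 - (pi0 (e x))^-1 *: f2) => a lam slam.
have [l sl lE] := line_ratio (@smooth_map_at_id _ _ x)
  (iffLR (smooth_sectionE _) slam x) (iffLR (smooth_sectionE _) se x) e0.
rewrite (lie_deriv_frame sl lE).
rewrite (conn_local _ _ slam (smooth_sectionZ sl se) lE) nab_leibniz//.
have slt : smooth_fun (l \o gtgt G) by exact: (smooth_map_fun (smapP (gtgt G)) sl).
have -> : (ssval a : tangent (gunit G x)) (fun g => l (gtgt G g) * c g)
    = (anchor G x a : tangent x) l + l x * (ssval a : tangent (gunit G x)) c.
  rewrite (tanM (ssval a : tangent (gunit G x)) slt sc) ratio_unit mulr1 /= gtgt_unit.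
  by congr (_ + _); rewrite -(tdiffE (gtgt_unit G x)).
rewrite (nbhs_singleton lE) scalerDl opprD addrACA subrr add0r.
change (l x * (ssval a : tangent (gunit G x)) c *: e x - l x *: nabla x e (anchor G x a)
  = ((ssval a : tangent (gunit G x)) c
     - (pi0 (e x))^-1 * pi0 (nabla x e (anchor G x a))) *: (l x *: e x)).
rewrite {1}(piE (nabla x e _)) !scalerA -scalerBl; congr (_ *: _).
by rewrite mulrBl mulrC [_^-1 * _]mulrC [_ / _ * _]mulrC.
Qed.

(** The only description of F_nabla used below. It expresses the Lie derivative
by the function c, which is natural under pullback. *)
Lemma FnablaE a : Fnabla nabla x a *: e x
  = (ssval a : tangent (gunit G x)) c *: e x - nabla x e (anchor G x a).
Proof.
have := xgetPex 0 Fnabla_exists => /(_ a e se); rewrite -/(Fnabla nabla x) => <-.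
congr (_ - _); rewrite (@lie_deriv_frame (fun=> 1))//.
- by congr (_ *: _); congr (_ _); apply/funext => g; rewrite mul1r.
- exact: smooth_fun_cst.
- by apply: nearW => z; rewrite scale1r.
Qed.

End LieDerivative.

(** * Comparison of the Morita curvatures *)

Section MoritaCurvatureMaps.
Context {R : realType}.

Lemma ratio_exists (L : lb_groupoid R) (x : gobj L) (e : section (bobj L)) :
  smooth_section e -> e x != 0 ->
  exists2 c : garr L -> R, smooth_fun c & \forall g \near gunit (gbase L) x,
    pull_section (vtgt L) e g = c g *: pull_section (vsrc L) e g.
Proof.
move=> se e0; set g0 := gunit (gbase L) x.
have sV := pull_section_smooth (@vtgt_bij _ L) se.
have sW := pull_section_smooth (@vsrc_bij _ L) se.
have w0 : pull_section (vsrc L) e g0 != 0.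
  apply: contra_neq (section_eq0 (gsrc_unit (gbase L) x) e0) => w0.
  by rewrite -pull_vsrc w0 hom0.
exact: (line_ratio (@smooth_map_at_id _ _ g0)
  (iffLR (smooth_sectionE _) sV g0) (iffLR (smooth_sectionE _) sW g0) w0).
Qed.

(** The equation s^* theta = t^* theta, evaluated at a unit on a vector killed
by ds. *)
Lemma form_anchor (L : lb_groupoid R) (theta : form1 (bobj L)) (x : gobj L) :
  (forall g : garr L, partial theta g = 0) ->
  forall a : lie_alg (gbase L) x, theta x (anchor (gbase L) x a) = 0.
Proof.
move=> tc a; set G := gbase L in a *; set g0 := gunit G x.
have E : hinv (vb_fib (vsrc L) g0) (theta (gsrc G g0) (tdiff (gsrc G) g0 (ssval a)))
    - hinv (vb_fib (vtgt L) g0) (theta (gtgt G g0) (tdiff (gtgt G) g0 (ssval a))) = 0.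
  exact: (congr1 (fun h : hom (tangent g0) (fib (barr L) g0) => h (ssval a)) (tc g0)).
have a0 : tdiff (gsrc G) g0 (ssval a) = 0 by exact: (subspP a).
rewrite a0 !hom0 sub0r in E.
have {}E : theta (gtgt G g0) (tdiff (gtgt G) g0 (ssval a)) = 0.
  have [_ K] := hinvP (vtgt_bij g0).
  rewrite -[LHS]K -[RHS](hom0 (vb_fib (vtgt L) g0)); congr (vb_fib _ _ _).
  by apply: oppr_inj; rewrite E oppr0.
have tr (z : gobj L) (gz : gtgt G g0 = z) : theta z (tdiff_at (gtgt G) gz (ssval a)) = 0.
  by case: _ / gz; exact: E.
exact: tr (gtgt_unit G x).
Qed.

Variables (L' L : lb_groupoid R) (F : vbg_mor L' L).
Hypothesis FM : is_vb_morita F.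
Let Fb := morita_fibre_bij FM.

Lemma Farr_inj (h : garr L') (u : fib (barr L') h) : vb_fib (Farr F) h u = 0 -> u = 0.
Proof.
move=> Fu; apply: (bij_inj (vsrc_bij h)); rewrite hom0.
apply: (bij_inj (Fb _)); rewrite hom0.
apply: (@vin_inj _ _ _ (bobj L)).
rewrite -vb_totE -vsrc_vin -(gm_src (F_mor F)) vb_totE Fu vsrc_vin hom0.
by rewrite (gm_src (f_mor F)).
Qed.

Lemma pull_Fobj (e : section (bobj L)) (y : gobj L') :
  vb_fib (Fobj F) y (pull_section (Fobj F) e y) = e (fobj F y).
Proof. by have [_] := hinvP (Fb y); apply. Qed.

Lemma Farr_pull_src (e : section (bobj L)) (h : garr L') :
  vb_fib (Farr F) h (pull_section (vsrc L') (pull_section (Fobj F) e) h)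
  = pull_section (vsrc L) e (farr F h).
Proof.
apply: (bij_inj (vsrc_bij (farr F h))); apply: (@vin_inj _ _ _ (bobj L)).
rewrite pull_vsrc -vsrc_vin -vb_totE (gm_src (F_mor F)) vsrc_vin pull_vsrc.
by rewrite vb_totE pull_Fobj (gm_src (f_mor F)).
Qed.

Lemma Farr_pull_tgt (e : section (bobj L)) (h : garr L') :
  vb_fib (Farr F) h (pull_section (vtgt L') (pull_section (Fobj F) e) h)
  = pull_section (vtgt L) e (farr F h).
Proof.
apply: (bij_inj (vtgt_bij (farr F h))); apply: (@vin_inj _ _ _ (bobj L)).
rewrite pull_vtgt -vtgt_vin -vb_totE (gm_tgt (F_mor F)) vtgt_vin pull_vtgt.
by rewrite vb_totE pull_Fobj (gm_tgt (f_mor F)).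
Qed.

Variables (nabla : connection (bobj L)) (nabla' : connection (bobj L')).
Hypothesis pull_nabla : is_pull_connection (Fobj F) nabla nabla'.

(** If c is the ratio attached to the frame e, then c o f is the ratio attached
to the frame F^* e: FnablaE on both sides is compared. *)
Lemma Fnabla_morita (y : gobj L') (b : lie_alg (gbase L') y) :
  Fnabla nabla' y b = Fnabla nabla (fobj F y) (lie_alg_map (f_mor F) y b).
Proof.
have [e se e0] := line_frame (bobj L) (fobj F y).
have [c sc cE] := ratio_exists se e0.
set e' := pull_section (Fobj F) e; have se' : smooth_section e'.
  exact: pull_section_smooth.
have e'0 : e' y != 0.
  by apply: contra_neq e0 => e'0; rewrite -pull_Fobj -/e' e'0 hom0.
have cE' : \forall h \near gunit (gbase L') y,
    pull_section (vtgt L') e' h = (c \o farr F) h *: pull_section (vsrc L') e' h.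
  have n : nbhs (gunit (gbase L') y) (farr F @^-1` [set g |
      pull_section (vtgt L) e g = c g *: pull_section (vsrc L) e g]).
    have hc := @smap_cont _ _ _ (farr F) (gunit (gbase L') y).
    have nc : nbhs (farr F (gunit (gbase L') y)) [set g |
      pull_section (vtgt L) e g = c g *: pull_section (vsrc L) e g].
      by rewrite (gm_unit (f_mor F)); exact: cE.
    exact: (hc _ nc).
  apply: filterS n => h hE; apply/eqP; rewrite -subr_eq0; apply/eqP/Farr_inj.
  by rewrite homB homZ Farr_pull_src Farr_pull_tgt hE subrr.
have sc' : smooth_fun (c \o farr F) by exact: (smooth_map_fun (smapP (farr F)) sc).
have := FnablaE se' e'0 sc' cE' nabla' b.
move=> /(congr1 (vb_fib (Fobj F) y)).
rewrite homB !homZ pull_Fobj (pull_nabla se).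
have [_ K] := hinvP (Fb y); rewrite K.
have -> : (ssval b : tangent (gunit (gbase L') y)) (c \o farr F)
    = (ssval (lie_alg_map (f_mor F) y b) : tangent (gunit (gbase L) (fobj F y))) c.
  by rewrite -(tdiffE (gm_unit (f_mor F) y)).
rewrite anchor_morita -(FnablaE se e0 sc cE) => /eqP.
rewrite -subr_eq0 -scalerBl scaler_eq0 (negPf e0) orbF subr_eq0.
by move=> /eqP.
Qed.

Lemma curvature_morita (theta : form1 (bobj L)) (y : gobj L') : smooth_form theta ->
  morita_curvature nabla' (pull_form (Fobj F) theta) y
  = cpx_comp (dual_map F theta y)
      (cpx_comp (morita_curvature nabla theta (fobj F y)) (kernel_map F theta y)).
Proof.
move=> sth; congr (CpxMap _ _ _); apply: hom_ext => u.
- change (- (Fnabla nabla' y u)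
    = - (Fnabla nabla (fobj F y) (lie_alg_map (f_mor F) y u))).
  by rewrite Fnabla_morita.
- apply: hom_ext => w.
  change ((cov_diff nabla' (pull_form (Fobj F) theta) y u : hom _ _) w
    = hinv (vb_fib (Fobj F) y) ((cov_diff nabla theta (fobj F y)
        (tdiff (fobj F) y u) : hom _ _) (tdiff (fobj F) y w))).
  exact: (@cov_diff_pull R _ _ _ _ _ (Fobj F) theta nabla nabla' y u w Fb sth pull_nabla).
- apply: hom_ext => b.
  change (Fnabla nabla' y b *: u = hinv (vb_fib (Fobj F) y)
    (Fnabla nabla (fobj F y) (lie_alg_map (f_mor F) y b) *: vb_fib (Fobj F) y u)).
  have [K _] := hinvP (Fb y).
  by rewrite homZ K Fnabla_morita.
Qed.

End MoritaCurvatureMaps.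

Theorem proposition5p2p16 (R : realType) (L' L : lb_groupoid R)
    (F : vbg_mor L' L) (F_morita : is_vb_morita F)
    (theta : form1 (bobj L)) (theta_smooth : smooth_form theta)
    (theta_closed : forall g : garr L, partial theta g = 0)
    (nabla : connection (bobj L)) (nabla' : connection (bobj L'))
    (nabla'_pull : is_pull_connection (Fobj F) nabla nabla')
    (y : gobj L') :
  let theta' := pull_form (Fobj F) theta in
  [/\ quasi_iso (kernel_map F theta y),
      quasi_iso (dual_map F theta y) &
      morita_curvature nabla' theta' y
      = cpx_comp (dual_map F theta y)
          (cpx_comp (morita_curvature nabla theta (fobj F y))
             (kernel_map F theta y))].
Proof.
have Fb := morita_fibre_bij F_morita y.
have theta_rho := form_anchor (x := fobj F y) theta_closed.
have [p1 [p2 retract]] := morita_alg_retract F_morita y.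
split.
- apply: kernel_quasi_iso => //.
  + exact: anchor_morita.
  + exact: morita_alg_inj.
  + exact: morita_alg_lift.
  + exact: morita_tangent_span.
- apply: (@dual_quasi_iso _ _ _ _ _ _ _ _ _ _ _ _ _ _ _ _ _ _ p1 p2) => //.
  + exact: anchor_morita.
  + exact: morita_alg_lift.
  + exact: morita_tangent_span.
- exact: curvature_morita.
Qed.
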